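(* Let $n$ be a positive integer and let $\mathcal{K}$ be either $\mathcal{R}$ or $\mathcal{C}$ (see context). Then \[ \nu(\operatorname{cone}(\mathrm{PM}^+_n(\mathcal{K}))) \;=\; \nu(\mathrm{Gr}_{\mathcal{K}}(n,2n)) \cap \mathcal{L}_n \;=\; \nu(\mathrm{Fl}_{\mathcal{K}}(n)) \cap \mathrm{SUBMOD}_n , \] and, taking Euclidean closures, \[ \operatorname{trop}(\operatorname{cone}(\mathrm{PM}^+_n(\mathcal{K}))) \;=\; \operatorname{trop}(\mathrm{Gr}_{\mathcal{K}}(n,2n)) \cap \mathcal{L}_n \;=\; \operatorname{trop}(\mathrm{Fl}_{\mathcal{K}}(n)) \cap \mathrm{SUBMOD}_n , \] where $\mathcal{L}_n$ is identified with $\mathbb{R}^{2^{[n]}}$ via $\phi$.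
   Context: $\mathcal{R}$ is a real closed field with a nontrivial valuation $\mathrm{val}:\mathcal{R}^*\to\mathbb{R}$ whose residue field is infinite, and we set $\nu=-\mathrm{val}$ (so $\nu(ab)=\nu(a)+\nu(b)$, $\nu(a+b)\le\max(\nu(a),\nu(b))$); the valuation is compatible with the order: $0<a<b$ implies $\nu(a)\le\nu(b)$. $\mathcal{C}=\mathcal{R}(\mathrm{i})$ with $\mathrm{i}^2=-1$, complex conjugation $\overline{a+\mathrm{i}b}=a-\mathrm{i}b$, and $\nu(a+\mathrm{i}b)=\max(\nu(a),\nu(b))$. For a set $X\subseteq \mathcal{K}^N$, $\nu(X)=\{(\nu(x_1),\dots,\nu(x_N)) : x\in X,\ \text{all } x_i\neq 0\}$ and $\operatorname{trop}(X)$ denotes the closure of $\nu(X)$ in the Euclidean topology of $\mathbb{R}^N$. For an $n\times n$ matrix $A$ and $S\subseteq[n]$, $A_S$ is the principal minor on rows and columns $S$ ($A_\emptyset=1$). A symmetric matrix over $\mathcal{R}$ (resp. Hermitian matrix over $\mathcal{C}$) is positive definite if all its principal minors are positive. $\mathrm{PM}^+_n(\mathcal{K})=\{(A_S)_{S\subseteq[n]} : A \text{ positive definite } n\times n \text{ over } \mathcal{K}\}\subseteq \mathcal{R}^{2^{[n]}}$, and $\operatorname{cone}(\mathrm{PM}^+_n(\mathcal{K}))=\{\lambda a: \lambda\in\mathcal{K}, a\in \mathrm{PM}^+_n(\mathcal{K})\}$. $\mathrm{Gr}_{\mathcal{K}}(n,2n)\subseteq \mathcal{K}^{\binom{[2n]}{n}}$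 is the set of vectors $(\det M(C))_{C\in\binom{[2n]}{n}}$ of maximal minors of matrices $M\in\mathcal{K}^{n\times 2n}$ ($M(C)$ = columns indexed by $C$). The affine flag variety $\mathrm{Fl}_{\mathcal{K}}(n)\subseteq \mathcal{K}^{2^{[n]}}$ consists of vectors $(q_S)_{S\subseteq[n]}$ for which there is a complete flag $\{0\}=L_0\subset L_1\subset\cdots\subset L_n=\mathcal{K}^n$ ($\dim L_k=k$) and nonzero scalars $c_0,\dots,c_n\in\mathcal{K}$ with $(q_S)_{|S|=k}=c_k\,(\det M_k(S))_{|S|=k}$ for each $k$, where $M_k$ is a $k\times n$ matrix whose rows span $L_k$ (its Plücker vector; for $k=0$ this is the empty determinant $1$). $\mathrm{SUBMOD}_n$ is the set of submodular functions $F:2^{[n]}\to\mathbb{R}$, i.e. $F(S\cap T)+F(S\cup T)\le F(S)+F(T)$ for all $S,T$. $\mathcal{L}_n=\{p\in\mathbb{R}^{\binom{[2n]}{n}} : p(C)=p(D) \text{ whenever } C\cap[n]=D\cap[n]\}$, identified with $\mathbb{R}^{2^{[n]}}$ via $\phi(p)(S)=p(S\cup T)$ for any $T\subseteq\{n+1,\dots,2n\}$ with $|T|=n-|S|$. *)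

(* Defs.v *)
From HB Require Import structures.
From mathcomp Require Import all_boot all_order all_algebra.
From mathcomp Require Import complex.
From mathcomp Require Import Rstruct.

Set Implicit Arguments. Unset Strict Implicit. Unset Printing Implicit Defensive.
Import Order.TTheory GRing.Theory Num.Theory.
Local Open Scope ring_scope.

Notation RR := Rdefinitions.R.

(* val : F^* -> R (its value at 0 is irrelevant and never used). *)
Definition is_valuation (F : rcfType) (val : F -> RR) : Prop :=
  (forall a b : F, a != 0 -> b != 0 -> val (a * b) = val a + val b) /\
  (forall a b : F, a != 0 -> b != 0 -> a + b != 0 ->
      Num.min (val a) (val b) <= val (a + b)).

Definition nontrivial_valuation (F : rcfType) (val : F -> RR) : Prop :=
  exists a : F, a != 0 /\ val a != 0.

(* The residue field {val >= 0} / {val > 0} is infinite: for every k there are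
   k elements of the valuation ring with pairwise distinct residues. *)
Definition infinite_residue_field (F : rcfType) (val : F -> RR) : Prop :=
  forall k : nat, exists a : 'I_k -> F,
    (forall i, a i = 0 \/ (a i != 0 /\ 0 <= val (a i))) /\
    (forall i j, i != j -> a i - a j != 0 /\ val (a i - a j) = 0).

Definition order_compatible (F : rcfType) (val : F -> RR) : Prop :=
  forall a b : F, 0 < a -> a < b -> - val a <= - val b.

Definition nuR (F : rcfType) (val : F -> RR) (a : F) : RR := - val a.

Definition nuC (F : rcfType) (val : F -> RR) (z : F[i]) : RR :=
  if complex.Re z == 0 then nuR val (complex.Im z)
  else if complex.Im z == 0 then nuR val (complex.Re z)
  else Num.max (nuR val (complex.Re z)) (nuR val (complex.Im z)).

Definition set_eq (T : Type) (A B : T -> Prop) : Prop := forall x, A x <-> B x.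

Definition set_inter (T : Type) (A B : T -> Prop) : T -> Prop :=
  fun x => A x /\ B x.

Definition nu_set (N : finType) (K : Type) (zero : K) (nuK : K -> RR)
    (X : (N -> K) -> Prop) : (N -> RR) -> Prop :=
  fun p => exists x, X x /\ (forall i, x i <> zero) /\ (forall i, p i = nuK (x i)).

Definition eclosure (N : finType) (Y : (N -> RR) -> Prop) : (N -> RR) -> Prop :=
  fun p => forall e : RR, 0 < e ->
    exists q, Y q /\ forall i, `|p i - q i| < e.

Definition trop (N : finType) (K : Type) (zero : K) (nuK : K -> RR)
    (X : (N -> K) -> Prop) : (N -> RR) -> Prop :=
  eclosure (nu_set zero nuK X).

Definition principal_minor (K : comNzRingType) (n : nat) (A : 'M[K]_n)
    (S : {set 'I_n}) : K :=
  \det (\matrix_(i < #|S|, j < #|S|) A (enum_val i) (enum_val j)).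

(* cj = identity (symmetric, over R) or complex conjugation (Hermitian, over C);
   positive definite = all principal minors positive. *)
Definition posdef (K : numDomainType) (cj : K -> K) (n : nat) (A : 'M[K]_n) : Prop :=
  (forall i j, A j i = cj (A i j)) /\ (forall S : {set 'I_n}, 0 < principal_minor A S).

Definition PMplus (K : numDomainType) (cj : K -> K) (n : nat) :
    ({set 'I_n} -> K) -> Prop :=
  fun a => exists A : 'M[K]_n, posdef cj A /\ forall S, a S = principal_minor A S.

Definition cone (N : finType) (K : comNzRingType) (X : (N -> K) -> Prop) :
    (N -> K) -> Prop :=
  fun b => exists (lam : K) a, X a /\ forall i, b i = lam * a i.

(* maximal minor of the k x m matrix M on the columns S (in increasing
   order); 0 if #|S| <> k (never used in that case) *)
Definition pluecker (K : comNzRingType) (k m : nat) (M : 'M[K]_(k, m))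
    (S : {set 'I_m}) : K :=
  match #|S| =P k with
  | ReflectT h => \det (colsub (fun j : 'I_k => enum_val (cast_ord (esym h) j)) M)
  | ReflectF _ => 0
  end.

Definition nsubsets (n : nat) := {C : {set 'I_(n + n)} | #|C| == n}.

Definition Gr (K : comNzRingType) (n : nat) : (nsubsets n -> K) -> Prop :=
  fun p => exists M : 'M[K]_(n, n + n), forall C : nsubsets n, p C = pluecker M (val C).

Definition Fl (K : fieldType) (n : nat) : ({set 'I_n} -> K) -> Prop :=
  fun q => exists (M : forall k : 'I_n.+1, 'M[K]_(k, n)) (c : 'I_n.+1 -> K),
    (forall k, \rank (M k) = k) /\
    (forall k k' : 'I_n.+1, (k <= k')%N -> (M k <= M k')%MS) /\
    (forall k, c k != 0) /\
    (forall (k : 'I_n.+1) (S : {set 'I_n}), #|S| = k -> q S = c k * pluecker (M k) S).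

Definition SUBMOD (n : nat) : ({set 'I_n} -> RR) -> Prop :=
  fun F => forall S T : {set 'I_n}, F (S :&: T) + F (S :|: T) <= F S + F T.

Definition low_part (n : nat) (C : nsubsets n) : {set 'I_n} :=
  [set i : 'I_n | lshift n i \in val C].

Definition Lspace (n : nat) : (nsubsets n -> RR) -> Prop :=
  fun p => forall C D : nsubsets n, low_part C = low_part D -> p C = p D.

(* phi(p) = F, i.e. F(S) = p(S cup T) for every admissible T *)
Definition phi_rel (n : nat) (p : nsubsets n -> RR) (F : {set 'I_n} -> RR) : Prop :=
  forall C : nsubsets n, p C = F (low_part C).

Definition phi_image (n : nat) (Y : (nsubsets n -> RR) -> Prop) :
    ({set 'I_n} -> RR) -> Prop :=
  fun F => exists p, Y p /\ Lspace p /\ phi_rel p F.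

Definition thm41_conclusion (K : numFieldType) (cj : K -> K) (nuK : K -> RR)
    (n : nat) : Prop :=
  set_eq (nu_set 0 nuK (cone (@PMplus K cj n))) (phi_image (nu_set 0 nuK (@Gr K n))) /\
  set_eq (phi_image (nu_set 0 nuK (@Gr K n)))
         (set_inter (nu_set 0 nuK (@Fl K n)) (@SUBMOD n)) /\
  set_eq (trop 0 nuK (cone (@PMplus K cj n))) (phi_image (trop 0 nuK (@Gr K n))) /\
  set_eq (phi_image (trop 0 nuK (@Gr K n)))
         (set_inter (trop 0 nuK (@Fl K n)) (@SUBMOD n)).

(* Main.v *)
(* Write P for the left-hand set, G for the middle one and H for the right-hand
   one.  Call [ball nu g x] the condition "x = 0 or nu x <= g".

   A matrix M = [V B | V] shows that a point of G is, up to a scalar, given by a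
   matrix B all of whose minors with columns S have the same valuation F(S).
   By Cauchy-Binet the principal minors of the Gram matrix B^* B are sums of
   squares of such minors, and nothing cancels since the valuation is convex;
   so 2 G is contained in P.  Conversely a positive definite A is B^* B by
   Cholesky, and [B | V] with V generic lies in G because
   |det [B_S | V_T]| is the largest |det [B_S | I_T']|; so P is contained in 2 G.

   The first k rows of B span the flag attached to a point of G, and the
   three-term Pluecker relations give submodularity.  Conversely, if the Pluecker
   vector F of a flag is submodular, an echelon basis B of the flag, rows scaled,
   satisfies nu (minor of B on any rows, columns S) <= F(S): this is proved by
   induction on the last row, using Pluecker relations.  A generic V then finishes.

   It remains to see that 2 G = G.  More generally, if nu (f_i x) = c_i for integer
   polynomials f_i, then some y has nu (f_i y) = lambda c_i, for lambda = 2 or 1/2.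
   Choose positive t_j with nu t_j linearly independent over Q such that every
   f_i x is, up to a power, a Laurent monomial in t times a unit, and N bounding
   the units, where N is an integer or exceeds all integers.  "There is x such that
   each of these quotients is between 1/N and N" is, by quantifier elimination for
   real closed fields, decided by the signs of finitely many rational polynomials
   in (t, N).  Each has a dominant monomial in t, so the signs do not change when t
   is replaced by t^lambda.

   For the closures: adding a small multiple of a strictly concave function of |S|
   makes an approximating point of H submodular. *)
Require Import Defs.
From HB Require Import structures.
From mathcomp Require Import all_boot all_order all_algebra all_fingroup.
From mathcomp Require Import complex.
From mathcomp Require Import boolp Rstruct.
From mathcomp Require qe_rcf_th qe_rcf.
From mathcomp Require Import ring lra zify.

Set Implicit Arguments. Unset Strict Implicit. Unset Printing Implicit Defensive.
Import Order.TTheory GRing.Theory Num.Theory.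
Local Open Scope ring_scope.

(** * Pluecker coordinates *)

Section Pluecker.
Variable K : comNzRingType.

Lemma plueckerE k m (M : 'M[K]_(k, m)) (S : {set 'I_m}) (h : #|S| = k) :
  pluecker M S = \det (colsub (fun j => enum_val (cast_ord (esym h) j)) M).
Proof. by rewrite /pluecker; case: eqP => // h'; rewrite (eq_irrelevance h' h). Qed.

(** The sign is that of the permutation sorting [c]. Signs are left existential throughout, because
    valuations and balls ignore them. *)
Lemma pluecker_colsub k m (M : 'M[K]_(k, m)) (c : 'I_k -> 'I_m) (S : {set 'I_m}) :
  injective c -> (forall x, (x \in S) = (x \in codom c)) ->
  exists b : bool, \det (colsub c M) = (-1) ^+ b * pluecker M S.
Proof.
move=> cI cS.
have h : #|S| = k.
  by rewrite -[RHS]card_ord -(card_codom cI); apply: eq_card => x; rewrite cS.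
pose d j := enum_val (cast_ord (esym h) j) : 'I_m.
have dI : injective d by move=> i j /enum_val_inj /cast_ord_inj.
have ex i : exists j, c i == d j.
  have hi : c i \in S by rewrite cS codom_f.
  exists (cast_ord h (enum_rank_in hi (c i))).
  by rewrite /d cast_ordK enum_rankK_in.
pose s i := xchoose (ex i).
have sE i : c i = d (s i) by apply/eqP/(xchooseP (ex i)).
have sI : injective s by move=> i j e; apply: cI; rewrite !sE e.
exists (perm sI : bool).
have -> : colsub c M = col_perm (perm sI) (colsub d M).
  by apply/matrixP => i j; rewrite !mxE permE sE.
by rewrite col_permE det_mulmx det_perm mulrC odd_permV (plueckerE _ h).
Qed.

Lemma pluecker_mull k m (A : 'M[K]_k) (M : 'M[K]_(k, m)) (S : {set 'I_m}) :
  #|S| = k -> pluecker (A *m M) S = \det A * pluecker M S.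
Proof.
move=> h; rewrite !(plueckerE _ h) -det_mulmx; congr (\det _).
by apply/matrixP => i j; rewrite !mxE; apply: eq_bigr => l _; rewrite !mxE.
Qed.

Definition setcol n (P : 'M[K]_n) (j : 'I_n) (v : 'cV[K]_n) : 'M[K]_n :=
  \matrix_(i, k) if k == j then v i ord0 else P i k.

Lemma det_setcol n (P : 'M[K]_n) j v :
  \det (setcol P j v) = \sum_i v i ord0 * cofactor P i j.
Proof.
rewrite (expand_det_col _ j); apply: eq_bigr => i _.
rewrite !mxE eqxx; congr (_ * (_ * \det _)).
by apply/matrixP => k l; rewrite !mxE eq_sym (negbTE (neq_lift _ _)).
Qed.

Lemma det_setcol_dup n (P : 'M[K]_n) j k (v : 'cV_n) :
  k != j -> (forall i, v i ord0 = P i k) -> \det (setcol P j v) = 0.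
Proof.
move=> kj vk; rewrite -det_tr; apply: (determinant_alternate kj) => i.
by rewrite !mxE eqxx (negbTE kj) vk.
Qed.

(* Multiplying out [P *m \adj P *m v = \det P *: v] column by column (Cramer). *)
Lemma det_exchange n (P Q : 'M[K]_n) p :
  \det P * \det Q = \sum_i \det (setcol P i (col p Q)) * \det (setcol Q p (col i P)).
Proof.
have key i : \det P * Q i p =
    \sum_k P i k * \det (setcol P k (col p Q)).
  have /matrixP/(_ i ord0) := congr1 (mulmx^~ (col p Q)) (mul_mx_adj P).
  rewrite mul_scalar_mx !mxE => <-.
  under [RHS]eq_bigr => k _ do rewrite det_setcol big_distrr /=.
  rewrite [RHS]exchange_big /=. apply: eq_bigr => l _.
  rewrite !mxE big_distrl /=. apply: eq_bigr => k _.
  by rewrite !mxE; ring.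
rewrite (expand_det_col Q p) big_distrr /=.
under eq_bigr => i _ do rewrite mulrA key big_distrl /=.
rewrite [LHS]exchange_big /=; apply: eq_bigr => k _.
rewrite (det_setcol Q) big_distrr /=; apply: eq_bigr => i _.
by rewrite !mxE; ring.
Qed.

Lemma colsub_setcol n m (M : 'M[K]_(n, m)) (c : 'I_n -> 'I_m) j x :
  setcol (colsub c M) j (col x M) = colsub (fun k => if k == j then x else c k) M.
Proof. by apply/matrixP => i k; rewrite !mxE; case: eqP. Qed.

(* The sign-free content of the quadratic Pluecker relations: a sum with signs
   of products of exchanged coordinates; [Q] will be a ball of the valuation. *)
Lemma pluecker_exchange n m (M : 'M[K]_(n, m)) (C D : {set 'I_m}) (p : 'I_m)
    (Q : K -> Prop) :
  #|C| = n -> #|D| = n -> p \in D -> p \notin C ->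
  Q 0 -> (forall x y, Q x -> Q y -> Q (x + y)) -> (forall x, Q x -> Q (- x)) ->
  (forall i, i \in C :\: D ->
     Q (pluecker M (p |: C :\ i) * pluecker M (i |: D :\ p))) ->
  Q (pluecker M C * pluecker M D).
Proof.
move=> hC hD pD pC Q0 QD QN hQ.
rewrite (plueckerE _ hC) (plueckerE _ hD).
set c := fun j : 'I_n => enum_val (cast_ord (esym hC) j).
set d := fun j : 'I_n => enum_val (cast_ord (esym hD) j).
have cI : injective c by move=> i j /enum_val_inj /cast_ord_inj.
have dI : injective d by move=> i j /enum_val_inj /cast_ord_inj.
have cC x : (x \in C) = (x \in codom c).
  apply/idP/codomP => [hx|[j ->]]; last exact: enum_valP.
  by exists (cast_ord hC (enum_rank_in hx x)); rewrite /c cast_ordK enum_rankK_in.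
have dD x : (x \in D) = (x \in codom d).
  apply/idP/codomP => [hx|[j ->]]; last exact: enum_valP.
  by exists (cast_ord hD (enum_rank_in hx x)); rewrite /d cast_ordK enum_rankK_in.
have /codomP[j pj] : p \in codom d by rewrite -dD.
rewrite (det_exchange _ _ j).
have Qs (b : bool) x : Q x -> Q ((-1) ^+ b * x).
  by case: b => hx; rewrite ?expr1 ?expr0 ?mulN1r ?mul1r //; apply: QN.
apply: (big_ind Q) => // i _.
have -> : col j (colsub d M) = col p M by apply/matrixP => a b; rewrite !mxE pj.
have -> : col i (colsub c M) = col (c i) M by apply/matrixP => a b; rewrite !mxE.
rewrite !colsub_setcol.
(* If [c i] already lies in [D], the exchange repeats a column and the term vanishes; only [C :\: D]
   contributes. *)
have [iD|iD] := boolP (c i \in D).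
  rewrite [X in _ * X](_ : _ = 0) ?mulr0 //.
  have /codomP[k ck] : c i \in codom d by rewrite -dD.
  have kj : k != j by apply: contra pC => /eqP e; rewrite pj -e -ck cC codom_f.
  rewrite -colsub_setcol; apply: (det_setcol_dup kj) => a; rewrite !mxE ck //.
have iC : c i \in C by rewrite cC codom_f.
have c1I : injective (fun k => if k == i then p else c k).
  move=> a b; do 2!case: eqP => [->|/eqP ?] //.
  - by move=> e; case/negP: pC; rewrite e cC codom_f.
  - by move=> e; case/negP: pC; rewrite -e cC codom_f.
  - exact: cI.
have d1I : injective (fun k => if k == j then c i else d k).
  move=> a b; do 2!case: eqP => [->|/eqP ?] //.
  - by move=> e; case/negP: iD; rewrite e dD codom_f.
  - by move=> e; case/negP: iD; rewrite -e dD codom_f.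
  - exact: dI.
have [|b1 ->] := @pluecker_colsub _ _ M _ (p |: C :\ c i) c1I.
  move=> x; rewrite !inE; apply/idP/codomP.
    case/orP => [/eqP->|/andP[xi]]; first by exists i; rewrite eqxx.
    rewrite cC => /codomP[k xk]; exists k; case: eqP => // e.
    by rewrite xk e eqxx in xi.
  case=> k ->; case: (eqVneq k _) => [_|ki]; first by rewrite eqxx.
  by rewrite (inj_eq cI) ki cC codom_f orbT.
have [|b2 ->] := @pluecker_colsub _ _ M _ (c i |: D :\ p) d1I.
  move=> x; rewrite !inE; apply/idP/codomP.
    case/orP => [/eqP->|/andP[xi]]; first by exists j; rewrite eqxx.
    rewrite dD => /codomP[k xk]; exists k; case: eqP => // e.
    by rewrite xk e pj eqxx in xi.
  case=> k ->; case: (eqVneq k _) => [_|ki]; first by rewrite eqxx.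
  by rewrite pj (inj_eq dI) ki dD codom_f orbT.
rewrite mulrACA -signr_addb; apply: Qs; apply: hQ => //.
by rewrite inE iD iC.
Qed.

End Pluecker.

(** * Column sets of a matrix with two blocks of n columns *)

Definition bcols (n : nat) (S T : {set 'I_n}) : {set 'I_(n + n)} :=
  [set x | match split x with inl i => i \in S | inr i => i \in T end].

Lemma split_lshift m n (i : 'I_m) : split (lshift n i) = inl i.
Proof. exact: (unsplitK (inl i)). Qed.

Lemma split_rshift m n (i : 'I_n) : split (rshift m i) = inr i.
Proof. exact: (unsplitK (inr i)). Qed.

Lemma bcols_l n S T (i : 'I_n) : (lshift n i \in bcols S T) = (i \in S).
Proof. by rewrite inE split_lshift. Qed.

Lemma bcols_r n S T (i : 'I_n) : (rshift n i \in bcols S T) = (i \in T).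
Proof. by rewrite inE split_rshift. Qed.

Lemma card_bcols n (S T : {set 'I_n}) : #|bcols S T| = (#|S| + #|T|)%N.
Proof.
have -> : bcols S T = (@lshift n n) @: S :|: (@rshift n n) @: T.
  apply/setP => x; rewrite in_setU; case: (split_ordP x) => i ->.
    rewrite bcols_l mem_imset; last exact: lshift_inj.
    by rewrite [X in _ || X](_ : _ = false) ?orbF //; apply/imsetP=> [[j _ /eqP]];
      rewrite eq_lrshift.
  rewrite bcols_r (mem_imset _ _ (@rshift_inj _ _)).
  by rewrite [X in X || _](_ : _ = false) //; apply/imsetP=> [[j _ /eqP]];
     rewrite eq_rlshift.
rewrite cardsU disjoint_setI0 ?cards0 ?subn0.
  by rewrite !card_imset //; [apply: rshift_inj | apply: lshift_inj].
rewrite -setI_eq0; apply/eqP/setP => x; rewrite !inE.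
by apply/negP => /andP[/imsetP[i _ ->] /imsetP[j _ /eqP]]; rewrite eq_lrshift.
Qed.

Lemma bcols_surj n (C : {set 'I_(n + n)}) :
  C = bcols [set i | lshift n i \in C] [set i | rshift n i \in C].
Proof.
by apply/setP => x; case: (split_ordP x) => i ->; rewrite ?bcols_l ?bcols_r inE.
Qed.

(** * Laplace expansion and the Cauchy-Binet formula *)

Section PlueckerIdentities.
Variable K : comNzRingType.

Lemma det_rowsub_inj n (f : 'I_n -> 'I_n) (X : 'M[K]_n) :
  injective f -> exists b : bool, \det (rowsub f X) = (-1) ^+ b * \det X.
Proof.
move=> fI; exists (perm fI : bool).
have -> : rowsub f X = row_perm (perm fI) X.
  by apply/matrixP => i j; rewrite !mxE permE.
by rewrite row_permE det_mulmx det_perm.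
Qed.

(* Laplace expansion along the unit columns [T] leaves the minor of [B] with
   rows [~: T] and columns [S]. *)
Lemma pluecker_pad n k (B : 'M[K]_n) (S T : {set 'I_n}) (r s : 'I_k -> 'I_n) :
  (k + #|T| = n)%N -> injective s -> (forall x, (x \in S) = (x \in codom s)) ->
  injective r -> (forall x, (x \notin T) = (x \in codom r)) ->
  exists b : bool,
    pluecker (row_mx B 1%:M) (bcols S T) = (-1) ^+ b * \det (mxsub r s B).
Proof.
move e: #|T| => m km; move: e; subst n => hT sI sS rI rT.
pose t j := enum_val (cast_ord (esym hT) j).
have tI : injective t by move=> i j /enum_val_inj /cast_ord_inj.
have tT x : (x \in T) = (x \in codom t).
  apply/idP/codomP => [hx|[j ->]]; last exact: enum_valP.
  by exists (cast_ord hT (enum_rank_in hx x)); rewrite /t cast_ordK enum_rankK_in.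
pose c (j : 'I_(k + m)) : 'I_((k + m) + (k + m)) :=
  match split j with inl a => lshift _ (s a) | inr b => rshift _ (t b) end.
have cI : injective c.
  move=> i j; rewrite /c; case: (split_ordP i) => a ->; case: (split_ordP j) => b ->.
  - by move/lshift_inj/sI ->.
  - by move/eqP; rewrite eq_lrshift.
  - by move/eqP; rewrite eq_rlshift.
  - by move/rshift_inj/tI ->.
have [|b1 e1] := @pluecker_colsub _ _ _ (row_mx B 1%:M) c (bcols S T) cI.
  move=> x; case: (split_ordP x) => i ->; rewrite ?bcols_l ?bcols_r ?sS ?tT.
    apply/codomP/codomP => [[j ->]|[j]]; first by exists (lshift _ j); rewrite /c split_lshift.
    rewrite /c; case: (split_ordP j) => a _; first by move/lshift_inj ->; exists a.
    by move/eqP; rewrite eq_lrshift.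
  apply/codomP/codomP => [[j ->]|[j]]; first by exists (rshift _ j); rewrite /c split_rshift.
  rewrite /c; case: (split_ordP j) => a _; last by move/rshift_inj ->; exists a.
  by move/eqP; rewrite eq_rlshift.
(* Listing the rows outside [T] before those of [T] makes the matrix block lower triangular with an
   identity block. *)
pose rho (j : 'I_(k + m)) := match split j with inl a => r a | inr b => t b end.
have rhoI : injective rho.
  move=> i j; rewrite /rho; case: (split_ordP i) => a ->; case: (split_ordP j) => b ->.
  - by move/rI ->.
  - by move=> e; have := rT (r a); rewrite codom_f e tT codom_f.
  - by move=> e; have := rT (r b); rewrite codom_f -e tT codom_f.
  - by move/tI ->.
have [b2 e2] := det_rowsub_inj (colsub c (row_mx B 1%:M)) rhoI.
have e3 : rowsub rho (colsub c (row_mx B 1%:M)) =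
    block_mx (mxsub r s B) 0 (mxsub t s B) 1%:M.
  apply/matrixP => i j; rewrite [LHS]mxE [LHS]mxE /rho /c.
  case: (split_ordP i) => a ->; case: (split_ordP j) => b ->;
  rewrite ?(split_lshift, split_rshift, mxE) //.
    by have := rT (r a); rewrite codom_f tT; case: eqP => // ->; rewrite codom_f.
  by rewrite (inj_eq tI).
move: e2; rewrite e3 det_lblock det1 mulr1 e1 => e2.
exists (b1 (+) b2); rewrite e2 signr_addb.
by case: b1 b2 {e1 e2} => -[]; rewrite ?expr1 ?expr0; ring.
Qed.

Lemma pluecker_tr_sub k m n (B : 'M[K]_(m, n)) (s : 'I_k -> 'I_n) (R : {set 'I_m})
    (h : #|R| = k) :
  pluecker (colsub s B)^T R =
  \det (mxsub (fun j => enum_val (cast_ord (esym h) j)) s B).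
Proof.
by rewrite (plueckerE _ h) -det_tr; congr (\det _); apply/matrixP => i j; rewrite !mxE.
Qed.

(** Multilinearity gives a sum over all maps [f]. A non-injective [f] repeats a row and contributes
    nothing; the injective ones are grouped by their image [R], where they are the permutations of
    its increasing listing. *)
Lemma cauchy_binet k n (X : 'M[K]_(k, n)) (Y : 'M[K]_(n, k)) :
  \det (X *m Y) = \sum_(R : {set 'I_n} | #|R| == k) pluecker X R * pluecker Y^T R.
Proof.
pose G (f : {ffun 'I_k -> 'I_n}) := (\prod_i X i (f i)) * \det (rowsub f Y).
have -> : \det (X *m Y) = \sum_f G f.
  rewrite /G; under [RHS]eq_bigr => f _ do rewrite mulrC big_distrl /=.
  rewrite exchange_big /=; apply: eq_bigr => s _.
  transitivity ((-1) ^+ s * \prod_i \sum_j X i j * Y j (s i)).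
    by congr (_ * _); apply: eq_bigr => i _; rewrite mxE.
  rewrite (bigA_distr_bigA (fun i j => X i j * Y j (s i))) big_distrr /=.
  apply: eq_bigr => f _; rewrite big_split /= -mulrA; congr (_ * _); rewrite mulrC.
  by congr (_ * _); apply: eq_bigr => i _; rewrite mxE.
rewrite (bigID (fun f : {ffun 'I_k -> 'I_n} => injectiveb f)) /= addrC big1 ?add0r; last first.
  move=> f /injectivePn[i [j ij fij]]; rewrite /G (determinant_alternate ij) ?mulr0 //.
  by move=> a; rewrite !mxE fij.
rewrite (partition_big (fun f : {ffun 'I_k -> 'I_n} => [set f i | i : 'I_k])
  (fun R : {set 'I_n} => #|R| == k)) /=; last first.
  by move=> f /injectiveP fI; rewrite card_imset // card_ord.
apply: eq_bigr => R /eqP hR.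
pose e j := enum_val (cast_ord (esym hR) j) : 'I_n.
have eI : injective e by move=> i j /enum_val_inj /cast_ord_inj.
have eR x : x \in R -> exists j, x == e j.
  move=> hx; exists (cast_ord hR (enum_rank_in hx x)).
  by rewrite /e cast_ordK enum_rankK_in.
pose h (s : 'S_k) := [ffun i => e (s i)].
have hI : {in [set: 'S_k] &, injective h}.
  by move=> s t _ _ /ffunP st; apply/permP => i; apply: eI; move: (st i); rewrite !ffunE.
transitivity (\sum_(f in h @: [set: 'S_k]) G f).
  apply: eq_bigl => f; apply/andP/imsetP => [[/injectiveP fI /eqP fR]|[s _ ->]].
    have ex i : exists j, f i == e j by apply: eR; rewrite -fR; apply: imset_f.
    pose s i := xchoose (ex i).
    have sE i : f i = e (s i) by apply/eqP/(xchooseP (ex i)).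
    have sI : injective s by move=> i j eij; apply: fI; rewrite !sE eij.
    by exists (perm sI); rewrite ?inE //; apply/ffunP => i; rewrite ffunE permE sE.
  have hsI : injective (h s) by move=> i j; rewrite !ffunE => /eI/perm_inj.
  split; first exact/injectiveP.
  rewrite eqEcard card_imset // card_ord hR leqnn andbT.
  by apply/subsetP => x /imsetP[i _ ->]; rewrite ffunE; apply: enum_valP.
rewrite big_imset //= (plueckerE _ hR) (plueckerE _ hR) big_distrl /=.
apply: eq_big => [s|s _]; first by rewrite inE.
rewrite /G; have -> : rowsub (h s) Y = row_perm s (rowsub e Y).
  by apply/matrixP => i j; rewrite !mxE ffunE.
rewrite row_permE det_mulmx det_perm mulrCA mulrA; congr (_ * _ * _).
  by apply: eq_bigr => i _; rewrite !mxE ffunE.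
by rewrite -det_tr; congr (\det _); apply/matrixP => i j; rewrite !mxE.
Qed.

End PlueckerIdentities.

(** * Convex valuations *)

(** The common interface of the real field with the identity and of its complexification with
    conjugation. Convexity is [cv_mono]; [cv_sqrt] makes positive elements norms, as Cholesky needs;
    [cv_dense] serves the closures. *)
Record convex_valuation (K : numFieldType) (cj : {rmorphism K -> K})
    (nu : K -> RR) : Prop := ConvexValuation {
  cv_mul : forall x y, x != 0 -> y != 0 -> nu (x * y) = nu x + nu y;
  cv_add : forall x y g, x != 0 -> y != 0 -> x + y != 0 ->
    nu x <= g -> nu y <= g -> nu (x + y) <= g;
  cv_mono : forall x y, 0 < x -> x <= y -> nu x <= nu y;
  cv_normE : forall x, x * cj x = `|x| ^+ 2;
  cv_norm : forall x, x != 0 -> nu (x * cj x) = nu x + nu x;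
  cv_sqrt : forall x, 0 < x -> exists y, y * cj y = x;
  cv_conjK : involutive cj;
  cv_dense : forall e : RR, 0 < e -> exists x, [/\ x != 0, 0 < nu x & nu x < e]
}.

Section Ball.
Variables (K : numFieldType) (cj : {rmorphism K -> K}) (nu : K -> RR).
Hypothesis nuP : convex_valuation cj nu.

Definition ball (g : RR) (x : K) := (x == 0) || (nu x <= g).

Lemma nu1 : nu 1 = 0.
Proof. have := cv_mul nuP (oner_neq0 K) (oner_neq0 K); rewrite mulr1; lra. Qed.

Lemma nuN1 : nu (-1) = 0.
Proof.
have h : (-1 : K) != 0 by rewrite oppr_eq0 oner_neq0.
have := cv_mul nuP h h; rewrite mulrNN mulr1 nu1; lra.
Qed.

Lemma nuV x : x != 0 -> nu x^-1 = - nu x.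
Proof.
move=> h; have hv : x^-1 != 0 by rewrite invr_eq0.
have := cv_mul nuP h hv; rewrite mulfV // nu1; lra.
Qed.

Lemma nu_div x y : x != 0 -> y != 0 -> nu (x / y) = nu x - nu y.
Proof. by move=> hx hy; rewrite (cv_mul nuP) ?invr_eq0 // nuV. Qed.

Lemma nuN x : nu (- x) = nu x.
Proof.
have [->|h] := eqVneq x 0; first by rewrite oppr0.
rewrite -mulN1r (cv_mul nuP) ?oppr_eq0 ?oner_neq0 // nuN1; lra.
Qed.

Lemma nu_sign (b : bool) x : nu ((-1) ^+ b * x) = nu x.
Proof. by case: b; rewrite ?expr1 ?expr0 ?mulN1r ?mul1r ?nuN. Qed.

Lemma nuX x k : x != 0 -> nu (x ^+ k) = nu x *+ k.
Proof.
move=> hx; elim: k => [|k IH]; first by rewrite expr0 mulr0n nu1.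
by rewrite exprS (cv_mul nuP) ?expf_neq0 // IH mulrS.
Qed.

Lemma ball0 g : ball g 0. Proof. by rewrite /ball eqxx. Qed.

Lemma ballN g x : ball g (- x) = ball g x.
Proof. by rewrite /ball oppr_eq0 nuN. Qed.

Lemma ball_sign g (b : bool) x : ball g ((-1) ^+ b * x) = ball g x.
Proof. by case: b; rewrite ?expr1 ?expr0 ?mulN1r ?mul1r ?ballN. Qed.

Lemma ballD g x y : ball g x -> ball g y -> ball g (x + y).
Proof.
rewrite /ball; have [->|hx] := eqVneq x 0; first by rewrite add0r.
have [->|hy] := eqVneq y 0; first by rewrite addr0 (negbTE hx).
by move=> /= gx gy; have [//|h] := eqVneq (x + y) 0; apply: (cv_add nuP).
Qed.

Lemma ballM g h x y : ball g x -> ball h y -> ball (g + h) (x * y).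
Proof.
rewrite /ball mulf_eq0; have [//|hx] := eqVneq x 0; have [//|hy] := eqVneq y 0.
by rewrite (cv_mul nuP) //= => *; apply: lerD.
Qed.

Lemma ball_sum (I : Type) (r : seq I) (P : pred I) (f : I -> K) g :
  (forall i, P i -> ball g (f i)) -> ball g (\sum_(i <- r | P i) f i).
Proof. by move=> h; apply: (big_ind (ball g)) => //; [exact: ball0 | exact: ballD]. Qed.

Lemma ball_nat n : ball 0 n%:R.
Proof.
elim: n => [|n IH]; first exact: ball0.
by rewrite -addn1 natrD; apply: ballD => //; rewrite /ball nu1 lexx orbT.
Qed.

Lemma ball_int (z : int) : ball 0 z%:~R.
Proof. by case: z => n; rewrite ?NegzE ?mulrNz ?ballN; apply: ball_nat. Qed.

Lemma ballE g x : x != 0 -> ball g x = (nu x <= g).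
Proof. by rewrite /ball => /negbTE ->. Qed.

Lemma ball_le g h x : g <= h -> ball g x -> ball h x.
Proof. by move=> gh; rewrite /ball => /orP[->//|/le_trans->]; rewrite ?orbT. Qed.

Lemma ball_mull c g x : c != 0 -> ball (nu c + g) (c * x) = ball g x.
Proof.
move=> hc; rewrite /ball mulf_eq0 (negbTE hc) /=.
by have [//|hx] := eqVneq x 0; rewrite (cv_mul nuP) //= lerD2l.
Qed.

(** Convexity forces residue characteristic zero: integers have value at most 0 by the ultrametric
    inequality, and at least [nu 1] by monotonicity. *)
Lemma nu_nat n : nu n.+1%:R = 0.
Proof.
have h : (n.+1%:R : K) != 0 by rewrite pnatr_eq0.
apply/eqP; rewrite eq_le; have := ball_nat n.+1; rewrite ballE // => -> /=.
by rewrite -{1}nu1; apply: (cv_mono nuP) => //; rewrite ler1n.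
Qed.

Lemma nu_int (z : int) : z != 0 -> nu z%:~R = 0.
Proof.
case: z => [[|n]|n] // _; first by rewrite -(nu_nat n).
by rewrite NegzE mulrNz nuN -(nu_nat n).
Qed.

Lemma norm_ge0 x : 0 <= x * cj x.
Proof. by rewrite (cv_normE nuP) exprn_ge0. Qed.

Lemma norm_gt0 x : x != 0 -> 0 < x * cj x.
Proof. by rewrite (cv_normE nuP) => hx; rewrite exprn_gt0 // normr_gt0. Qed.

Lemma nu_normr x : nu `|x| = nu x.
Proof.
have [->|hx] := eqVneq x 0; first by rewrite normr0.
have := cv_norm nuP hx; rewrite (cv_normE nuP) expr2 (cv_mul nuP) ?normr_eq0 //; lra.
Qed.

Lemma ball_norm g x : ball (g + g) (x * cj x) = ball g x.
Proof.
rewrite /ball mulf_eq0 fmorph_eq0 orbb.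
by have [//|hx] := eqVneq x 0; rewrite (cv_norm nuP) //=; apply/idP/idP; lra.
Qed.

(** Nonnegative terms cannot cancel: each is at most the sum in the order, hence also in
    valuation. *)
Lemma ball_sum_ge0 (I : finType) (P : pred I) (f : I -> K) g :
  (forall i, P i -> 0 <= f i) -> ball g (\sum_(i | P i) f i) ->
  forall i, P i -> ball g (f i).
Proof.
move=> f0 bs i Pi; have [e|hi] := eqVneq (f i) 0; first by rewrite e ball0.
have pi : 0 < f i by rewrite lt_def hi f0.
have le : f i <= \sum_(i | P i) f i.
  by rewrite (bigD1 i) //= lerDl sumr_ge0 // => j /andP[Pj _]; apply: f0.
move: bs; rewrite !ballE ?gt_eqF ?(lt_le_trans pi) //.
exact/le_trans/(cv_mono nuP).
Qed.

(** Values that are maxima are computed through the balls containing an element, so that no maximal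
    term has to be named. *)
Lemma nu_eq_ball x g : x != 0 -> (forall h, ball h x <-> g <= h) -> nu x = g.
Proof.
move=> hx hb; apply/eqP; rewrite eq_le -ballE //.
by rewrite (hb g).2 //= -(hb (nu x)) ballE.
Qed.

Lemma ball_neq0 x g : ~~ ball g x -> x != 0.
Proof. by apply: contraNN => /eqP ->; apply: ball0. Qed.

End Ball.

(** * Gram matrices *)

Section Gram.
Variables (K : numFieldType) (cj : {rmorphism K -> K}) (nu : K -> RR).
Hypothesis nuP : convex_valuation cj nu.

Definition gram n (B : 'M[K]_n) : 'M[K]_n := (map_mx cj B)^T *m B.

(* Up to sign, the minor of [B] with rows [~: T] and columns [S]. *)
Definition cominor n (B : 'M[K]_n) (S T : {set 'I_n}) : K :=
  pluecker (row_mx B 1%:M) (bcols S T).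

Lemma gram_herm n (B : 'M[K]_n) i j : gram B j i = cj (gram B i j).
Proof.
rewrite !mxE rmorph_sum /=; apply: eq_bigr => k _.
by rewrite !mxE rmorphM /= (cv_conjK nuP) mulrC.
Qed.

(** Cauchy-Binet on the columns [S]; the unknown sign from [pluecker_pad] occurs twice and
    cancels. *)
Lemma gram_minor n (B : 'M[K]_n) (S : {set 'I_n}) :
  principal_minor (gram B) S =
  \sum_(R : {set 'I_n} | #|R| == #|S|) cominor B S (~: R) * cj (cominor B S (~: R)).
Proof.
pose s (j : 'I_#|S|) := enum_val j : 'I_n.
have -> : principal_minor (gram B) S =
    \det ((colsub s (map_mx cj B))^T *m colsub s B).
  congr (\det _); apply/matrixP => i j; rewrite !mxE.
  by apply: eq_bigr => k _; rewrite !mxE.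
rewrite cauchy_binet; apply: eq_bigr => R /eqP hR.
rewrite !(pluecker_tr_sub _ _ hR).
set r := fun j => _; have -> : mxsub r s (map_mx cj B) = map_mx cj (mxsub r s B).
  by apply/matrixP => i j; rewrite !mxE.
rewrite det_map_mx /cominor.
have [|||||b ->] := @pluecker_pad _ n #|S| B S (~: R) r s.
- by rewrite -hR cardsC card_ord.
- exact: enum_val_inj.
- move=> x; apply/idP/codomP => [hx|[j ->]]; last exact: enum_valP.
  by exists (enum_rank_in hx x); rewrite /s enum_rankK_in.
- by move=> i j /enum_val_inj /cast_ord_inj.
- move=> x; rewrite inE negbK; apply/idP/codomP => [hx|[j ->]]; last exact: enum_valP.
  by exists (cast_ord hR (enum_rank_in hx x)); rewrite /r cast_ordK enum_rankK_in.
by rewrite rmorphM rmorph_sign mulrACA -signr_addb addbb mul1r mulrC.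
Qed.

(** In effect, a principal minor of the Gram matrix has twice the largest valuation of a minor of
    [B] on the same columns. One direction is ultrametric, the other is the absence of cancellation
    among norms. *)
Lemma gram_ball n (B : 'M[K]_n) (S : {set 'I_n}) g :
  ball nu (g + g) (principal_minor (gram B) S) <->
  (forall T : {set 'I_n}, (#|S| + #|T| = n)%N -> ball nu g (cominor B S T)).
Proof.
rewrite gram_minor; split => [h T hT|h]; last first.
  apply: (ball_sum nuP) => R /eqP hR; rewrite (ball_norm nuP); apply: h.
  by rewrite -hR cardsC card_ord.
have := ball_sum_ge0 nuP (fun R _ => norm_ge0 nuP (cominor B S (~: R))) h.
move=> /(_ (~: T)); rewrite setCK (ball_norm nuP); apply.
by rewrite -(eqn_add2r #|T|) hT addnC cardsC card_ord.
Qed.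

Lemma det_block_schur n (a : K) (u : 'rV[K]_n) (l : 'cV[K]_n) (d : 'M[K]_n) :
  a != 0 ->
  \det (block_mx a%:M u l d) = a * \det (d - a^-1 *: (l *m u)).
Proof.
move=> ha.
have -> : block_mx a%:M u l d =
    block_mx 1%:M 0 (a^-1 *: l) 1%:M *m block_mx a%:M u 0 (d - a^-1 *: (l *m u)).
  rewrite mulmx_block !mul1mx !mul0mx !addr0 mul_mx_scalar scalerA mulfV //.
  by rewrite scale1r -scalemxAl addrC subrK.
by rewrite det_mulmx det_lblock det_ublock !det1 !mul1r det_scalar1.
Qed.

(** Induction through the Schur complement of the first entry. Minors along arbitrary injective
    listings are assumed, so that the pivot can be prepended to a listing without reordering it. *)
Lemma cholesky n (A : 'M[K]_n) :
  (forall i j, A j i = cj (A i j)) ->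
  (forall k (s : 'I_k -> 'I_n), injective s -> 0 < \det (mxsub s s A)) ->
  exists B, A = gram B.
Proof.
elim: n A => [|n IH] A hA pA; first by exists 0; apply/matrixP => -[].
rewrite -[n.+1]/(1 + n)%N in A hA pA *.
have := pA 1%N (fun=> 0) (fun i j _ => ord_inj (etrans (congr1 val (ord1 i)) (esym (congr1 val (ord1 j))))).
rewrite det_mx11 mxE; set a := A _ _ => a0.
have ha : a != 0 by rewrite gt_eqF.
have aM : ulsubmx A = a%:M.
  by apply/matrixP => i j; rewrite !ord1 !mxE mulr1n; congr (A _ _); apply/val_inj.
have aE : A = block_mx a%:M (ursubmx A) (dlsubmx A) (drsubmx A) by rewrite -aM submxK.
pose A2 := drsubmx A - a^-1 *: (dlsubmx A *m ursubmx A).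
have dlE i j : dlsubmx A i j = cj (ursubmx A j i) by rewrite !mxE hA.
have cja : cj a = a by rewrite /a -hA.
have [||B2 A2E] := IH A2.
- move=> i j; rewrite !mxE rmorphB rmorphM fmorphV cja hA; congr (_ - _ * _).
  rewrite rmorph_sum; apply: eq_bigr => k _ /=.
  by rewrite !dlE rmorphM (cv_conjK nuP) mulrC.
- move=> k s sI.
  (* The minor of [A] on the pivot followed by [s] is [a] times the minor of the Schur complement on
     [s]. *)
  pose s1 (j : 'I_(1 + k)) : 'I_(1 + n) :=
    match split j with inl _ => lshift n 0 | inr j => rshift 1 (s j) end.
  have s1I : injective s1.
    move=> i j; rewrite /s1; case: (split_ordP i) => x ->; case: (split_ordP j) => y ->.
    - by rewrite !ord1.
    - by move/eqP; rewrite eq_lrshift.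
    - by move/eqP; rewrite eq_rlshift.
    - by move/rshift_inj/sI ->.
  have := pA _ _ s1I.
  have -> : mxsub s1 s1 A =
      block_mx a%:M (colsub s (ursubmx A)) (rowsub s (dlsubmx A)) (mxsub s s (drsubmx A)).
    apply/matrixP => i j; rewrite mxE /s1.
    case: (split_ordP i) => x ->; case: (split_ordP j) => y ->;
      rewrite ?split_lshift ?split_rshift ?block_mxEul ?block_mxEur ?block_mxEdl
        ?block_mxEdr ?(ord1 x) ?(ord1 y) !mxE //.
    rewrite mulr1n; congr (A _ _); exact/val_inj.
  rewrite det_block_schur // pmulr_rgt0 //; congr (_ < \det _).
  by apply/matrixP => i j; rewrite !mxE; congr (_ - _ * _);
     apply: eq_bigr => l _; rewrite !mxE.
(* The pivot [a] is the norm of [b], which becomes the first diagonal entry of the upper block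
   triangular factor. *)
have [b bE] := cv_sqrt nuP a0.
have hb : b != 0 by apply: contraNneq ha => e; rewrite -bE e mul0r.
have hcb : cj b != 0 by rewrite fmorph_eq0.
exists (block_mx b%:M ((cj b)^-1 *: ursubmx A) 0 B2).
rewrite /gram map_block_mx tr_block_mx mulmx_block [LHS]aE; congr block_mx.
- rewrite map_mx0 trmx0 mul0mx addr0 map_scalar_mx tr_scalar_mx -scalar_mxM.
  by rewrite mulrC bE.
- rewrite map_mx0 trmx0 mul0mx addr0 map_scalar_mx tr_scalar_mx mul_scalar_mx.
  by rewrite scalerA mulfV // scale1r.
- rewrite mulmx0 addr0 mul_mx_scalar; apply/matrixP => i j; rewrite dlE !mxE.
  by rewrite rmorphM fmorphV (cv_conjK nuP) mulrA mulfV ?mul1r.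
- rewrite -[_ *m B2]/(gram B2) -A2E; apply/matrixP => i j.
  rewrite !mxE addrC -[LHS](subrK (a^-1 * \sum_j0 dlsubmx A i j0 * ursubmx A j0 j)).
  congr (_ + _).
  rewrite !big_ord_recl !big_ord0 !addr0 dlE !mxE rmorphM fmorphV (cv_conjK nuP) -bE invfM.
  ring.
Qed.

(** Passes from subsets to injective listings: rows and columns are permuted alike, so the two signs
    cancel. *)
Lemma posdef_minor n (A : 'M[K]_n) k (s : 'I_k -> 'I_n) :
  posdef cj A -> injective s -> 0 < \det (mxsub s s A).
Proof.
move=> [_ pA] sI; have := pA [set s i | i : 'I_k].
have h : #|[set s i | i : 'I_k]| = k by rewrite card_imset // card_ord.
have e0 i : s i \in [set s i | i : 'I_k] by apply: imset_f.
rewrite /principal_minor; set S := [set _ | _ in _] in h e0 *.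
pose t (i : 'I_k) := cast_ord h (enum_rank_in (e0 i) (s i)).
have tI : injective t.
  move=> i j /cast_ord_inj e; apply: sI.
  by rewrite -(enum_rankK_in (e0 i) (e0 i)) e enum_rankK_in.
set X := (\matrix_(i, j) _); have -> : \det X =
    \det (\matrix_(i < k, j < k) A (enum_val (cast_ord (esym h) i)) (enum_val (cast_ord (esym h) j))).
  rewrite /X; clear -h; case: _ / h => /=; congr (\det _).
  by apply/matrixP => i j; rewrite !mxE !cast_ord_id.
set Y := (\matrix_(i, j) _).
have -> : mxsub s s A = row_perm (perm tI) (col_perm (perm tI) Y).
  by apply/matrixP => i j; rewrite !mxE !permE !cast_ordK !enum_rankK_in.
rewrite row_permE col_permE !det_mulmx !det_perm odd_permV.
by rewrite mulrCA -signr_addb addbb mulr1.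
Qed.

End Gram.

(** * Generic columns *)

Section Generic.
Variables (K : numFieldType) (cj : {rmorphism K -> K}) (nu : K -> RR).
Hypothesis nuP : convex_valuation cj nu.

(** The determinant is a nonzero integer, hence of valuation 0, so the inverse keeps its entries in
    the valuation ring. *)
Lemma vandermonde_inverse n (u : 'I_n -> nat) : injective u ->
  exists W : 'M[K]_n, (forall i j, ball nu 0 (W i j)) /\
    W *m (\matrix_(k, i) (u k)%:R ^+ i) = 1%:M.
Proof.
move=> uI; pose V0 : 'M[int]_n := (Vandermonde n (\row_j (u j)%:R))^T.
have VE : \matrix_(k, i) (u k)%:R ^+ i = map_mx intr V0 :> 'M[K]_n.
  by apply/matrixP => i j; rewrite !mxE rmorphXn /= rmorph_nat.
have d0 : \det V0 != 0.
  rewrite det_tr det_Vandermonde; apply/prodf_neq0 => i _; apply/prodf_neq0 => j ij.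
  rewrite !mxE subr_eq0 eqr_nat; apply: contraTneq ij => /uI ->.
  by rewrite ltnn.
have d1 : ((\det V0)%:~R : K) != 0 by rewrite intr_eq0.
exists ((\det V0)%:~R^-1 *: map_mx intr (\adj V0)); split => [i j|].
  rewrite !mxE; rewrite -(addr0 0); apply: (ballM nuP); last exact: (ball_int nuP).
  by rewrite ballE ?invr_eq0 // (nuV nuP) // (nu_int nuP) // oppr0.
rewrite VE -scalemxAl -map_mxM mul_adj_mx map_scalar_mx /=.
by rewrite scale_scalar_mx mulVf.
Qed.

(* A nonzero polynomial with at least [n] distinct natural numbers where its
   value is smaller than its largest coefficient would have, by interpolation,
   only small coefficients; hence few evaluation points are bad. *)
Lemma generic_nat n (A : finType) (w : A -> 'I_n -> K) :
  exists u : nat, forall a g, ball nu g (\sum_(i < n) u%:R ^+ i * w a i) ->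
    forall i, ball nu g (w a i).
Proof.
pose y a (u : nat) := \sum_(i < n) u%:R ^+ i * w a i.
pose good a u := [forall i, (w a i == 0) || (y a u != 0) && (nu (w a i) <= nu (y a u))].
suff [u hu] : exists u, [forall a, good a u].
  exists u => a g; move/forallP/(_ a)/forallP: hu => hu h i.
  move: (hu i); rewrite /ball; case/orP => [->//|/andP[h0 h1]].
  by move: h; rewrite ballE // => /(le_trans h1) ->; rewrite orbT.
(* Each [a] excludes at most [n] points, so one of these [N] points is good for all [a]. *)
pose N := (#|A| * n).+1.
suff [u hu] : exists u : 'I_N, [forall a, good a u] by exists u.
apply/existsP; apply: contraT; rewrite negb_exists => /forallP bad.
have cover : (#|'I_N| <= \sum_a #|[set u : 'I_N | ~~ good a u]|)%N.
  rewrite -sum1_card; under [leqRHS]eq_bigr => a _ do rewrite -sum1dep_card big_mkcond.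
  rewrite exchange_big; apply: leq_sum => u _; have := bad u.
  by rewrite negb_forall => /existsP[a ha]; rewrite (bigD1 a) //= ha.
suff few a : (#|[set u : 'I_N | ~~ good a u]| <= n)%N.
  move: cover; rewrite card_ord /N => h.
  have : (\sum_a #|[set u : 'I_N | ~~ good a u]| <= #|A| * n)%N.
    by rewrite -sum_nat_const; apply: leq_sum.
  by move/(leq_trans h); rewrite ltnn.
rewrite leqNgt; apply/negP => many.
pose c (j : 'I_n) : nat := enum_val (widen_ord (ltnW many) j) : 'I_N.
have cI : injective c.
  by move=> i j /ord_inj/enum_val_inj/(congr1 val) /= /ord_inj.
have badP u : ~~ good a u ->
    exists2 i, w a i != 0 & (y a u == 0) || (nu (y a u) < nu (w a i)).
  case/forallPn => i; rewrite negb_or negb_and negbK -ltNge.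
  by case/andP; exists i.
have cbad j : ~~ good a (c j).
  by have := enum_valP (widen_ord (ltnW many) j); rewrite inE.
have [W [Wb WV]] := vandermonde_inverse cI.
have [i1 wi1] : exists i1, w a i1 != 0.
  have := enum_valP (Ordinal (leq_ltn_trans (leq0n n) many)).
  by rewrite inE => /badP[i hi _]; exists i.
(* The largest coefficient is recovered by interpolation from [n] bad points. The values there are
   smaller than it, which makes it smaller than itself. *)
have [i0 wi0 max0] := @arg_maxP _ _ _ i1 (fun i => w a i != 0) (fun i => nu (w a i)) wi1.
pose small x := (x == 0) || (nu x < nu (w a i0)).
suff : small (w a i0) by rewrite /small (negbTE wi0) ltxx.
have -> : w a i0 = \sum_k W i0 k * y a (c k).
  have /matrixP/(_ i0 ord0) := congr1 (mulmx^~ (\col_i w a i)) WV.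
  rewrite mul1mx -mulmxA !mxE => <-; apply: eq_bigr => k _; congr (_ * _).
  by rewrite !mxE; apply: eq_bigr => i _; rewrite !mxE.
apply: (big_ind small) => [|p q|k _]; first by rewrite /small eqxx.
  rewrite /small; have [->|p0] := eqVneq p 0; first by rewrite add0r.
  have [->|q0] := eqVneq q 0; first by rewrite addr0 (negbTE p0).
  move=> /= hp hq; have [//|pq0] := eqVneq (p + q) 0.
  apply: (@le_lt_trans _ _ (Num.max (nu p) (nu q))); last by rewrite gt_max hp.
  by apply: (cv_add nuP) => //; rewrite le_max lexx ?orbT.
rewrite /small mulf_eq0; have := Wb i0 k; rewrite /ball.
have [//|W0] := eqVneq (W i0 k) 0; have [//|y0] := eqVneq (y a (c k)) 0.
move=> /= Wle; rewrite (cv_mul nuP) //.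
have [i wi] := badP _ (cbad k); rewrite (negbTE y0) /= => ylt.
have le1 : nu (w a i) <= nu (w a i0) := max0 i wi.
by apply: le_lt_trans (lt_le_trans ylt le1); rewrite gerDr.
Qed.

(** With [v] inserted, the determinant is a linear form in [v] whose coefficients are cofactors. The
    condition excludes cancellation in this form, whatever columns from [L] surround [v]. *)
Definition generic_for n (L : seq 'cV[K]_n) (v : 'cV[K]_n) : Prop :=
  forall (P : 'M[K]_n) j g, (forall k, k != j -> col k P \in L) ->
    ball nu g (\det (setcol P j v)) -> forall i, ball nu g (cofactor P i j).

Lemma generic_column n (L : seq 'cV[K]_n) :
  exists v : 'cV[K]_n, (forall i, ball nu 0 (v i ord0)) /\ generic_for L v.
Proof.
pose P_ (f : {ffun 'I_n -> 'I_(size L).+1}) : 'M[K]_n :=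
  \matrix_(i, k) (nth 0 L (f k)) i ord0.
have [u hu] := generic_nat (fun (a : {ffun 'I_n -> 'I_(size L).+1} * 'I_n) i =>
  cofactor (P_ a.1) i a.2).
exists (\col_i u%:R ^+ i); split => [i|P j g PL].
  rewrite mxE -natrX; exact: (ball_nat nuP).
(* Column [j] need not lie in [L]; the index [size L] then gives the default column 0. This is
   harmless, as the cofactors along [j] do not see that column. *)
pose f : {ffun 'I_n -> 'I_(size L).+1} := [ffun k => inord (index (col k P) L)].
have PE v : setcol P j v = setcol (P_ f) j v.
  apply/matrixP => i k; rewrite !mxE; case: eqVneq => // kj.
  by rewrite ffunE inordK ?ltnS ?index_size // nth_index ?PL // mxE.
have cE i : cofactor P i j = cofactor (P_ f) i j.
  have := congr1 determinant (PE (delta_mx i ord0)).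
  rewrite !det_setcol (bigD1 i) //= big1 ?addr0 => [|l /negbTE li]; last by rewrite mxE li mul0r.
  rewrite (bigD1 i) //= big1 ?addr0 => [|l /negbTE li]; last by rewrite mxE li mul0r.
  by rewrite mxE !eqxx !mul1r.
rewrite PE det_setcol => h i; rewrite cE.
apply: (hu (f, j)); move: h; congr (ball nu g _).
by apply: eq_bigr => l _; rewrite mxE.
Qed.

Lemma generic_seq n (L : seq 'cV[K]_n) k :
  exists vs : seq 'cV[K]_n, [/\ size vs = k,
    forall j i, (j < k)%N -> ball nu 0 (nth 0 vs j i ord0) &
    forall j, (j < k)%N -> generic_for (L ++ take j vs) (nth 0 vs j)].
Proof.
elim: k => [|k [vs [sz vb vg]]]; first by exists [::]; split.
have [v [vb1 vg1]] := generic_column (L ++ vs).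
exists (rcons vs v); rewrite size_rcons sz; split => // [j i|j].
  rewrite ltnS nth_rcons sz leq_eqVlt; case: ltnP => [/vb //|_]; rewrite orbF => -> //.
rewrite ltnS nth_rcons sz -cats1 leq_eqVlt; case: ltnP => [jk _|_].
  by rewrite takel_cat ?sz ?(ltnW jk) //; apply: vg.
by rewrite orbF => /eqP ->; rewrite eqxx -sz take_size_cat.
Qed.



End Generic.

Section GenericMatrix.
Variables (K : numFieldType) (cj : {rmorphism K -> K}) (nu : K -> RR).
Hypothesis nuP : convex_valuation cj nu.

Section Columns.
Variables (n : nat) (B : 'M[K]_n) (vs : seq 'cV[K]_n) (c : 'I_n -> 'I_(n + n)).
Hypothesis cI : injective c.
Let L : seq 'cV[K]_n := [seq col j B | j : 'I_n] ++ [seq delta_mx j ord0 | j : 'I_n].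
Hypothesis vb : forall j i, (j < n)%N -> ball nu 0 (nth 0 vs j i ord0).
Hypothesis vg : forall j, (j < n)%N -> generic_for nu (L ++ take j vs) (nth 0 vs j).

(* The columns [c] of [B | V], with the columns of [V] of index at least [k]
   replaced by unit vectors. *)
Let Q (k : nat) (f : 'I_n -> 'I_n) : 'M[K]_n := \matrix_(i, j)
  match split (c j) with
  | inl s => B i s
  | inr t => if (t < k)%N then nth 0 vs t i ord0 else (i == f j)%:R
  end.

(** At most one column [j] changes. Expanding along it, one direction holds because the entries of
    [vs] lie in the valuation ring, the other by genericity against the columns of [B], the unit
    vectors and the earlier columns. *)
Lemma generic_step k h : (k < n)%N -> size vs = n ->
  (forall f, ball nu h (\det (Q k f))) <-> (forall f, ball nu h (\det (Q k.+1 f))).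
Proof.
move=> kn szv.
have [/existsP[j /eqP ej]|none] := boolP [exists j, c j == rshift n (Ordinal kn)]; last first.
  have QE f : Q k.+1 f = Q k f.
    apply/matrixP => i j; rewrite !mxE; case: (split_ordP (c j)) => t e //.
    rewrite ltnS leq_eqVlt; case: (eqVneq (t : nat) k) => //= tk; exfalso.
    by move/negP: none; apply; apply/existsP; exists j; rewrite e; apply/eqP; congr rshift; apply: val_inj.
  by split => H f; [rewrite QE|rewrite -QE].
have jE t : c t = rshift n (Ordinal kn) -> t = j by move=> e; apply: cI; rewrite e ej.
(* Putting the unit vector [i] in column [j] turns a cofactor into a determinant of the same family,
   which is why all [f] are quantified together. *)
pose upd (f : 'I_n -> 'I_n) i l := if l == j then i else f l.
have QS f : Q k.+1 f = setcol (Q k f) j (nth 0 vs k).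
  apply/matrixP => i l; rewrite !mxE; case: (eqVneq l j) => [->|lj].
    by rewrite ej split_rshift /= ltnSn.
  case: (split_ordP (c l)) => t e //; rewrite ltnS leq_eqVlt; case: (eqVneq (t : nat) k) => //= tk.
  by case/eqP: lj; apply: jE; rewrite e; congr rshift; apply: val_inj.
have QU f i : \det (Q k (upd f i)) = cofactor (Q k f) i j.
  have -> : Q k (upd f i) = setcol (Q k f) j (delta_mx i ord0).
    apply/matrixP => a l; rewrite !mxE /upd; case: (eqVneq l j) => [->|//].
    by rewrite ej split_rshift /= ltnn andbT.
  rewrite det_setcol (bigD1 i) //= big1 ?addr0 => [|l /negbTE li]; last by rewrite mxE li mul0r.
  by rewrite mxE !eqxx mul1r.
split=> H f.
  rewrite QS det_setcol; apply: (ball_sum nuP) => i _; rewrite -QU -(add0r h).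
  by apply: (ballM nuP) => //; apply: vb.
have -> : Q k f = Q k (upd f (f j)).
  by apply/matrixP => i l; rewrite !mxE /upd; case: (eqVneq l j) => [->|].
rewrite QU; apply: (vg kn); last by rewrite -QS; apply: H.
move=> l lj; rewrite !mem_cat.
case e : (split (c l)) => [s|t].
  rewrite (_ : col l _ = col s B) ?image_f //; apply/matrixP => a b; rewrite !mxE e //.
case tk : (t < k)%N.
  have H1 : col l (Q k f) = nth 0 vs t.
    by apply/matrixP => a b; rewrite !mxE e tk (ord1 b).
  by rewrite H1 orbC -[X in X \in _](nth_take 0 tk) mem_nth // size_takel // szv ltnW.
have -> : col l (Q k f) = delta_mx (f l) ord0.
  by apply/matrixP => a b; rewrite !mxE e tk (ord1 b) eqxx andbT.
by rewrite (image_f (fun j => delta_mx j ord0)) // orbT.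
Qed.

Lemma generic_steps h : size vs = n ->
  (forall f, ball nu h (\det (Q 0 f))) <-> (forall f, ball nu h (\det (Q n f))).
Proof.
move=> sz; suff H k : (k <= n)%N ->
    (forall f, ball nu h (\det (Q 0 f))) <-> (forall f, ball nu h (\det (Q k f))) by apply: H.
by elim: k => // k IH kn; rewrite (IH (ltnW kn)); apply: generic_step.
Qed.

End Columns.

Lemma injective_onto n (T T' : {set 'I_n}) : #|T| = #|T'| ->
  exists f : 'I_n -> 'I_n, {in T &, injective f} /\ f @: T = T'.
Proof.
move=> e; have [T0|[x0 x0T]] := set_0Vmem T.
  rewrite T0 in e *; exists id; split; first by move=> ?; rewrite inE.
  by move: e; rewrite cards0 imset0 => /esym/eqP; rewrite cards_eq0 => /eqP.
pose f x := enum_val (cast_ord e (enum_rank_in x0T x)).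
have fI : {in T &, injective f}.
  by move=> x y hx hy /enum_val_inj/cast_ord_inj/(congr1 enum_val); rewrite !enum_rankK_in.
exists f; split => //; apply/eqP; rewrite eqEcard card_in_imset // e leqnn andbT.
by apply/subsetP => _ /imsetP[x _ ->]; apply: enum_valP.
Qed.

(** One [V] serves all [S], [T] and [h]: the valuation of a coordinate of [B | V] is the largest one
    among the minors of [B] on columns [S], and so is independent of [T]. The unit columns are
    replaced by those of [V] one at a time. *)
Theorem generic_matrix n (B : 'M[K]_n) : exists V : 'M[K]_n,
  forall (S T : {set 'I_n}) h, (#|S| + #|T| = n)%N ->
    ball nu h (pluecker (row_mx B V) (bcols S T)) <->
    (forall T' : {set 'I_n}, (#|S| + #|T'| = n)%N -> ball nu h (cominor B S T')).
Proof.
have [vs [sz vb vg]] := generic_seq nuP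
  ([seq col j B | j : 'I_n] ++ [seq delta_mx j ord0 | j : 'I_n]) n.
exists (\matrix_(i, j) nth 0 vs j i ord0) => S T h hST.
set V := \matrix_(i, j) _.
have hC : #|bcols S T| = n by rewrite card_bcols.
pose c (j : 'I_n) := enum_val (cast_ord (esym hC) j).
have cI : injective c by move=> i j /enum_val_inj /cast_ord_inj.
have cC x : (x \in bcols S T) = (x \in codom c).
  apply/idP/codomP => [hx|[j ->]]; last exact: enum_valP.
  by exists (cast_ord hC (enum_rank_in hx x)); rewrite /c cast_ordK enum_rankK_in.
pose Q (k : nat) (f : 'I_n -> 'I_n) : 'M[K]_n := \matrix_(i, j)
  match split (c j) with
  | inl s => B i s
  | inr t => if (t < k)%N then nth 0 vs t i ord0 else (i == f j)%:R
  end.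
have steps : (forall f, ball nu h (\det (Q 0 f))) <-> (forall f, ball nu h (\det (Q n f))).
  exact: (generic_steps cI vb vg h sz).
have Qn f : Q n f = colsub c (row_mx B V).
  apply/matrixP => i j; rewrite /Q !mxE; case: split => t //.
  by rewrite ltn_ord mxE.
pose cc (f : 'I_n -> 'I_n) j := match split (c j) with
  | inl s => lshift n s | inr _ => rshift n (f j) end.
have Q0 f : Q 0%N f = colsub (cc f) (row_mx B 1%:M).
  apply/matrixP => i j; rewrite /Q !mxE /cc; case: (split (c j)) => t.
    by rewrite split_lshift.
  by rewrite split_rshift ltn0 mxE.
have -> : ball nu h (pluecker (row_mx B V) (bcols S T)) <->
    (forall f, ball nu h (\det (Q 0%N f))).
  rewrite steps (plueckerE _ hC) -/c; split => [H f|/(_ id)]; by rewrite Qn.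
split => [H T' hT'|H f].
  have [g [gI gT]] : exists g : 'I_n -> 'I_n, {in T &, injective g} /\ g @: T = T'.
    by apply: injective_onto; apply/eqP; rewrite -(eqn_add2l #|S|) hST hT'.
  pose f j := match split (c j) with inl _ => j | inr t => g t end.
  have inT j t : c j = rshift n t -> t \in T by move=> e; rewrite -(bcols_r S T) cC -e codom_f.
  have ccI : injective (cc f).
    move=> i j; rewrite /cc /f => e; apply: cI; move: e.
    case: (split_ordP (c i)) => a ea; case: (split_ordP (c j)) => b eb;
      rewrite ?ea ?eb ?split_lshift ?split_rshift.
    - by move=> ->.
    - by move/eqP; rewrite eq_lrshift.
    - by move/eqP; rewrite eq_rlshift.
    - by move/rshift_inj/gI => -> //; [apply: inT ea | apply: inT eb].
  have [|b e] := @pluecker_colsub _ _ _ (row_mx B 1%:M) (cc f) (bcols S T') ccI.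
    move=> x; case: (split_ordP x) => a ->.
      rewrite bcols_l -(bcols_l S T) cC; apply/codomP/codomP => -[j ej]; exists j.
        by rewrite /cc -ej split_lshift.
      move: ej; rewrite /cc; case: (split_ordP (c j)) => t -> //.
      by move/eqP; rewrite eq_lrshift.
    rewrite bcols_r -gT; apply/imsetP/codomP => [[t tT ->]|[j]].
      have /codomP[j ej] : rshift n t \in codom c by rewrite -cC bcols_r.
      by exists j; rewrite /cc /f -ej !split_rshift.
    rewrite /cc /f; case: (split_ordP (c j)) => t e; first by move/eqP; rewrite eq_rlshift.
    by move/rshift_inj ->; exists t => //; apply: inT e.
  by have := H f; rewrite Q0 e (ball_sign nuP).
(* A repeated unit column makes the determinant vanish; otherwise the determinant is a [cominor] up
   to sign. *)
rewrite Q0; have [/injectiveP ccI|/injectivePn[i [j ij e]]] := boolP (injectiveb (cc f)); last first.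
  rewrite -det_tr (determinant_alternate ij) ?ball0 // => a; by rewrite !mxE e.
have [|b ->] := @pluecker_colsub _ _ _ (row_mx B 1%:M) (cc f) [set x in codom (cc f)] ccI.
  by move=> x; rewrite inE.
rewrite (ball_sign nuP) [X in pluecker _ X]bcols_surj.
set S' := [set i | _]; have -> : S' = S.
  apply/setP => s; rewrite !inE -(bcols_l S T) cC; apply/codomP/codomP => -[j ej]; exists j.
    by move: ej; rewrite /cc; case: (split_ordP (c j)) => t -> // /eqP; rewrite eq_lrshift.
  by rewrite /cc -ej split_lshift.
apply: H; rewrite -card_bcols.
have -> : bcols S [set i | rshift n i \in [set x in codom (cc f)]] = [set x in codom (cc f)].
  rewrite [RHS]bcols_surj; congr bcols; apply/setP => s.
  rewrite !inE -(bcols_l S T) cC; apply/codomP/codomP => -[j ej]; exists j.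
    by rewrite /cc -ej split_lshift.
  by move: ej; rewrite /cc; case: (split_ordP (c j)) => t -> // /eqP; rewrite eq_lrshift.
by rewrite cardsE card_codom // card_ord.
Qed.

End GenericMatrix.

(** * Points of the Grassmannian slice *)

Section Slice.
Variables (K : numFieldType) (cj : {rmorphism K -> K}) (nu : K -> RR).
Hypothesis nuP : convex_valuation cj nu.

(** The intersection of [nu_set] of [Gr] with [Lspace], read on subsets through [phi_rel]. *)
Definition Gr_slice n (F : {set 'I_n} -> RR) : Prop :=
  exists M : 'M[K]_(n, n + n), forall S T : {set 'I_n}, (#|S| + #|T| = n)%N ->
    pluecker M (bcols S T) != 0 /\ nu (pluecker M (bcols S T)) = F S.

(** The assumed coordinate is, up to sign, the determinant of the right block, so [M] factors as
    this block times [B | 1]. *)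
Lemma row_mx_unit_factor n (M : 'M[K]_(n, n + n)) :
  pluecker M (bcols set0 setT) != 0 ->
  let B := invmx (rsubmx M) *m lsubmx M in
  \det (rsubmx M) != 0 /\
  forall S T : {set 'I_n}, (#|S| + #|T| = n)%N ->
    pluecker M (bcols S T) = \det (rsubmx M) * cominor B S T.
Proof.
move=> h; pose r (i : 'I_n) := rshift n i.
have rI : injective r by apply: rshift_inj.
have [|b e] := @pluecker_colsub _ _ _ M r (bcols set0 setT) rI.
  move=> x; case: (split_ordP x) => i ->; rewrite ?bcols_l ?bcols_r !inE.
    by symmetry; apply/codomP => -[j /eqP]; rewrite eq_lrshift.
  by symmetry; apply: codom_f.
have rE : rsubmx M = colsub r M by apply/matrixP => i j; rewrite !mxE.
have d0 : \det (rsubmx M) != 0 by rewrite rE e mulf_neq0 // signr_eq0.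
split=> // S T hST; rewrite /cominor -pluecker_mull ?card_bcols //.
by rewrite mul_mx_row mulmx1 mulKVmx ?hsubmxK // unitmxE unitfE.
Qed.

Lemma Gr_slice_cominor n (F : {set 'I_n} -> RR) : Gr_slice F ->
  exists (c : K) (B : 'M[K]_n), c != 0 /\ forall S T : {set 'I_n}, (#|S| + #|T| = n)%N ->
    cominor B S T != 0 /\ F S = nu c + nu (cominor B S T).
Proof.
move=> [M hM].
have [|c0 E] := @row_mx_unit_factor n M.
  by apply: (hM _ _ _).1; rewrite cards0 cardsT card_ord.
exists (\det (rsubmx M)), (invmx (rsubmx M) *m lsubmx M); split=> // S T hST.
have [h <-] := hM S T hST; move: h; rewrite E // mulf_eq0 (negbTE c0) /= => h.
by rewrite (cv_mul nuP).
Qed.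

(** Here [f S] is the largest valuation of a minor on columns [S], and [generic_matrix] realizes it
    in every coordinate. *)
Lemma Gr_slice_of_bound n (c : K) (B : 'M[K]_n.+1) (f F : {set 'I_n.+1} -> RR) :
  c != 0 ->
  (forall (S : {set 'I_n.+1}) h, (forall T : {set 'I_n.+1}, (#|S| + #|T| = n.+1)%N -> ball nu h (cominor B S T))
     <-> f S <= h) ->
  (forall S, F S = nu c + f S) -> Gr_slice F.
Proof.
move=> c0 hf hF; have [V hV] := generic_matrix nuP B.
(* Scaling one row by [c] multiplies every maximal minor by [c]; this needs at least one row. *)
pose d : 'rV[K]_n.+1 := \row_j if j == ord0 then c else 1.
have dE : \det (diag_mx d) = c.
  by rewrite det_diag big_ord_recl big1 ?mxE ?mulr1 // => j _; rewrite !mxE.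
exists (diag_mx d *m row_mx B V) => S T hST.
rewrite pluecker_mull ?card_bcols // dE.
set x := pluecker _ _.
have xb h : ball nu h x <-> f S <= h by rewrite (hV S T h hST).
have x0 : x != 0.
  apply: (@ball_neq0 _ nu _ (f S - 1)); apply/negP => /xb; lra.
split; first by rewrite mulf_neq0.
by rewrite (cv_mul nuP) // hF (nu_eq_ball x0 xb).
Qed.

Lemma gram_minor_gt0 n (B : 'M[K]_n) (S : {set 'I_n}) :
  (forall T : {set 'I_n}, (#|S| + #|T| = n)%N -> cominor B S T != 0) ->
  0 < principal_minor (gram cj B) S.
Proof.
move=> h; rewrite gram_minor (bigD1 S) //=.
have hS : (#|S| + #|~: S| = n)%N by rewrite cardsC card_ord.
apply: ltr_pwDl; first exact: (norm_gt0 nuP (h _ hS)).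
by apply: sumr_ge0 => R _; apply: (norm_ge0 nuP).
Qed.

(** All minors of [B] on columns [S] have the same valuation, so the Gram matrix doubles it exactly,
    and [c] is squared accordingly. *)
Lemma Gr_slice_PM n (F : {set 'I_n} -> RR) : Gr_slice F ->
  nu_set 0 nu (cone (@PMplus K cj n)) (fun S => F S + F S).
Proof.
move=> /Gr_slice_cominor[c [B [c0 hB]]].
have pS S : 0 < principal_minor (gram cj B) S.
  by apply: gram_minor_gt0 => T /hB[].
exists (fun S => (c * c) * principal_minor (gram cj B) S); split.
  exists (c * c), (principal_minor (gram cj B)); split=> //.
  by exists (gram cj B); split=> //; split=> // i j; apply: (gram_herm nuP).
have pS0 S : principal_minor (gram cj B) S != 0 by rewrite gt_eqF.
have cc0 : c * c != 0 by rewrite mulf_neq0.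
have nz S : c * c * principal_minor (gram cj B) S <> 0.
  by apply/eqP; rewrite mulf_neq0.
split=> // S; rewrite !(cv_mul nuP) //.
rewrite (@nu_eq_ball _ nu (principal_minor _ S) (F S + F S - (nu c + nu c))).
- lra.
- exact: pS0.
move=> h; have -> : h = h / 2 + h / 2 by lra.
rewrite (gram_ball nuP); split => [H|H T hT].
  have hS : (#|S| + #|~: S| = n)%N by rewrite cardsC card_ord.
  have [nz1 ->] := hB S (~: S) hS; have := H _ hS; rewrite ballE //; lra.
have [nz1 e] := hB S T hT; rewrite ballE //; rewrite e in H; lra.
Qed.

Lemma PM_Gr_slice n (F : {set 'I_n.+1} -> RR) :
  nu_set 0 nu (cone (@PMplus K cj n.+1)) F -> Gr_slice (fun S => F S / 2).
Proof.
move=> [b [[lam [a [[A [pA aE]] bE]]] [b0 FE]]].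
have [|B AB] := cholesky nuP pA.1; first by move=> k s; apply: posdef_minor pA.
have l0 : lam != 0.
  by apply/eqP => e; apply: (b0 set0); rewrite bE e mul0r.
(* The scalar [lam] may fail to be a norm. Its absolute value has the same valuation and is the norm
   of some [c]. *)
have nl0 : 0 < `|lam| by rewrite normr_gt0.
have [c cE] := cv_sqrt nuP nl0.
have c0 : c != 0 by apply: contraTneq nl0 => e; rewrite -cE e mul0r ltxx.
have cn : nu c + nu c = nu lam by rewrite -(cv_norm nuP c0) cE (nu_normr nuP).
have AS S : principal_minor A S != 0.
  by apply/eqP => e; apply: (b0 S); rewrite bE aE e mulr0.
apply: (@Gr_slice_of_bound n c B (fun S => nu (principal_minor A S) / 2)) => // S.
  move=> h; rewrite -(gram_ball nuP) -AB ballE //; split; lra.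
by rewrite FE bE aE (cv_mul nuP) // -cn; lra.
Qed.

(** * Flags spanned by the first rows of a matrix *)

Definition high n (k : nat) : {set 'I_n} := [set i : 'I_n | (k <= i)%N].
Definition low n (k : nat) : {set 'I_n} := [set i : 'I_n | (i < k)%N].

Lemma lowCE n k : low n k = ~: high n k.
Proof. by apply/setP => i; rewrite !inE ltnNge. Qed.

Lemma card_low n k : (k <= n)%N -> #|low n k| = k.
Proof.
move=> kn; have -> : low n k = [set widen_ord kn i | i : 'I_k].
  apply/setP => i; rewrite inE; apply/idP/imsetP => [ik|[j _ ->]]; last exact: (ltn_ord j).
  by exists (Ordinal ik) => //; apply: val_inj.
rewrite card_imset ?card_ord // => i j /(congr1 val) /= e; exact: val_inj.
Qed.

Lemma card_high n k : (k <= n)%N -> (k + #|high n k|)%N = n.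
Proof.
by move=> kn; rewrite -{1}(card_low kn) lowCE addnC cardsC card_ord.
Qed.

Definition top_rows n k (kn : (k <= n)%N) (B : 'M[K]_n) : 'M[K]_(k, n) :=
  rowsub (widen_ord kn) B.

Lemma cominor_high n k (kn : (k <= n)%N) (B : 'M[K]_n) (S : {set 'I_n}) :
  #|S| = k -> exists b : bool,
    cominor B S (high n k) = (-1) ^+ b * pluecker (top_rows kn B) S.
Proof.
move=> hS; pose s (j : 'I_k) := enum_val (cast_ord (esym hS) j).
have [|||||b e] := @pluecker_pad _ n k B S (high n k) (widen_ord kn) s.
- exact: card_high.
- by move=> i j /enum_val_inj /cast_ord_inj.
- move=> x; apply/idP/codomP => [hx|[j ->]]; last exact: enum_valP.
  by exists (cast_ord hS (enum_rank_in hx x)); rewrite /s cast_ordK enum_rankK_in.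
- by move=> i j /(congr1 val) /= e; apply: val_inj.
- move=> x; rewrite inE -ltnNge; apply/idP/codomP => [ik|[j ->]]; last exact: (ltn_ord j).
  by exists (Ordinal ik); apply: val_inj.
exists b; rewrite /cominor e (plueckerE _ hS); congr (_ * \det _).
by apply/matrixP => i j; rewrite !mxE.
Qed.

Lemma rank_pluecker k n (M : 'M[K]_(k, n)) (S : {set 'I_n}) :
  #|S| = k -> pluecker M S != 0 -> \rank M = k.
Proof.
move=> hS; rewrite (plueckerE _ hS) -unitfE -unitmxE => /mxrank_unit rk.
apply/eqP; rewrite eqn_leq rank_leq_row -{1}rk.
pose c (j : 'I_k) := enum_val (cast_ord (esym hS) j).
rewrite -/c; have -> : colsub c M = M *m colsub c 1%:M.
  by rewrite mulmx_colsub mulmx1.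
exact: mxrankM_maxl.
Qed.

(** After factoring out the right block, the flag is spanned by the first rows of [B]; the
    determinant of that block serves as scalar at all levels. *)
Lemma pluecker_Fl n (M : 'M[K]_(n, n + n)) :
  (forall S T : {set 'I_n}, (#|S| + #|T| = n)%N -> pluecker M (bcols S T) != 0) ->
  nu_set 0 nu (@Fl K n) (fun S => nu (pluecker M (bcols S (high n #|S|)))).
Proof.
move=> M0; have [|c0 E] := @row_mx_unit_factor n M.
  by apply: M0; rewrite cards0 cardsT card_ord.
move: (\det _) (invmx _ *m _) c0 E => c B c0 E.
have kn (k : 'I_n.+1) : (k <= n)%N by rewrite -ltnS.
pose N (k : 'I_n.+1) := top_rows (kn k) B.
have NP (k : 'I_n.+1) (S : {set 'I_n}) : #|S| = k ->
    pluecker (N k) S != 0 /\ nu (pluecker M (bcols S (high n k))) = nu (c * pluecker (N k) S).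
  move=> hS; have hST : (#|S| + #|high n k| = n)%N by rewrite hS card_high.
  have [b e] := cominor_high (kn k) B hS.
  have := M0 _ _ hST; rewrite E // e mulrCA (nu_sign nuP) !mulf_eq0 signr_eq0 !negb_or /=.
  by case/andP.
have sz (S : {set 'I_n}) : (#|S| < n.+1)%N by rewrite ltnS -[X in (_ <= X)%N]card_ord max_card.
exists (fun S => c * pluecker (N (Ordinal (sz S))) S); split; last first.
  split=> S; have [nz e] := NP (Ordinal (sz S)) S erefl; last exact: e.
  by apply/eqP; rewrite mulf_neq0.
exists N, (fun=> c); split; [|split; [|split => //]].
- move=> k; apply: (@rank_pluecker _ _ _ (low n k)); first exact: card_low.
  by apply: (NP k _ _).1; apply: card_low.
- move=> k k' kk'; apply/row_subP => i.
  have -> : row i (N k) = row (widen_ord kk' i) (N k').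
    by apply/rowP => j; rewrite !mxE; congr (B _ _); apply: val_inj.
  exact: row_sub.
- move=> k S hS; have -> // : Ordinal (sz S) = k by exact/val_inj.
Qed.

End Slice.

(** * Submodularity *)

Lemma bcols_exchange_lr n (S T : {set 'I_n}) i p :
  rshift n p |: (bcols S T :\ lshift n i) = bcols (S :\ i) (p |: T).
Proof.
apply/setP => x; rewrite in_setU1 in_setD1; case: (split_ordP x) => y ->.
  by rewrite !bcols_l eq_lrshift eq_lshift !inE.
by rewrite !bcols_r eq_rlshift eq_rshift !inE.
Qed.

Lemma bcols_exchange_rr n (S T : {set 'I_n}) i p :
  rshift n p |: (bcols S T :\ rshift n i) = bcols S (p |: (T :\ i)).
Proof.
apply/setP => x; rewrite in_setU1 in_setD1; case: (split_ordP x) => y ->.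
  by rewrite !bcols_l !eq_lrshift.
by rewrite !bcols_r !eq_rshift !inE.
Qed.

Lemma bcols_exchange_rl n (S T : {set 'I_n}) i p :
  lshift n p |: (bcols S T :\ rshift n i) = bcols (p |: S) (T :\ i).
Proof.
apply/setP => x; rewrite in_setU1 in_setD1; case: (split_ordP x) => y ->.
  by rewrite !bcols_l eq_lrshift eq_lshift !inE.
by rewrite !bcols_r eq_rlshift eq_rshift !inE.
Qed.

(** First, marginal gains decrease along inclusions, by induction on [T :\: W]; then the elements of
    [S :\: T] are removed one at a time. *)
Lemma submod_of_local n (F : {set 'I_n} -> RR) :
  (forall (W : {set 'I_n}) i j, i \notin W -> j \notin W -> i != j ->
     F W + F (i |: (j |: W)) <= F (i |: W) + F (j |: W)) -> SUBMOD F.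
Proof.
move=> loc.
have dim (T W : {set 'I_n}) i : W \subset T -> i \notin T -> F (i |: T) - F T <= F (i |: W) - F W.
  move: {2}#|_| (erefl #|T :\: W|) => k; elim: k T => [|k IH] T.
    move/eqP; rewrite cards_eq0 setD_eq0 => TW WT _.
    by have -> : T = W by apply/eqP; rewrite eqEsubset TW.
  move=> e WT iT; have /card_gt0P[j] : (0 < #|T :\: W|)%N by rewrite e.
  rewrite inE => /andP[jW jT].
  have := IH (T :\ j); rewrite setDDl setUC -setDDl => /(_ _ _ _) IH'.
  apply: le_trans (IH' _ _ _); first last.
  - by rewrite !inE negb_and iT orbT.
  - by rewrite subsetD1 WT.
  - by move: e; rewrite [in LHS](cardsD1 j) inE jW jT => -[].
  have := loc (T :\ j) i j; rewrite setD1K // !inE eqxx /= negb_and iT orbT.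
  have ij : i != j by apply: contraNneq iT => ->.
  by move=> /(_ isT isT ij); lra.
move=> S T; move: {2}#|_| (erefl #|S :\: T|) => k; elim: k S => [|k IH] S.
  move/eqP; rewrite cards_eq0 setD_eq0 => ST.
  by rewrite (setIidPl ST) (setUidPr ST) lexx.
move=> e; have /card_gt0P[j] : (0 < #|S :\: T|)%N by rewrite e.
rewrite inE => /andP[jT jS].
have := IH (S :\ j); rewrite setDDl setUC -setDDl => IH'.
have {IH'} : F ((S :\ j) :&: T) + F ((S :\ j) :|: T) <= F (S :\ j) + F T.
  by apply: IH'; move: e; rewrite [in LHS](cardsD1 j) inE jT jS => -[].
have -> : (S :\ j) :&: T = S :&: T.
  apply/setP => x; rewrite !inE; case: eqVneq => //= ->; by rewrite (negbTE jT) andbF.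
have := @dim ((S :\ j) :|: T) (S :\ j) j.
rewrite setUA !setD1K // subsetUl !inE eqxx /= => /(_ isT jT); lra.
Qed.

(** * Submodularity from three-term Pluecker relations *)

Section Flags.
Variables (K : numFieldType) (cj : {rmorphism K -> K}) (nu : K -> RR).
Hypothesis nuP : convex_valuation cj nu.

Lemma exchange_ball n m (M : 'M[K]_(n, m)) (C D : {set 'I_m}) p g :
  #|C| = n -> #|D| = n -> p \in D -> p \notin C ->
  (forall i, i \in C :\: D ->
     ball nu g (pluecker M (p |: (C :\ i)) * pluecker M (i |: (D :\ p)))) ->
  ball nu g (pluecker M C * pluecker M D).
Proof.
move=> hC hD pD pC h; apply: (@pluecker_exchange _ _ _ M C D p (ball nu g)) => //.
- exact: ball0.
- exact: (ballD nuP).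
- by move=> x; rewrite (ballN nuP).
Qed.

(** The three-term relation bounds the product of the two outer coordinates by the two mixed
    products. An error [d] in each of the four coordinates is allowed, so that the statement also
    serves limits of Grassmannian points. *)
Lemma near_slice_local n (M : 'M[K]_(n, n + n)) (F : {set 'I_n} -> RR) d :
  (forall S T : {set 'I_n}, (#|S| + #|T| = n)%N ->
     pluecker M (bcols S T) != 0 /\ `|F S - nu (pluecker M (bcols S T))| <= d) ->
  forall (W : {set 'I_n}) i j, i \notin W -> j \notin W -> i != j ->
     F W + F (i |: (j |: W)) <= F (i |: W) + F (j |: W) + d *+ 4.
Proof.
move=> hM W i j iW jW ij.
pose T := ~: W :\ i :\ j.
have cW : (#|W| + #|~: W| = n)%N by rewrite cardsC card_ord.
have cT : (#|~: W| = #|T|.+2)%N.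
  by rewrite (cardsD1 i) (cardsD1 j) !inE iW jW eq_sym ij !add1n.
have cij : (#|i |: (j |: W)| = #|W|.+2)%N.
  by rewrite !cardsU1 !inE negb_or iW jW ij !add1n.
have bnd (S T' : {set 'I_n}) g : (#|S| + #|T'| = n)%N -> F S + d <= g -> ball nu g (pluecker M (bcols S T')).
  move=> /hM[nz]; rewrite ler_distlC => /andP[_ h] hg; rewrite ballE //; lra.
have lo (S T' : {set 'I_n}) : (#|S| + #|T'| = n)%N -> pluecker M (bcols S T') != 0 /\
    F S - d <= nu (pluecker M (bcols S T')).
  by move=> /hM[nz]; rewrite ler_distlC => /andP[h _]; split => //; lra.
have iT : i \notin T by rewrite !inE eqxx andbF.
have h1 : (#|i |: (j |: W)| + #|T| = n)%N by rewrite cij; lia.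
(* Column [i] of the right block is exchanged; only columns [i] and [j] of the left block can
   replace it. *)
have : ball nu (F (i |: W) + d + (F (j |: W) + d))
    (pluecker M (bcols (i |: (j |: W)) T) * pluecker M (bcols W (~: W))).
  apply: (@exchange_ball _ _ _ _ _ (rshift n i)); rewrite ?card_bcols //.
  - by rewrite bcols_r inE.
  - by rewrite bcols_r !inE eqxx andbF.
  move=> x; rewrite in_setD; case: (split_ordP x) => y ->; last first.
    by rewrite !bcols_r !inE => /andP[/negP h /and3P[_ _ /h]].
  rewrite !bcols_l !inE => /andP[yW]; rewrite (negbTE yW) orbF.
  rewrite bcols_exchange_lr bcols_exchange_rl => /orP[]/eqP ->.
    have -> : (i |: (j |: W)) :\ i = j |: W.
      by apply/setP => z; rewrite !inE; case: eqVneq => //= ->; rewrite (negbTE ij) (negbTE iW).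
    rewrite addrC; apply: (ballM nuP); apply: bnd => //.
    - by rewrite !cardsU1 jW iT; lia.
    - rewrite cardsU1 iW; move: cW; rewrite (cardsD1 i (~: W)) !inE iW !add1n => E; by rewrite -[RHS]E addSn addnS.
  have -> : (i |: (j |: W)) :\ j = i |: W.
    by apply/setP => z; rewrite !inE; case: eqVneq => //= ->; rewrite eq_sym (negbTE ij) (negbTE jW).
  apply: (ballM nuP); apply: bnd => //.
  - by rewrite !cardsU1 iW iT; lia.
  - rewrite cardsU1 jW; move: cW; rewrite (cardsD1 i (~: W)) !inE iW !add1n => E; by rewrite -[RHS]E addSn addnS.
have [n1 l1] := lo _ _ h1; have [n2 l2] := lo _ _ cW.
rewrite ballE ?mulf_neq0 // (cv_mul nuP) //; lra.
Qed.

Lemma Gr_slice_submod n (F : {set 'I_n} -> RR) : Gr_slice nu F -> SUBMOD F.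
Proof.
move=> [M hM]; apply: submod_of_local => W i j iW jW ij.
have := @near_slice_local n M F 0 _ W i j iW jW ij; rewrite mul0rn addr0; apply.
by move=> S T /hM[? ->]; split=> //; rewrite subrr normr0.
Qed.

End Flags.

(** * From flags to the slice *)

Section FlagBasis.
Variables (K : numFieldType) (cj : {rmorphism K -> K}) (nu : K -> RR).
Hypothesis nuP : convex_valuation cj nu.

Lemma pluecker_low k n (kn : (k <= n)%N) (N : 'M[K]_(k, n)) :
  exists b : bool, \det (colsub (widen_ord kn) N) = (-1) ^+ b * pluecker N (low n k).
Proof.
apply: pluecker_colsub => [i j /(congr1 val) /= e|x]; first exact: val_inj.
rewrite inE; apply/idP/codomP => [xk|[j ->]]; last exact: (ltn_ord j).
by exists (Ordinal xk); apply: val_inj.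
Qed.

(** The first k+1 columns of [N] form an invertible block, so a combination of the rows takes
    prescribed values on them. *)
Lemma exists_echelon_row k n (kn : (k < n)%N) (N : 'M[K]_(k.+1, n)) (d : K) :
  pluecker N (low n k.+1) != 0 ->
  exists v : 'rV[K]_n, [/\ (v <= N)%MS, forall j : 'I_n, (j < k)%N -> v ord0 j = 0 &
    v ord0 (Ordinal kn) = d].
Proof.
move=> nz; have [b e] := pluecker_low kn N.
have Pu : colsub (widen_ord kn) N \in unitmx by rewrite unitmxE unitfE e mulf_neq0 ?signr_eq0.
pose v := d *: (delta_mx ord0 ord_max *m invmx (colsub (widen_ord kn) N) *m N) : 'rV_n.
have vE : colsub (widen_ord kn) v = d *: delta_mx ord0 ord_max.
  have -> : colsub (widen_ord kn) v = d *: colsub (widen_ord kn)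
      (delta_mx ord0 ord_max *m invmx (colsub (widen_ord kn) N) *m N).
    by apply/matrixP => i j; rewrite !mxE.
  by rewrite -mulmx_colsub mulmxKV.
exists v; split.
- by rewrite scalemx_sub // submxMl.
- move=> j jk; have /matrixP/(_ ord0 (Ordinal (ltnW jk : (j < k.+1)%N))) := vE.
  rewrite !mxE -[_ == ord_max]val_eqE /= ltn_eqF // mulr0 => E; rewrite -[RHS]E.
  by congr (_ * _); apply: eq_bigr => i _ /=; congr (_ * N _ _); apply: val_inj.
have /matrixP/(_ ord0 ord_max) := vE.
rewrite !mxE !eqxx mulr1 => E; rewrite -[RHS]E.
by congr (_ * _); apply: eq_bigr => i _; congr (_ * N _ _); apply: val_inj.
Qed.

Lemma cominor_row0 n (B : 'M[K]_n) (S T : {set 'I_n}) i :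
  (#|S| + #|T| = n)%N -> i \notin T -> (forall j, j \in S -> B i j = 0) -> cominor B S T = 0.
Proof.
move=> hST iT Bi; have hC : #|bcols S T| = n by rewrite card_bcols.
rewrite /cominor (plueckerE _ hC) (expand_det_row _ i) big1 // => j _.
have := enum_valP (cast_ord (esym hC) j); rewrite mxE.
case: (split_ordP (enum_val (cast_ord (esym hC) j))) => t ->; rewrite ?bcols_l ?bcols_r => ht.
  by rewrite row_mxEl Bi // mul0r.
rewrite row_mxEr mxE; case: eqVneq => [e|]; last by rewrite mul0r.
by rewrite e ht in iT.
Qed.

(** A point of the flag variety carries an independent scalar at each level. A suitable choice of
    the diagonal of an echelon basis absorbs them all into the single scalar [q set0]. *)
Lemma flag_basis n (F : {set 'I_n} -> RR) : nu_set 0 nu (@Fl K n) F ->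
  exists (c : K) (B : 'M[K]_n), [/\ c != 0, nu c = F set0,
    forall i j : 'I_n, (j < i)%N -> B i j = 0 &
    forall S : {set 'I_n}, cominor B S (high n #|S|) != 0 /\
      nu (cominor B S (high n #|S|)) = F S - F set0].
Proof.
move=> [q [[M [c [rkM [leM [c0 qE]]]]] [q0 FE]]].
have q0' S : q S != 0 by apply/eqP; apply: q0.
have plM (k : 'I_n.+1) (S : {set 'I_n}) : #|S| = k -> pluecker (M k) S != 0.
  by move=> hS; have := q0' S; rewrite (qE k) // mulf_eq0 negb_or => /andP[].
have kn (k : 'I_n.+1) : (k <= n)%N by rewrite -ltnS.
(* With these diagonal entries the leading minors telescope to [q (low n k) / q set0]. *)
pose d (i : 'I_n) := q (low n i.+1) / q (low n i).
have row_ex (i : 'I_n) : exists v : 'rV[K]_n,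
    [/\ (v <= M (lift ord0 i))%MS, forall j : 'I_n, (j < i)%N -> v ord0 j = 0 & v ord0 i = d i].
  have [|v [h1 h2 h3]] := @exists_echelon_row i n (ltn_ord i) (M (lift ord0 i)) (d i).
    by apply: (plM (lift ord0 i)); rewrite card_low.
  by exists v; split=> //; rewrite -h3; congr (v _ _); apply: val_inj.
have [v hv] := fin_all_exists row_ex.
pose B : 'M[K]_n := \matrix_(i, j) v i ord0 j.
have Btri (i j : 'I_n) : (j < i)%N -> B i j = 0 by move=> ji; rewrite mxE; case: (hv i) => _ h _; apply: h.
exists (q set0), B; split=> //.
move=> S; have sz : (#|S| < n.+1)%N by rewrite ltnS -[X in (_ <= X)%N]card_ord max_card.
pose k := Ordinal sz.
have /submxP[X XE] : (top_rows (kn k) B <= M k)%MS.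
  apply/row_subP => i; have [h _ _] := hv (widen_ord (kn k) i).
  have -> : row i (top_rows (kn k) B) = v (widen_ord (kn k) i).
    by apply/rowP => j; rewrite !mxE.
  by apply: submx_trans h (leM _ _ _); rewrite /= /bump /=; apply: ltn_ord.
have clow : #|low n k| = k by rewrite card_low.
have pl (S' : {set 'I_n}) : #|S'| = k ->
    pluecker (top_rows (kn k) B) S' = \det X * pluecker (M k) S'.
  by move=> h; rewrite XE pluecker_mull.
have detB : \det (colsub (widen_ord (kn k)) (top_rows (kn k) B)) = q (low n k) / q set0.
  have telescope m : \prod_(0 <= i < m) (q (low n i.+1) / q (low n i)) = q (low n m) / q set0.
    have <- : low n 0 = set0 by apply/setP => i; rewrite !inE.
    elim: m => [|m IH]; first by rewrite big_nil divff.
    by rewrite big_nat_recr //= IH mulrC mulrA divfK.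
  rewrite -det_tr det_trig; last first.
    by apply/is_trig_mxP => i j ij; rewrite !mxE; case: (hv (widen_ord (kn k) j)) => _ h _; apply: h.
  transitivity (\prod_(i < k) (q (low n i.+1) / q (low n i))).
    by apply: eq_bigr => i _; rewrite !mxE; case: (hv (widen_ord (kn k) i)).
  by rewrite -(big_mkord xpredT (fun i => q (low n i.+1) / q (low n i))) telescope.
have X0 : \det X * pluecker (M k) (low n k) != 0 /\
    nu (\det X * pluecker (M k) (low n k)) = F (low n k) - F set0.
  rewrite -pl //; have [b] := pluecker_low (kn k) (top_rows (kn k) B).
  rewrite detB => e.
  have -> : pluecker (top_rows (kn k) B) (low n k) = (-1) ^+ b * (q (low n k) / q set0).
    by rewrite e mulrA -signr_addb addbb mul1r.
  split.
    by rewrite mulf_neq0 ?signr_eq0 // mulf_neq0 // invr_eq0.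
  by rewrite (nu_sign nuP) (nu_div nuP) // -!FE.
have dX : \det X != 0 by have := X0.1; rewrite mulf_eq0 negb_or => /andP[].
have [b ->] := @cominor_high K n k (kn k) B S erefl.
rewrite pl //; split; first by rewrite mulf_neq0 ?signr_eq0 // mulf_neq0 // plM.
have := X0.2; rewrite (nu_sign nuP) !(cv_mul nuP) ?plM //.
rewrite !FE (qE k S) // (qE k (low n k)) // !(cv_mul nuP) ?plM //; lra.
Qed.

End FlagBasis.

(** * Bounding all minors of an echelon basis by a submodular function *)

Section FlagSlice.
Variables (K : numFieldType) (cj : {rmorphism K -> K}) (nu : K -> RR).
Hypothesis nuP : convex_valuation cj nu.

Section Bound.
Variables (n : nat) (B : 'M[K]_n) (f : {set 'I_n} -> RR).
Hypothesis fsub : SUBMOD f.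
Hypothesis Btri : forall i j : 'I_n, (j < i)%N -> B i j = 0.
Hypothesis Btop : forall S : {set 'I_n}, cominor B S (high n #|S|) != 0 /\
  nu (cominor B S (high n #|S|)) = f S.

Lemma Btop_ball (S : {set 'I_n}) k : #|S| = k -> ball nu (f S) (cominor B S (high n k)).
Proof. by move=> <-; have [nz e] := Btop S; rewrite ballE // e. Qed.

(* [f S] bounds the minors of [B] on columns [S] whose rows are among the
   first [m]. *)
Definition bounded_upto m := forall S T : {set 'I_n}, (#|S| + #|T| = n)%N ->
  high n m \subset T -> ball nu (f S) (cominor B S T).

Lemma highS m (r : 'I_n) : r = m :> nat -> high n m = r |: high n m.+1.
Proof.
by move=> rm; apply/setP => i; rewrite !inE -val_eqE /= rm [RHS]orbC leq_eqVlt eq_sym orbC.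
Qed.

(** Treats the first m+1 rows without row [r], by induction on the part of [W] outside the first m
    columns. If that part is empty, row [m] vanishes on [W]; otherwise an exchange with a set [W1]
    closer to [low n m] applies, and the known factor on [W1] is cancelled. *)
Lemma omit_row_bound (m r : 'I_n) : bounded_upto m -> (r < m)%N ->
  forall W : {set 'I_n}, #|W| = m -> ball nu (f W) (cominor B W (r |: high n m.+1)).
Proof.
move=> good rm W; have mn : (m <= n)%N by apply: ltnW.
have mh : m \notin high n m.+1 by rewrite inE ltnn.
have rh : r \notin high n m by rewrite inE -ltnNge.
have rh1 : r \notin high n m.+1 by rewrite inE -ltnNge (ltn_trans rm).
have chm : (m + #|high n m| = n)%N by apply: card_high.
have chm1 : #|high n m| = #|high n m.+1|.+1 by rewrite (highS (erefl (m : nat))) cardsU1 mh.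
move: {2}#|_| (erefl #|W :\: low n m|) => k; elim: k W => [|k IH] W.
  move/eqP; rewrite cards_eq0 setD_eq0 => Wl hW.
  have {Wl} -> : W = low n m by apply/eqP; rewrite eqEcard Wl hW card_low ?leqnn.
  rewrite (@cominor_row0 _ _ _ _ _ m) ?ball0 //.
  - by rewrite card_low // cardsU1 rh1 -[RHS]chm chm1.
  - by rewrite !inE ltnn orbF; apply: contraTneq rm => ->; rewrite ltnn.
  - by move=> j; rewrite inE => /Btri.
move=> e hW.
have [i /setDP[iW il]] : exists i, i \in W :\: low n m by apply/card_gt0P; rewrite e.
have [j /setDP[jl jW]] : exists j, j \in low n m :\: W.
  apply/card_gt0P; have := cardsID W (low n m); have := cardsID (low n m) W.
  by rewrite setIC hW e card_low //; lia.
have ij : i != j by apply: contraNneq jW => <-.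
pose W1 := j |: (W :\ i).
have cW1 : #|W1| = m.
  by rewrite cardsU1 !inE (negbTE jW) andbF -hW (cardsD1 i W) iW.
have bW1 : ball nu (f W1) (cominor B W1 (r |: high n m.+1)).
  apply: IH => //; move: e; rewrite [in LHS](cardsD1 i) in_setD il iW => -[<-].
  congr #|pred_of_set _|; apply/setP => z; rewrite !inE.
  by case: (eqVneq z j) => [->|_] /=; [move: jl; rewrite inE => -> /=; rewrite andbF|rewrite andbCA].
have nzW1 := Btop W1; rewrite cW1 in nzW1.
have nzW := Btop W; rewrite hW in nzW.
have cT : (#|W1| + #|high n m| = n)%N by rewrite cW1.
have cT' : (#|W| + #|r |: high n m.+1| = n)%N by rewrite hW cardsU1 rh1 -[RHS]chm chm1.
suff : ball nu (f W1 + f W) (cominor B W1 (high n m) * cominor B W (r |: high n m.+1)).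
  by rewrite -nzW1.2 (ball_mull nuP) ?nzW1.1.
apply: (exchange_ball nuP (p := rshift n r)); rewrite ?card_bcols //.
- by rewrite bcols_r !inE eqxx.
- by rewrite bcols_r.
move=> x; rewrite in_setD; case: (split_ordP x) => y ->; rewrite ?bcols_l ?bcols_r.
  rewrite in_setU1 in_setD1 => /andP[yW]; rewrite (negbTE yW) andbF orbF => /eqP ->.
  rewrite bcols_exchange_lr bcols_exchange_rl.
  have -> : W1 :\ j = W :\ i.
    by apply/setP => z; rewrite !inE; case: eqVneq => //= ->; rewrite (negbTE jW) andbF.
  have -> : (r |: high n m.+1) :\ r = high n m.+1.
    by apply/setP => z; rewrite in_setD1 in_setU1; case: eqVneq => //= ->; rewrite (negbTE rh1).
  (* Submodularity enters here: [W :\ i] and [j |: W] are the intersection and the union of [W1] and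
     [W]. *)
  apply: (@ball_le _ nu (f (W :\ i) + f (j |: W))).
    have := fsub W1 W; have -> : W1 :&: W = W :\ i.
      by apply/setP => z; rewrite !inE; case: eqVneq => //= [->|_]; rewrite ?(negbTE jW) ?andbF // -andbA andbb.
    suff -> : W1 :|: W = j |: W by [].
    by apply/setP => z; rewrite !inE; case: eqVneq => //= _; case: (z \in W); rewrite ?orbT ?andbF.
  apply: (ballM nuP).
    apply: good; last exact: subsetUr.
    by rewrite cardsU1 rh -[RHS]chm -hW (cardsD1 i W) iW addnCA addnA.
  by apply: Btop_ball; rewrite cardsU1 jW hW.
rewrite in_setU1 negb_or => /andP[/andP[_ yh1] yh].
(* The only column exchanged within the right block is [m]; it leads to the induction hypothesis for
   [W1]. *)
have -> : y = m.
  by apply/val_inj/eqP; move: yh yh1; rewrite !inE -ltnNge ltnS eqn_leq => -> ->.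
rewrite !bcols_exchange_rr addrC.
have -> : r |: high n m :\ m = r |: high n m.+1.
  by rewrite (highS (erefl (m : nat))) setU1K.
have -> : m |: (r |: high n m.+1) :\ r = high n m.
  rewrite (highS (erefl (m : nat))); congr (_ |: _); apply/setP => z; rewrite in_setD1 in_setU1.
  by case: eqVneq => //= ->; rewrite (negbTE rh1).
rewrite addrC; apply: (ballM nuP) => //.
exact: Btop_ball.
Qed.

(** If row [m] is used together with fewer than m others, [S] is enlarged to some [W] of size m.
    Exchanging column [m] against the minor of the first m rows on [W] leaves minors without row [m]
    on [S], and minors with one omitted row on [W]. *)
Lemma bounded_uptoS (m : 'I_n) : bounded_upto m -> bounded_upto m.+1.
Proof.
move=> good S T hST sT; have mn : (m <= n)%N by apply: ltnW.
have [mT|mT] := boolP (m \in T).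
  by apply: good => //; rewrite (highS (erefl (m : nat))) subUset sub1set mT.
have chm : (m + #|high n m| = n)%N by apply: card_high.
have mh : m \notin high n m.+1 by rewrite inE ltnn.
have chm1 : #|high n m| = #|high n m.+1|.+1 by rewrite (highS (erefl (m : nat))) cardsU1 mh.
have [Th|Th] := eqVneq T (high n m.+1).
  rewrite Th; apply: Btop_ball; move: hST; rewrite Th; lia.
have cT : (#|high n m.+1| < #|T|)%N by apply: proper_card; rewrite properEneq eq_sym Th.
have cS : (#|S| <= m)%N by lia.
have [W [SW hW]] : exists W : {set 'I_n}, S \subset W /\ #|W| = m.
  have [k hk] : exists k, (k + #|S|)%N = m by exists (m - #|S|)%N; rewrite subnK.
  elim: k S hk {good hST sT mT Th cT cS} => [|k IH] S hk; first by exists S.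
  have [x xS] : exists x, x \in ~: S by apply/card_gt0P; have := cardsC S; rewrite card_ord; have := ltn_ord m; lia.
  rewrite inE in xS; have [|W [xW hW]] := IH (x |: S).
    by rewrite cardsU1 xS -hk addnCA addnA.
  by exists W; split=> //; apply: subset_trans xW; apply: subsetUr.
have nzW := Btop W; rewrite hW in nzW.
suff : ball nu (f W + f S) (cominor B W (high n m) * cominor B S T).
  by rewrite -nzW.2 (ball_mull nuP) ?nzW.1.
rewrite mulrC addrC.
apply: (exchange_ball nuP (p := rshift n m)); rewrite ?card_bcols ?hW //.
- by rewrite bcols_r inE.
- by rewrite bcols_r.
move=> x; rewrite in_setD; case: (split_ordP x) => y ->; rewrite ?bcols_l ?bcols_r.
  by move=> /andP[yW yS]; rewrite (subsetP SW) in yW.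
move=> /andP[yh yT]; rewrite !bcols_exchange_rr.
have ym : (y < m)%N by move: yh; rewrite inE -ltnNge.
have -> : y |: high n m :\ m = y |: high n m.+1.
  by rewrite (highS (erefl (m : nat))) setU1K.
apply: (ballM nuP); last exact: omit_row_bound.
apply: good.
  by rewrite cardsU1 !inE (negbTE mT) andbF -[RHS]hST (cardsD1 y T) yT.
rewrite (highS (erefl (m : nat))) setUS //; apply/subsetP => z zh.
rewrite in_setD1 (subsetP sT) // andbT; apply: contraNneq yh => <-.
by move: zh; rewrite !inE => /ltnW.
Qed.

Lemma bounded_all : bounded_upto n.
Proof.
suff H k : (k <= n)%N -> bounded_upto k by apply: H.
elim: k => [_ S T hST sT|k IH kn]; last exact: (@bounded_uptoS (Ordinal kn) (IH (ltnW kn))).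
have TT : T = high n 0 by apply/eqP; rewrite eqEsubset sT andbT; apply/subsetP => i; rewrite inE.
rewrite TT; apply: Btop_ball; have := card_high (leq0n n); move: hST; rewrite TT; lia.
Qed.

End Bound.

(** The value [f S] is attained on the first rows and, by [bounded_all], exceeded on no others, so
    it is the maximum that [Gr_slice_of_bound] asks for. *)
Theorem Fl_Gr_slice n (F : {set 'I_n.+1} -> RR) :
  nu_set 0 nu (@Fl K n.+1) F -> SUBMOD F -> Gr_slice nu F.
Proof.
move=> /(flag_basis nuP)[c [B [c0 cF Btri Btop]]] sF.
pose f S := F S - F set0.
have sf : SUBMOD f by move=> S T; have := sF S T; rewrite /f; lra.
apply: (@Gr_slice_of_bound _ _ _ nuP n c B f F) => // [S h|S]; last by rewrite cF /f; lra.
split => [H|fh T hST].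
  have [nz e] := Btop S; rewrite /f -e -ballE //; apply: H.
  by apply: card_high; rewrite -[X in (_ <= X)%N]card_ord max_card.
apply: ball_le fh _; apply: (bounded_all sf Btri Btop hST).
by apply/subsetP => i; rewrite inE leqNgt ltn_ord.
Qed.

End FlagSlice.

(** * Closures *)

Lemma low_part_bcols n (S T : {set 'I_n}) (h : #|bcols S T| == n) :
  low_part (exist _ (bcols S T) h : nsubsets n) = S.
Proof. by apply/setP => i; rewrite inE bcols_l. Qed.

Lemma eclosure_sub (N : finType) (A B : (N -> RR) -> Prop) :
  (forall p, A p -> B p) -> forall p, eclosure A p -> eclosure B p.
Proof. by move=> AB p h e /h[q [/AB Bq pq]]; exists q. Qed.

Section Conclusion.
Variables (K : numFieldType) (cj : {rmorphism K -> K}) (nu : K -> RR).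
Hypothesis nuP : convex_valuation cj nu.

Lemma phi_image_Gr n (F : {set 'I_n} -> RR) :
  phi_image (nu_set 0 nu (@Gr K n)) F <-> Gr_slice nu F.
Proof.
split=> [[p [[x [[M xM] [x0 px]]] [_ pF]]]|[M hM]].
  exists M => S T hST; have hC : #|bcols S T| == n by rewrite card_bcols hST.
  pose C : nsubsets n := exist _ (bcols S T) hC.
  by rewrite -(xM C) -px pF low_part_bcols; split=> //; apply/eqP/x0.
have low_pluecker (C : nsubsets n) : pluecker M (val C) != 0 /\
    nu (pluecker M (val C)) = F (low_part C).
  by rewrite [val C]bcols_surj; apply: hM; rewrite -card_bcols -bcols_surj; apply/eqP/(valP C).
exists (F \o @low_part n); split; last by split=> // C D /= ->.
exists (fun C => pluecker M (val C)); split; first by exists M.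
by split=> C; have [nz e] := low_pluecker C; [apply/eqP | rewrite e].
Qed.

(** The approximating points need not lie in the slice themselves, hence the three-term relation
    with error. *)
Lemma phi_image_trop_Gr n (F : {set 'I_n} -> RR) :
  phi_image (trop 0 nu (@Gr K n)) F -> trop 0 nu (@Fl K n) F /\ SUBMOD F.
Proof.
move=> [p [tp [_ pF]]].
have near e : 0 < e -> exists M : 'M[K]_(n, n + n), forall S T : {set 'I_n},
    (#|S| + #|T| = n)%N ->
    pluecker M (bcols S T) != 0 /\ `|F S - nu (pluecker M (bcols S T))| < e.
  move=> /tp[q [[x [[M xM] [x0 qx]]] pq]]; exists M => S T hST.
  have hC : #|bcols S T| == n by rewrite card_bcols hST.
  pose C : nsubsets n := exist _ (bcols S T) hC.
  have := pq C; rewrite qx pF low_part_bcols (xM C); split=> //.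
  by rewrite -(xM C); apply/eqP/x0.
split=> [e e0|].
  have [M hM] := near e e0; have hS (S : {set 'I_n}) : (#|S| + #|high n #|S| | = n)%N.
    by apply: card_high; rewrite -[X in (_ <= X)%N]card_ord max_card.
  eexists; split; first by apply: (pluecker_Fl nuP (M := M)) => S T /hM[].
  by move=> S; have [] := hM _ _ (hS S).
apply: submod_of_local => W i j iW jW ij; apply/ler_addgt0Pr => e e0.
have e4 : 0 < e / 4 by lra.
have [M hM] := near _ e4.
have := @near_slice_local _ _ _ nuP n M F (e / 4) _ W i j iW jW ij.
have -> : e / 4 *+ 4 = e by lra.
by apply=> S T /hM[? h]; split=> //; apply: ltW.
Qed.

(* Multiplying the level [k] of the flag by [x ^- (k ^ 2)] adds a small strictly
   concave function of the cardinality, which restores submodularity. *)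
Lemma trop_Fl_submod n (F : {set 'I_n} -> RR) :
  trop 0 nu (@Fl K n) F -> SUBMOD F ->
  eclosure (set_inter (nu_set 0 nu (@Fl K n)) (@SUBMOD n)) F.
Proof.
(* The square of any cardinality is below [b], so the correction stays within [e / 2]. *)
move=> tF sF e e0; pose b : RR := (n ^ 2)%:R + 1.
have b0 : 0 < b by rewrite /b ltr_wpDl // ler0n.
have [x [x0 v0 ve]] := cv_dense nuP (divr_gt0 (divr_gt0 e0 (ltr0Sn _ 1)) b0).
have ve' : nu x * b < e / 2 by rewrite -ltr_pdivlMr.
(* The bound [e / 2] controls the distance; [nu x / 2] keeps the total error [4 * d] within the gap
   [2 * nu x] given by the second difference of the squares. *)
pose d := Num.min (e / 2) (nu x / 2).
have d0 : 0 < d by rewrite lt_min; apply/andP; split; lra.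
have [de dx] : d <= e / 2 /\ d <= nu x / 2 by rewrite /d !ge_min !lexx orbT.
have [F1 [[q [[M [c [rkM [leM [c0 qE]]]]] [q0 F1E]]] near]] := tF d d0.
pose G (S : {set 'I_n}) := F1 S - nu x *+ (#|S| ^ 2).
exists G; split; last first.
  move=> S; have := near S; rewrite /G !ltr_norml opprB addrA => /andP[h1 h2].
  have : nu x *+ #|S| ^ 2 <= nu x * b.
    rewrite -mulr_natr; apply: ler_wpM2l; first exact: ltW.
    apply: ler_wpDr => //; rewrite ler_nat leq_exp2r //.
    by rewrite -[X in (_ <= X)%N]card_ord max_card.
  have : 0 <= nu x *+ #|S| ^ 2 by rewrite mulrn_wge0 // ltW.
  by move=> h3 h4; apply/andP; split; lra.
split; last first.
  apply: submod_of_local => W i j iW jW ij; rewrite /G !cardsU1 !inE negb_or iW jW ij /=.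
  have nF (S : {set 'I_n}) : F S - d <= F1 S <= F S + d.
    by have := near S; rewrite ltr_norml => /andP[h1 h2]; apply/andP; split; lra.
  have /andP[a1 a2] := nF W; have /andP[b1 b2] := nF (i |: (j |: W)).
  have /andP[c1 c2] := nF (i |: W); have /andP[d1 d2] := nF (j |: W).
  have := sF (i |: W) (j |: W).
  have -> : (i |: W) :&: (j |: W) = W.
    apply/setP => z; rewrite !inE; case: (z \in W); rewrite ?orbT //= !orbF.
    by apply/negbTE/negP => /andP[/eqP -> /eqP]; apply/eqP.
  have -> : (i |: W) :|: (j |: W) = i |: (j |: W).
    by apply/setP => z; rewrite !inE; case: (z \in W); rewrite ?orbT ?orbF.
  rewrite -!(mulr_natr (nu x)) !natrX !natrD; set w := #|W|%:R; lra.
exists (fun S => q S * x ^- (#|S| ^ 2)); split.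
  exists M, (fun k => c k * x ^- (k ^ 2)); split=> //; split=> //; split.
    by move=> k; rewrite mulf_neq0 ?invr_eq0 ?expf_neq0.
  by move=> k S hS; rewrite (qE k S hS) hS mulrAC.
have q0' S : q S != 0 by apply/eqP.
split=> S; first by apply/eqP; rewrite mulf_neq0 ?invr_eq0 ?expf_neq0.
by rewrite (cv_mul nuP) ?invr_eq0 ?expf_neq0 // (nuV nuP) ?expf_neq0 // (nuX nuP) // -F1E.
Qed.

(** The positive definite side and the slice agree up to a factor 2, removed by the two hypotheses.
    The closures are all compared through the closure of the slice itself. *)
Theorem thm41_of_scaling n :
  (forall F : {set 'I_n.+1} -> RR, Gr_slice nu F -> Gr_slice nu (fun S => F S *+ 2)) ->
  (forall F : {set 'I_n.+1} -> RR, Gr_slice nu F -> Gr_slice nu (fun S => F S / 2)) ->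
  thm41_conclusion cj nu n.+1.
Proof.
move=> dbl half.
have ext (F G : {set 'I_n.+1} -> RR) : F =1 G -> forall A, nu_set 0 nu A F -> nu_set 0 nu A G.
  by move=> FG A [x [Ax [x0 Fx]]]; exists x; split=> //; split=> // i; rewrite -FG.
have extG (F G : {set 'I_n.+1} -> RR) : F =1 G -> Gr_slice nu F -> Gr_slice nu G.
  by move=> FG [M hM]; exists M => S T hST; rewrite -FG; apply: hM.
have PG F : nu_set 0 nu (cone (@PMplus K cj n.+1)) F <-> Gr_slice nu F.
  split=> [/(PM_Gr_slice nuP)/dbl|/half/(Gr_slice_PM nuP)].
    by apply: extG => S; lra.
  by apply: ext => S; lra.
have GH F : Gr_slice nu F <-> set_inter (nu_set 0 nu (@Fl K n.+1)) (@SUBMOD n.+1) F.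
  split=> [GF|[FF sF]]; last exact: (Fl_Gr_slice nuP).
  split; last exact: (Gr_slice_submod nuP).
  case: GF => M hM; apply: ext (pluecker_Fl nuP (M := M) _) => [S|S T /hM[]//].
  apply: (hM _ _ _).2; apply: card_high.
  by rewrite -[X in (_ <= X)%N]card_ord max_card.
have GtG F : eclosure (@Gr_slice K nu n.+1) F -> phi_image (trop 0 nu (@Gr K n.+1)) F.
  move=> cF; exists (F \o @low_part _); split; last by split=> // C D /= ->.
  move=> e /cF[F1 [/phi_image_Gr[p [gp [_ pF]]] near]].
  by exists p; split=> // C; rewrite pF; apply: near.
have tGH F : phi_image (trop 0 nu (@Gr K n.+1)) F <->
    set_inter (trop 0 nu (@Fl K n.+1)) (@SUBMOD n.+1) F.
  split=> [/phi_image_trop_Gr//|[tF sF]]; apply: GtG.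
  by apply: eclosure_sub (trop_Fl_submod tF sF) => G /GH.
split; [|split; [|split]] => F.
- by rewrite phi_image_Gr.
- by rewrite phi_image_Gr.
- split=> [tP|/tGH[tF sF]]; first by apply: GtG; apply: eclosure_sub tP => G /PG.
  by apply: eclosure_sub (trop_Fl_submod tF sF) => G /GH/PG.
- exact: tGH.
Qed.

End Conclusion.

(** * Quantifier elimination with rational constants *)

Section RationalConstants.
Variable F : rcfType.
Import qe_rcf.

Definition israt (c : F) : Prop := exists q : rat, c = ratr q.

Fixpoint All (T : Type) (P : T -> Prop) (s : seq T) : Prop :=
  if s is x :: s' then P x /\ All P s' else Logic.True.

Lemma All_map (T U : Type) (g : T -> U) (P : U -> Prop) s :
  All P (map g s) <-> All (fun x => P (g x)) s.
Proof. by elim: s => //= x s ->. Qed.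

Lemma All_cat (T : Type) (P : T -> Prop) s1 s2 :
  All P (s1 ++ s2) <-> All P s1 /\ All P s2.
Proof. by elim: s1 => [|x s1 IH] /=; [tauto | rewrite IH; tauto]. Qed.

Lemma All_imp (T : Type) (P Q : T -> Prop) s : (forall x, P x -> Q x) -> All P s -> All Q s.
Proof. by move=> PQ; elim: s => //= x s IH [/PQ ? /IH]. Qed.

Lemma All_nth (T : Type) (P : T -> Prop) x0 s i : P x0 -> All P s -> P (nth x0 s i).
Proof. by move=> P0; elim: s i => [|x s IH] [|i] //= [] // _ /IH. Qed.

(* [qe_rcf] allows arbitrary constants of [F] in its output.  That it only adds
   rational ones can be seen from its code alone, hence the lemmas below, one for
   each of its functions. *)
Fixpoint ratT (t : term F) : Prop :=
  match t with
  | Var _ => Logic.True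
  | Const c => israt c
  | NatConst _ => Logic.True
  | Add u v => ratT u /\ ratT v
  | Opp u => ratT u
  | NatMul u _ => ratT u
  | Mul u v => ratT u /\ ratT v
  | Exp u _ => ratT u
  end.

Fixpoint ratF (f : formula F) : Prop :=
  match f with
  | Bool _ => Logic.True
  | Equal u v => ratT u /\ ratT v
  | Lt u v => ratT u /\ ratT v
  | Le u v => ratT u /\ ratT v
  | And f g => ratF f /\ ratF g
  | Or f g => ratF f /\ ratF g
  | Implies f g => ratF f /\ ratF g
  | Not f => ratF f
  end.

Notation ratP := (All ratT).
Notation ratPs := (All ratP).

Lemma israt_int (z : int) : israt z%:~R.
Proof. by exists z%:~R; rewrite ratr_int. Qed.
Lemma israt0 : israt 0. Proof. exact: (israt_int 0). Qed.
Lemma israt1 : israt 1. Proof. exact: (israt_int 1). Qed.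
Lemma isratN1 : israt (-1). Proof. exact: (israt_int (-1)). Qed.
Hint Resolve israt0 israt1 isratN1 : core.

Lemma ratP0 : ratP [:: Const 0]. Proof. by split=> //; apply: israt0. Qed.
Hint Resolve ratP0 : core.

Lemma rat_If c t e : ratF c -> ratF t -> ratF e -> ratF (If c t e).
Proof. by []. Qed.

Lemma rat_Size p k : ratP p -> (forall n, ratF (k n)) -> ratF (Size p k).
Proof.
by elim: p k => [|c q IH] k //= [hc hq] hk; apply: IH => // -[|m] //=.
Qed.

Lemma rat_Isnull p k : ratP p -> (forall n, ratF (k n)) -> ratF (Isnull p k).
Proof. by move=> hp hk; apply: rat_Size. Qed.

Lemma rat_LtSize p q k : ratP p -> ratP q -> (forall n, ratF (k n)) -> ratF (LtSize p q k).
Proof. by move=> hp hq hk; apply: rat_Size => // n; apply: rat_Size. Qed.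

Lemma rat_LeadCoef p k : ratP p -> (forall t, ratT t -> ratF (k t)) -> ratF (LeadCoef p k).
Proof.
elim: p k => [|c q IH] k /= hp hk; first by apply: hk; apply: israt0.
by case: hp => hc hq; apply: IH => // l hl; apply: rat_If; [|apply: hk|apply: hk].
Qed.

Lemma rat_AmulXn a n : ratT a -> ratP (AmulXn a n).
Proof. by move=> ha; elim: n => //= n IH. Qed.

Lemma rat_AddPoly p q : ratP p -> ratP q -> ratP (AddPoly p q).
Proof. by elim: p q => [|a p IH] [|b q] //= [ha hp] [hb hq]; split=> //; apply: IH. Qed.

Lemma rat_ScalPoly c p : ratT c -> ratP p -> ratP (ScalPoly c p).
Proof. by move=> hc hp; apply/All_map; apply: All_imp hp. Qed.

Lemma rat_MulPoly p q : ratP p -> ratP q -> ratP (MulPoly p q).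
Proof.
elim: p => [|a p IH] //= [ha hp] hq; apply: rat_AddPoly; first exact: rat_ScalPoly.
by split=> //; apply: IH.
Qed.

Lemma rat_ExpPoly p n : ratP p -> ratP (ExpPoly p n).
Proof.
move=> hp; rewrite /ExpPoly; case: n => //= n; elim: n => //= n IH.
exact: rat_MulPoly.
Qed.

Lemma rat_OppPoly p : ratP p -> ratP (OppPoly p).
Proof. by apply: rat_ScalPoly; apply: isratN1. Qed.

Lemma rat_Deriv p : ratP p -> ratP (Deriv p).
Proof. by elim: p => //= a p IH [ha hp]; apply: rat_AddPoly => //; split=> //; apply: IH. Qed.

Hint Resolve rat_AmulXn rat_AddPoly rat_ScalPoly rat_MulPoly rat_ExpPoly rat_OppPoly rat_Deriv : core.

Lemma rat_Rediv_rec_loop q sq cq c qq r n k : ratP q -> ratT cq -> ratP qq -> ratP r ->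
  (forall d, ratP d.1.2 -> ratP d.2 -> ratF (k d)) ->
  ratF (Rediv_rec_loop q sq cq c qq r n k).
Proof.
move=> hq hcq; have hcq1 : ratP [:: cq] by [].
have step l m t : ratT l -> ratP t ->
    ratP (AddPoly (MulPoly t [:: cq]) (AmulXn l m)) /\
    ratP (AddPoly (MulPoly t [:: cq]) (OppPoly (MulPoly (AmulXn l m) q))).
  move=> hl ht; have hm := rat_AmulXn m hl.
  by split; apply: rat_AddPoly; auto.
have step2 l m t u : ratT l -> ratP t -> ratP u ->
    ratP (AddPoly (MulPoly u [:: cq]) (AmulXn l m)) /\
    ratP (AddPoly (MulPoly t [:: cq]) (OppPoly (MulPoly (AmulXn l m) q))).
  by move=> hl ht hu; split; [case: (step l m u hl hu) | case: (step l m t hl ht)].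
elim: n c qq r => [|n IH] c qq r hqq hr hk /=;
  apply: rat_Size => // sr; case: ifP => _; try exact: hk;
  apply: rat_LeadCoef => // l hl; case: (step2 l (sr - sq)%N r qq hl hr hqq) => h1 h2.
  exact: hk.
exact: IH.
Qed.

Lemma rat_Rediv p q k : ratP p -> ratP q ->
  (forall d, ratP d.1.2 -> ratP d.2 -> ratF (k d)) -> ratF (Rediv p q k).
Proof.
move=> hp hq hk; apply: rat_Isnull => // -[]; first by apply: hk.
by apply: rat_Size => // sq; apply: rat_Size => // sp; apply: rat_LeadCoef => // l hl;
  apply: rat_Rediv_rec_loop.
Qed.

Lemma rat_Rmod p q k : ratP p -> ratP q -> (forall r, ratP r -> ratF (k r)) -> ratF (Rmod p q k).
Proof. by move=> hp hq hk; apply: rat_Rediv => // d _ h; apply: hk. Qed.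

Lemma rat_Rscal p q k : ratP p -> ratP q -> (forall n, ratF (k n)) -> ratF (Rscal p q k).
Proof. by move=> hp hq hk; apply: rat_Rediv. Qed.

Lemma rat_Rgcd_loop n p q k : ratP p -> ratP q -> (forall r, ratP r -> ratF (k r)) ->
  ratF (Rgcd_loop n p q k).
Proof.
move=> hp hq hk; elim: n p q hp hq => [|n IH] p q hp hq /=;
  apply: rat_Rmod => // r hr; apply: rat_Isnull => // -[]; by [apply: hk | apply: IH].
Qed.

Lemma rat_Rgcd p q k : ratP p -> ratP q -> (forall r, ratP r -> ratF (k r)) -> ratF (Rgcd p q k).
Proof.
move=> hp hq hk; apply: rat_LtSize => // b; case: b; apply: rat_Isnull => // -[];
  by [apply: hk | apply: rat_Size => // n; apply: rat_Rgcd_loop].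
Qed.

Lemma rat_BigRgcd ps k : ratPs ps -> (forall r, ratP r -> ratF (k r)) -> ratF (BigRgcd ps k).
Proof.
elim: ps k => [|p ps IH] k /= h hk; first exact: hk.
by case: h => hp hps; apply: IH => // r hr; apply: rat_Rgcd.
Qed.

Lemma rat_Changes s k : ratP s -> (forall n, ratF (k n)) -> ratF (Changes s k).
Proof.
elim: s k => [|a s IH] k //= [ha hs] hk; apply: IH => // v; apply: rat_If => //=.
by do 2!split=> //; case: s hs => //= b s [].
Qed.

Lemma rat_SeqPInfty ps k : ratPs ps -> (forall s, ratP s -> ratF (k s)) -> ratF (SeqPInfty ps k).
Proof.
elim: ps k => [|p ps IH] k /= h hk; first exact: hk.
by case: h => hp hps; apply: rat_LeadCoef => // l hl; apply: IH => // s hs; apply: hk.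
Qed.

Lemma rat_SeqMInfty ps k : ratPs ps -> (forall s, ratP s -> ratF (k s)) -> ratF (SeqMInfty ps k).
Proof.
elim: ps k => [|p ps IH] k /= h hk; first exact: hk.
case: h => hp hps; apply: rat_LeadCoef => // l hl; apply: rat_Size => // n.
by apply: IH => // s hs; apply: hk => /=; do 2!split=> //; apply: isratN1.
Qed.

Lemma rat_ChangesPoly ps k : ratPs ps -> (forall n, ratF (k n)) -> ratF (ChangesPoly ps k).
Proof.
move=> h hk; apply: rat_SeqMInfty => // s hs; apply: rat_SeqPInfty => // s' hs'.
by apply: rat_Changes => // v; apply: rat_Changes.
Qed.

Lemma rat_NextMod p q k : ratP p -> ratP q -> (forall r, ratP r -> ratF (k r)) ->
  ratF (NextMod p q k).
Proof.
move=> hp hq hk; apply: rat_LeadCoef => // l hl; apply: rat_Rscal => // s.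
by apply: rat_Rmod => // r hr; apply: hk; apply: rat_ScalPoly.
Qed.

Lemma rat_ModsAux p q n k : ratP p -> ratP q -> (forall r, ratPs r -> ratF (k r)) ->
  ratF (ModsAux p q n k).
Proof.
elim: n p q k => [|n IH] p q k hp hq hk /=; first exact: hk.
apply: rat_Isnull => // -[]; first exact: hk.
by apply: rat_NextMod => // r hr; apply: IH => // ps hps; apply: hk.
Qed.

Lemma rat_Mods p q k : ratP p -> ratP q -> (forall r, ratPs r -> ratF (k r)) ->
  ratF (Mods p q k).
Proof.
by move=> hp hq hk; apply: rat_Size => // m; apply: rat_Size => // n; apply: rat_ModsAux.
Qed.

Lemma rat_PolyComb sq sc : ratPs sq -> ratP (PolyComb sq sc).
Proof.
move=> h; rewrite /PolyComb; elim: (iota _ _) => //= i s IH.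
by apply: rat_MulPoly => //; apply: rat_ExpPoly; apply: All_nth.
Qed.

Lemma rat_Pcq sq i : ratPs sq -> ratP (Pcq sq i).
Proof.
move=> h; rewrite /Pcq; apply: All_nth => //; apply/All_map.
by elim: (qe_rcf_th.sg_tab _) => //= a s IH; split=> //; apply: rat_PolyComb.
Qed.

Lemma rat_TaqsR p sq i k : ratP p -> ratPs sq -> (forall t, ratT t -> ratF (k t)) ->
  ratF (TaqsR p sq i k).
Proof.
move=> hp hsq hk; apply: rat_Mods => //.
  by apply: rat_MulPoly; [exact: rat_Deriv | exact: rat_Pcq].
by move=> ps hps; apply: rat_ChangesPoly => // n; apply: hk; apply: israt_int.
Qed.

Lemma rat_BoundingPoly sq : ratPs sq -> ratP (BoundingPoly sq).
Proof.
move=> h; apply: rat_Deriv; elim: sq h => //= p sq IH [hp /IH h].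
exact: rat_MulPoly.
Qed.

(** These are entries of the inverse of an integer matrix, and inversion commutes with the embedding
    of the rationals. *)
Lemma rat_Coefs n i : ratT (Coefs F n i).
Proof.
suff h : israt (qe_rcf_th.coefs F n i) by rewrite -(eval_Coefs [::]) in h.
rewrite /qe_rcf_th.coefs.
have [lt|ge] := ltnP i (3 ^ n); last first.
  by rewrite nth_default // size_map size_enum_ord.
rewrite (nth_map (Ordinal lt)) ?size_enum_ord // castmxE.
set a := cast_ord _ _; set b := cast_ord _ _.
have -> : map_mx (intr : int -> F) (qe_rcf_th.ctmat n) =
    map_mx (ratr : rat -> F) (map_mx (intr : int -> rat) (qe_rcf_th.ctmat n)).
  by apply/matrixP => x y; rewrite !mxE ratr_int.
by rewrite -map_invmx mxE; eexists.
Qed.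

Lemma rat_CcountWeak p sq k : ratP p -> ratPs sq -> (forall t, ratT t -> ratF (k t)) ->
  ratF (CcountWeak p sq k).
Proof.
move=> hp hsq hk; rewrite /CcountWeak; have : ratT 0%qfT by [].
move: 0%qfT; elim: (3 ^ _)%N => [|n IH] t ht /=; first exact: hk.
apply: rat_TaqsR => // x hx; apply: IH => /=; do 2!split=> //.
exact: rat_Coefs.
Qed.

Lemma rat_reduce_and (T : Type) (s : seq T) (g : T -> formula F) :
  All (fun x => ratF (g x)) s ->
  ratF (reducebig qe_rcf.True s (fun q => BigBody q And true (g q))).
Proof. by elim: s => //= x s IH [h /IH]. Qed.

Lemma rat_CcountGt0 sp sq : ratPs sp -> ratPs sq -> ratF (CcountGt0 sp sq).
Proof.
move=> hp hq; apply: rat_BigRgcd => // p hp'; apply: rat_Isnull => // -[] /=; last first.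
  by apply: rat_CcountWeak.
apply: rat_CcountWeak => //; first exact: rat_BoundingPoly.
move=> t ht /=; split; last split.
- by apply: rat_reduce_and; apply: All_imp hq => q hq; apply: rat_LeadCoef.
- apply: rat_reduce_and; apply: All_imp hq => q hq; apply: rat_Size => // n.
  by apply: rat_LeadCoef.
- by [].
Qed.

Lemma rat_abstrX i t : ratT t -> ratP (abstrX i t).
Proof.
elim: t => //=.
- by move=> n; case: eqP.
- by move=> u IHu v IHv [/IHu hu /IHv hv]; apply: rat_AddPoly.
- by move=> u IHu /IHu; apply: rat_OppPoly.
- by move=> u IHu n /IHu h; apply: rat_ScalPoly.
- by move=> u IHu v IHv [/IHu hu /IHv hv]; apply: rat_MulPoly.
- by move=> u IHu n /IHu h; apply: rat_ExpPoly.
Qed.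

End RationalConstants.

(** * Sets definable over the rational numbers *)

Section Definable.
Variable F : rcfType.
Notation tm := (qe_rcf.term F).
Notation ev := (@qe_rcf.eval F).

(* Semialgebraic sets over the rational numbers, in disjunctive normal form. *)
Definition holds_clause (e : seq F) (c : seq tm * seq tm) : bool :=
  all (fun t => ev e t == 0) c.1 && all (fun t => 0 < ev e t) c.2.

Definition definable (D : seq F -> Prop) : Prop :=
  exists L : seq (seq tm * seq tm),
    All (fun c => All (@ratT F) c.1 /\ All (@ratT F) c.2) L /\
    forall e, D e <-> has (holds_clause e) L.

Lemma definable_ext D D' : (forall e, D e <-> D' e) -> definable D -> definable D'.
Proof. by move=> DD [L [hL LE]]; exists L; split=> // e; rewrite -DD. Qed.

Lemma definable_true : definable (fun=> True).
Proof. by exists [:: ([::], [::])]. Qed.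

Lemma definable_false : definable (fun=> False).
Proof. by exists [::]. Qed.

Lemma definable_eq t : ratT t -> definable (fun e => ev e t == 0).
Proof.
by move=> ht; exists [:: ([:: t], [::])]; split=> //= e; rewrite /holds_clause /= !andbT orbF.
Qed.

Lemma definable_gt t : ratT t -> definable (fun e => 0 < ev e t).
Proof.
by move=> ht; exists [:: ([::], [:: t])]; split=> //= e; rewrite /holds_clause /= !andbT orbF.
Qed.

Lemma definable_or D D' : definable D -> definable D' -> definable (fun e => D e \/ D' e).
Proof.
move=> [L [hL LE]] [L' [hL' LE']]; exists (L ++ L'); split; first exact/All_cat.
by move=> e; rewrite has_cat LE LE'; split=> /orP.
Qed.

Lemma definable_and D D' : definable D -> definable D' -> definable (fun e => D e /\ D' e).
Proof.
move=> [L [hL LE]] [L' [hL' LE']].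
exists [seq (c.1 ++ c'.1, c.2 ++ c'.2) | c <- L, c' <- L']; split.
  elim: L hL {LE} => //= c L IH [[h1 h2] /IH h]; apply/All_cat; split=> //.
  apply/All_map; apply: All_imp hL' => c' [h1' h2'] /=.
  by split; apply/All_cat.
move=> e; rewrite LE LE' (rwP andP).
suff -> : has (holds_clause e) [seq (c.1 ++ c'.1, c.2 ++ c'.2) | c <- L, c' <- L'] =
    has (holds_clause e) L && has (holds_clause e) L' by [].
elim: L {LE hL} => //= c L IH; rewrite has_cat IH andb_orl; congr (_ || _).
elim: {LE' hL' IH} L' => [|c' L' IH] /=; first by rewrite andbF.
by rewrite IH andb_orr; congr (_ || _); rewrite /holds_clause /= !all_cat andbACA.
Qed.

Lemma definable_not D : definable D -> definable (fun e => ~ D e).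
Proof.
move=> [L [hL LE]]; apply: (@definable_ext (fun e => ~~ has (holds_clause e) L)).
  by move=> e; rewrite LE; split=> /negP.
elim: L hL {LE} => [|c L IH] /=.
  by move=> _; apply: definable_ext definable_true.
move=> [[h1 h2] /IH hL].
suff hc : definable (fun e => ~~ holds_clause e c).
  by apply: definable_ext (definable_and hc hL) => e; rewrite negb_or; split=> /andP.
case: c h1 h2 => sp sq /= h1 h2.
have d1 : definable (fun e => ~~ all (fun t => ev e t == 0) sp).
  elim: sp h1 => [|t sp IHsp] /=; first by move=> _; apply: definable_ext definable_false => e; split.
  move=> [ht /IHsp h].
  apply: definable_ext (definable_or (definable_or (definable_gt ht)
    (definable_gt (t := qe_rcf.Opp t) ht)) h) => e /=.
  rewrite negb_and -(rwP orP) neq_lt oppr_gt0 -(rwP orP); tauto.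
have d2 : definable (fun e => ~~ all (fun t => 0 < ev e t) sq).
  elim: sq h2 => [|t sq IHsq] /=; first by move=> _; apply: definable_ext definable_false => e; split.
  move=> [ht /IHsq h].
  apply: definable_ext (definable_or (definable_or (definable_eq ht)
    (definable_gt (t := qe_rcf.Opp t) ht)) h) => e /=.
  rewrite negb_and -(rwP orP) -leNgt le_eqVlt oppr_gt0 -(rwP orP); tauto.
apply: definable_ext (definable_or d1 d2) => e.
by rewrite negb_and; split=> /orP.
Qed.

Lemma definable_qf f : ratF f -> definable (fun e => qe_rcf.qf_eval e f).
Proof.
elim: f => /=.
- move=> [] _; first exact: definable_ext definable_true.
  by apply: definable_ext definable_false.
- move=> t u [ht hu].
  apply: definable_ext (definable_eq (t := qe_rcf.Add t (qe_rcf.Opp u)) (conj ht hu)) => e /=.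
  by rewrite subr_eq0.
- move=> t u [ht hu].
  apply: definable_ext (definable_gt (t := qe_rcf.Add u (qe_rcf.Opp t)) (conj hu ht)) => e /=.
  by rewrite subr_gt0.
- move=> t u [ht hu].
  apply: definable_ext (definable_not (definable_gt (t := qe_rcf.Add t (qe_rcf.Opp u)) (conj ht hu))) => e /=.
  by rewrite subr_gt0 leNgt; split=> /negP.
- move=> f IHf g IHg [/IHf hf /IHg hg]; apply: definable_ext (definable_and hf hg) => e.
  by split=> /andP.
- move=> f IHf g IHg [/IHf hf /IHg hg]; apply: definable_ext (definable_or hf hg) => e.
  by split=> /orP.
- move=> f IHf g IHg [/IHf hf /IHg hg].
  apply: definable_ext (definable_or (definable_not hf) hg) => e.
  by rewrite implybE; split=> [[/negP->//|->]|/orP[/negP|]]; rewrite ?orbT; auto.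
- move=> f IHf /IHf hf; apply: definable_ext (definable_not hf) => e.
  by split=> /negP.
Qed.

(** The quantifier distributes over the clauses, and each clause is eliminated by the root-counting
    formula [CcountGt0], which keeps constants rational. *)
Lemma definable_exists D i : definable D ->
  definable (fun e => exists x, D (set_nth 0 e i x)).
Proof.
move=> [L [hL LE]].
apply: (@definable_ext (fun e => exists x, has (holds_clause (set_nth 0 e i x)) L)).
  by move=> e; split=> -[x]; exists x; apply/LE.
elim: L hL {LE} => [|[sp sq] L IH] /=.
  by move=> _; apply: definable_ext definable_false => e; split=> [|[]].
move=> [[h1 h2] /IH hL].
pose f := qe_rcf.CcountGt0 (map (qe_rcf.abstrX i) sp) (map (qe_rcf.abstrX i) sq).
have hf : ratF f.
  by apply: rat_CcountGt0; apply/All_map; [apply: All_imp h1|apply: All_imp h2] => t;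
     apply: rat_abstrX.
apply: definable_ext (definable_or (definable_qf hf) hL) => e.
have -> : qe_rcf.qf_eval e f <-> exists x, holds_clause (set_nth 0 e i x) (sp, sq).
  rewrite /f qe_rcf.eval_CcountGt0 -(rwP (qe_rcf_th.ccount_gt0P _ _)).
  suff E x : (\big[andb/true]_(p <- map (qe_rcf.eval_poly e) (map (qe_rcf.abstrX i) sp)) (p.[x] == 0)
    && \big[andb/true]_(q <- map (qe_rcf.eval_poly e) (map (qe_rcf.abstrX i) sq)) (0 < q.[x])) =
    holds_clause (set_nth 0 e i x) (sp, sq).
    by split=> -[x]; [rewrite E|rewrite -E]; exists x.
  rewrite !big_map !big_all /holds_clause /=; congr (_ && _); apply: eq_all => t;
    by rewrite qe_rcf.abstrXP.
split=> [[[x h]|[x xL]]|[x /orP[h|h]]].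
- by exists x; rewrite h.
- by exists x; rewrite xL orbT.
- by left; exists x.
- by right; exists x.
Qed.

(** The number [a] of parameters is fixed because the quantified variables are addressed by
    position, starting at [a]. *)
Lemma definable_exists_seq D a m : definable D -> exists D', definable D' /\
  forall e, size e = a -> D' e <-> exists x, size x = m /\ D (e ++ x).
Proof.
move=> hD; elim: m a => [|m IH] a.
  exists D; split=> // e _; split=> [De|[x [/size0nil -> ]]]; last by rewrite cats0.
  by exists [::]; rewrite cats0.
have [D1 [/(definable_exists a) hD1 D1E]] := IH a.+1.
eexists; split; first exact: hD1.
move=> e sz; have rE y : set_nth 0 e a y = rcons e y.
  by elim: e a sz {IH D1 hD1 D1E} => [|z e IHe] a <- //=; rewrite IHe.
split=> [[y]|[[|y x] [sx Dx]]] //; last case: sx => sx.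
  rewrite rE D1E ?size_rcons ?sz // => -[x [<- Dx]].
  by exists (y :: x); rewrite -cat_rcons.
by exists y; rewrite rE D1E ?size_rcons ?sz //; exists x; rewrite cat_rcons.
Qed.

Definition same_signs (e e' : seq F) : Prop := forall t, ratT t ->
  (ev e t == 0) = (ev e' t == 0) /\ (0 < ev e t) = (0 < ev e' t).

Lemma definable_transfer D e e' : definable D -> same_signs e e' -> D e -> D e'.
Proof.
move=> [L [hL LE]] ee'; rewrite !LE; congr is_true.
elim: L hL {LE} => //= -[sp sq] L IH [[/= h1 h2] /IH ->]; congr (_ || _).
rewrite /holds_clause /=; congr (_ && _).
  by elim: sp h1 => //= t sp IHsp [/ee'[-> _] /IHsp ->].
by elim: sq h2 => //= t sq IHsq [/ee'[_ ->] /IHsq ->].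
Qed.

End Definable.

(** * Rescaling valuations *)

Section Scaling.
Variables (F : rcfType) (nu : F -> RR).
Hypothesis nuP : convex_valuation (idfun : {rmorphism F -> F}) nu.
Notation tm := (qe_rcf.term F).
Notation ev := (@qe_rcf.eval F).

Lemma nu_rat (q : rat) : q != 0 -> nu (ratr q) = 0.
Proof.
move=> q0; rewrite /ratr (nu_div nuP) ?intr_eq0 ?numq_eq0 ?denq_neq0 //.
by rewrite !(nu_int nuP) ?numq_eq0 ?denq_neq0 // subr0.
Qed.

Lemma nu_lt_norm (a r : F) : a != 0 -> (r == 0) || (nu r < nu a) -> `|r| < `|a|.
Proof.
move=> a0 /orP[/eqP->|ra]; first by rewrite normr0 normr_gt0.
rewrite ltNge; apply/negP => le; have pa : 0 < `|a| by rewrite normr_gt0.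
by have := cv_mono nuP pa le; rewrite !(nu_normr nuP); lra.
Qed.

(** The remaining terms have smaller valuation, hence by convexity a sum of smaller absolute value,
    which can neither cancel [a i0] nor change its sign. *)
Lemma dominant_term (I : finType) (a : I -> F) i0 : a i0 != 0 ->
  (forall i, i != i0 -> (a i == 0) || (nu (a i) < nu (a i0))) ->
  [/\ \sum_i a i != 0, nu (\sum_i a i) = nu (a i0) & (0 < \sum_i a i) = (0 < a i0)].
Proof.
move=> h0 dom; rewrite (bigD1 i0) //=; set r := \sum_(i | _) a i.
have small : (r == 0) || (nu r < nu (a i0)).
  rewrite /r; apply: (big_ind (fun x => (x == 0) || (nu x < nu (a i0)))) => //.
    by rewrite eqxx.
  move=> x y; have [->|x0] := eqVneq x 0; first by rewrite add0r.
  have [->|y0] := eqVneq y 0; first by rewrite addr0 (negbTE x0).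
  move=> /= hx hy; have [//|xy0] := eqVneq (x + y) 0.
  apply: (@le_lt_trans _ _ (Num.max (nu x) (nu y))); last by rewrite gt_max hx.
  by apply: (cv_add nuP) => //; rewrite le_max lexx ?orbT.
have lt := nu_lt_norm h0 small.
have s0 : a i0 + r != 0.
  by apply: contraTneq lt => /eqP; rewrite addr_eq0 => /eqP ->; rewrite normrN ltxx.
split=> //.
  apply/eqP; rewrite eq_le; apply/andP; split.
    rewrite -(ballE _ _ s0); apply: (ballD nuP); first by rewrite ballE.
    by case/orP: small => [/eqP ->|/ltW h]; rewrite ?ball0 // /ball h orbT.
  (* Otherwise [a i0], as the difference of the sum and [r], would be smaller than itself in
     absolute value. *)
  rewrite leNgt; apply/negP => lt'.
  have : `|a i0 + r - r| < `|a i0|.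
    apply: nu_lt_norm => //; have [r0|r0] := eqVneq r 0.
      by move: lt'; rewrite r0 addr0 subr0 => ->; rewrite orbT.
    rewrite (negbTE r0) /= in small; apply/orP; right.
    apply: (@le_lt_trans _ _ (Num.max (nu (a i0 + r)) (nu r))); last by rewrite gt_max lt'.
    by apply: (cv_add nuP); rewrite ?oppr_eq0 ?addrK ?(nuN nuP) // le_max lexx ?orbT.
  by rewrite addrK ltxx.
move: lt; rewrite ltr_norml; have [pa|pa|e] := ltrgt0P (a i0); rewrite ?opprK => /andP[h1 h2].
- by lra.
- by apply/negbTE; rewrite -leNgt; lra.
- by rewrite e eqxx in h0.
Qed.

Variable lambda : RR.

(* A pair [x, x'] stands for the values of one expression at two points, the
   second obtained from the first by rescaling valuations by [lambda]. *)
Definition scaled_pairs (W : F -> F -> Prop) : Prop := forall x x', W x x' ->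
  [/\ (x == 0) = (x' == 0), (0 < x) = (0 < x') & x != 0 -> nu x' = lambda * nu x].

Definition ring_pairs (W : F -> F -> Prop) : Prop :=
  [/\ forall c, israt c -> W c c,
      forall x x' y y', W x x' -> W y y' -> W (x + y) (x' + y'),
      forall x x' y y', W x x' -> W y y' -> W (x * y) (x' * y') &
      forall x x', W x x' -> W (- x) (- x')].

(** If [W] is a subring of [F * F], this is the subring generated by [W] and the pair of [t] and
    [t']. *)
Definition adjoin (W : F -> F -> Prop) (t t' : F) : F -> F -> Prop := fun x x' =>
  exists p q : {poly F}, (forall i, W p`_i q`_i) /\ x = p.[t] /\ x' = q.[t'].

Lemma ring_pairs_sum (W : F -> F -> Prop) (I : Type) (r : seq I) (P : pred I) (f g : I -> F) :
  ring_pairs W -> (forall i, P i -> W (f i) (g i)) ->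
  W (\sum_(i <- r | P i) f i) (\sum_(i <- r | P i) g i).
Proof.
move=> [Wc Wa _ _] h; apply: (big_ind2 W) => //; exact: (Wc 0 (israt0 F)).
Qed.

Lemma adjoin_const W t t' x x' : ring_pairs W -> W x x' -> adjoin W t t' x x'.
Proof.
move=> [Wc _ _ _] h; exists x%:P, x'%:P; rewrite !hornerC; split=> // i.
by rewrite !coefC; case: eqP => // _; apply: Wc (israt0 F).
Qed.

Lemma adjoin_gen W t t' : ring_pairs W -> adjoin W t t' t t'.
Proof.
move=> [Wc _ _ _]; exists 'X, 'X; rewrite !hornerX; split=> // i; rewrite coefX.
by case: eqP => _; apply: Wc; [apply: israt1 | apply: israt0].
Qed.

Lemma adjoin_ring W t t' : ring_pairs W -> ring_pairs (adjoin W t t').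
Proof.
move=> hW; have [Wc Wa Wm Wn] := hW; split.
- by move=> c hc; apply: adjoin_const => //; apply: Wc.
- move=> x x' y y' [p [q [pq [-> ->]]]] [p1 [q1 [pq1 [-> ->]]]].
  by exists (p + p1), (q + q1); rewrite !hornerD; split=> // i; rewrite !coefD; apply: Wa.
- move=> x x' y y' [p [q [pq [-> ->]]]] [p1 [q1 [pq1 [-> ->]]]].
  exists (p * p1), (q * q1); rewrite !hornerM; split=> // i; rewrite !coefM.
  by apply: ring_pairs_sum => // j _; apply: Wm.
- move=> x x' [p [q [pq [-> ->]]]]; exists (- p), (- q); rewrite !hornerN; split=> // i.
  by rewrite !coefN; apply: Wn.
Qed.

(** The monomials of [p] at [t] have distinct valuations, so one dominates. Since [lambda] is
    positive, the same monomial dominates in [q] at [t'], and the signs and valuations are read off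
    it. *)
Lemma adjoin_dominant W (t t' : F) (p q : {poly F}) : scaled_pairs W -> 0 < t -> 0 < t' ->
  nu t' = lambda * nu t -> 0 < lambda ->
  (forall i, W p`_i q`_i) ->
  (forall i j, p`_i != 0 -> p`_j != 0 -> nu p`_i + nu t *+ i = nu p`_j + nu t *+ j -> i = j) ->
  p != 0 -> exists i, [/\ p`_i != 0, nu p.[t] = nu p`_i + nu t *+ i &
     [/\ p.[t] != 0, q.[t'] != 0, (0 < p.[t]) = (0 < q.[t']) & nu q.[t'] = lambda * nu p.[t]]].
Proof.
move=> hW t0 t0' tt' l0 pq inj p0.
have tn : t != 0 by rewrite gt_eqF.
have tn' : t' != 0 by rewrite gt_eqF.
have i1P : p`_(size p).-1 != 0 by rewrite -lead_coefE lead_coef_eq0.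
have sp : ((size p).-1 < size p)%N by rewrite prednK // size_poly_gt0.
have [i0 pi0 max0] := @arg_maxP _ _ _ (Ordinal sp) (fun i : 'I_(size p) => p`_i != 0)
   (fun i => nu p`_i + nu t *+ i) i1P.
have sq : (size q <= size p)%N.
  apply/leq_sizeP => j jp; have [e _ _] := hW _ _ (pq j).
  by apply/eqP; rewrite -e (leq_sizeP _ _ (leqnn _)).
have [e1 s1 n1] := hW _ _ (pq i0).
have nq i : p`_i != 0 -> q`_i != 0 /\ nu q`_i = lambda * nu p`_i.
  by have [e _ n] := hW _ _ (pq i) => h; rewrite -e n.
pose a (i : 'I_(size p)) := p`_i * t ^+ i; pose b (i : 'I_(size p)) := q`_i * t' ^+ i.
have an i : p`_i != 0 -> nu (p`_i * t ^+ i) = nu p`_i + nu t *+ i.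
  by move=> h; rewrite (cv_mul nuP) ?expf_neq0 // (nuX nuP).
have bn i : p`_i != 0 -> nu (q`_i * t' ^+ i) = lambda * (nu p`_i + nu t *+ i).
  move=> h; have [h1 h2] := nq i h.
  by rewrite (cv_mul nuP) ?expf_neq0 // (nuX nuP) // h2 tt' mulrDr mulrnAr.
have lt i : i != i0 -> p`_i != 0 -> nu p`_i + nu t *+ i < nu p`_i0 + nu t *+ i0.
  move=> ii0 h; rewrite lt_neqAle; apply/andP; split; last exact: (max0 i h).
  by apply: contraNneq ii0 => e; apply/eqP/val_inj; apply: inj.
have [|i ii0|pz pn ps] := @dominant_term _ a i0; first by rewrite mulf_neq0 ?expf_neq0.
  have [e|h] := eqVneq p`_i 0; first by rewrite /a e mul0r eqxx.
  by rewrite /a !an // lt // orbT.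
have [|i ii0|qz qn qs] := @dominant_term _ b i0; first by rewrite mulf_neq0 ?expf_neq0 -?e1.
  have [e|h] := eqVneq p`_i 0.
    by have [e2 _ _] := hW _ _ (pq i); rewrite e eqxx in e2; rewrite /b (eqP (esym e2)) mul0r eqxx.
  by rewrite /b !bn // ltr_pM2l // lt // orbT.
have pE : p.[t] = \sum_i a i by rewrite horner_coef.
have qE : q.[t'] = \sum_i b i by rewrite (horner_coef_wide _ sq).
exists i0; rewrite pE qE; split=> //; first by rewrite pn an.
split=> //; last by rewrite qn pn bn ?an.
by rewrite ps qs /a /b !pmulr_lgt0 ?exprn_gt0.
Qed.

Fixpoint zspan (gs : seq RR) (g : RR) : Prop :=
  if gs is h :: gs' then exists z : int, zspan gs' (g - h *~ z) else g = 0.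

(** Linear independence over the rationals, phrased without division. *)
Fixpoint independent (gs : seq RR) : Prop :=
  if gs is h :: gs' then independent gs' /\ forall k, ~ zspan gs' (h *+ k.+1)
  else Logic.True.

Lemma zspan0 gs : zspan gs 0.
Proof. by elim: gs => //= h gs IH; exists 0; rewrite mulr0z subr0. Qed.

Lemma zspanB gs g g' : zspan gs g -> zspan gs g' -> zspan gs (g - g').
Proof.
elim: gs g g' => [|h gs IH] g g' /=; first by move=> -> ->; rewrite subr0.
move=> [z hz] [z' hz']; exists (z - z'); rewrite mulrzBr.
have -> : g - g' - (h *~ z - h *~ z') = (g - h *~ z) - (g' - h *~ z') by ring.
exact: IH.
Qed.

Lemma zspan_cons h gs g z : zspan gs g -> zspan (h :: gs) (g + h *~ z).
Proof. by exists z; rewrite addrK. Qed.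

Lemma zspan_ind (G : RR -> Prop) gs : G 0 -> (forall x y, G x -> G y -> G (x - y)) ->
  All G gs -> forall g, zspan gs g -> G g.
Proof.
move=> G0 GB; elim: gs => [_ g -> //|h gs IH [Gh /IH Gs] g [z /Gs Gz]].
have GN x : G x -> G (- x) by rewrite -sub0r; apply: GB.
have GD x y : G x -> G y -> G (x + y) by move=> hx hy; rewrite -[y]opprK; apply: GB => //; apply: GN.
have Gn n : G (h *+ n) by elim: n => [|n IHn]; rewrite ?mulr0n ?mulrS //; apply: GD.
rewrite -(subrK (h *~ z) g); apply: GD => //.
by case: z {Gz} => n; [apply: Gn | rewrite NegzE mulrNz; apply/GN/Gn].
Qed.

(** Greedy choice: [x] contributes the positive element of equal valuation, its absolute value,
    unless a positive multiple of [nu x] is already in the span. *)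
Lemma independent_basis (s : seq F) : All (fun x => x != 0) s ->
  exists t : seq F, [/\ All (fun x => 0 < x) t, independent (map nu t) &
    All (fun x => exists k, zspan (map nu t) (nu x *+ k.+1)) s].
Proof.
elim: s => [|x s IH] /=; first by exists [::].
move=> [x0 /IH[t [tp ti ts]]].
have [hx|hx] := EM (exists k, zspan (map nu t) (nu x *+ k.+1)); first by exists t; split.
exists (`|x| :: t); split=> //=; rewrite ?(nu_normr nuP).
- by split=> //; rewrite normr_gt0.
- by split=> // k hk; apply: hx; exists k.
split.
  by exists 0%N, 1; rewrite mulr1n mulr1z subrr; apply: zspan0.
by apply: All_imp ts => y [k hk]; exists k, 0; rewrite mulr0z subr0.
Qed.

(** The last property makes [N] invisible to the valuation. If an integer bounds the units, a larger
    integer is taken, and polynomial values at it are rational. Otherwise the bound [b] exceeds all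
    integers, and nonzero rational polynomials cannot become infinitesimal at [b]. *)
Lemma residual_bound (us : seq F) : All (fun u => u != 0 /\ nu u = 0) us ->
  exists N : F, [/\ 0 < N, nu N = 0, All (fun u => `|u| <= N /\ `|u|^-1 <= N) us &
    forall p : {poly rat}, (map_poly ratr p).[N] != 0 -> nu (map_poly ratr p).[N] = 0].
Proof.
move=> hus.
have [b [b1 nb hb]] : exists b, [/\ 1 <= b, nu b = 0 & All (fun u => `|u| <= b /\ `|u|^-1 <= b) us].
  elim: us hus => [_|u us IH /= [[u0 nu0] /IH[b [b1 nb hb]]]].
    by exists 1; split=> //; apply: (nu1 nuP).
  have un0 : `|u| != 0 by rewrite normr_eq0.
  have ui0 : 0 < `|u|^-1 by rewrite invr_gt0 normr_gt0.
  have ua0 : 0 < `|u| by rewrite normr_gt0.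
  exists (b + `|u| + `|u|^-1); split.
  - by lra.
  - have bp : 0 < b + `|u| + `|u|^-1 by lra.
    have bp0 : b + `|u| + `|u|^-1 != 0 by rewrite gt_eqF.
    apply/eqP; rewrite eq_le; apply/andP; split; last first.
      by rewrite -(nu1 nuP); apply: (cv_mono nuP) => //; lra.
    rewrite -ballE //; apply: (ballD nuP); first apply: (ballD nuP).
    + by rewrite /ball nb lexx orbT.
    + by rewrite /ball (nu_normr nuP) nu0 lexx orbT.
    + by rewrite /ball (nuV nuP) // (nu_normr nuP) nu0 oppr0 lexx orbT.
  - split; first by split; lra.
    by apply: All_imp hb => v [h1 h2]; split; lra.
have [[n bn]|large] := EM (exists n : nat, b <= n%:R).
  exists n.+1%:R; split; first by rewrite ltr0Sn.
  - exact: (nu_nat nuP).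
  - have n1 : n%:R <= n.+1%:R :> F by rewrite ler_nat.
    by apply: All_imp hb => u [h1 h2]; split; lra.
  - move=> p; rewrite -(ratr_nat F) horner_map fmorph_eq0; exact: nu_rat.
exists b; split=> //; first by lra.
have big n : n%:R < b.
  by rewrite ltNge; apply/negP => h; apply: large; exists n.
(* A lower bound 1/n with [n] natural gives valuation at least 0; the ultrametric inequality gives
   at most 0. *)
suff low (p : {poly rat}) : p != 0 -> exists n : nat, 1 <= n%:R * `|(map_poly ratr p).[b]|.
  move=> p p0; have p00 : p != 0 by apply: contraNneq p0 => ->; rewrite map_poly0 horner0.
  have [n hn] := low p p00; apply/eqP; rewrite eq_le; apply/andP; split.
    rewrite -ballE // horner_coef; apply: (ball_sum nuP) => i _; rewrite -(addr0 0).
    apply: (ballM nuP).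
      rewrite coef_map; have [e|h] := eqVneq p`_i 0; first by rewrite e raddf0 ball0.
      by rewrite /ball nu_rat // lexx orbT.
    by rewrite /ball (nuX nuP) ?nb ?mul0rn ?lexx ?orbT // gt_eqF //; lra.
  have := cv_mono nuP ltr01 hn; rewrite (nu1 nuP); case: n hn => [|n] hn.
    by move: hn; rewrite mul0r ler10.
  by rewrite (cv_mul nuP) ?normr_eq0 ?pnatr_eq0 // (nu_nat nuP) add0r (nu_normr nuP).
elim/poly_ind: p => [|p c IH]; first by rewrite eqxx.
have ub (r : rat) : exists n : nat, `|ratr r : F| <= n%:R.
  exists (Num.bound `|r|); rewrite -ratr_norm -(ratr_nat F) ler_rat.
  by apply: ltW; apply: archi_boundP.
rewrite rmorphD rmorphM /= map_polyX map_polyC /= hornerMXaddC.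
have [->|p0] := eqVneq p 0.
  rewrite map_poly0 horner0 !mul0r !add0r polyC_eq0 => c0.
  have [n hn] := ub c^-1; exists n; rewrite -ler_pdivrMr ?normr_gt0 ?fmorph_eq0 //.
  by rewrite mul1r -normfV -fmorphV.
move=> _; have [n hn] := IH p0; have [m hm] := ub c; exists n.
set y := (map_poly ratr p).[b] in hn *.
have n0 : 0 <= n%:R :> F by rewrite ler0n.
have b0 : 0 <= b by lra.
have low : `|y| * b - `|ratr c : F| <= `|y * b + ratr c|.
  by apply: (le_trans _ (lerB_normD _ _)); rewrite (normrM y b) (ger0_norm b0).
apply: le_trans (ler_wpM2l n0 low).
have n1 : 1 <= n%:R :> F.
  by case: (n) hn => [|k _]; rewrite ?mul0r ?ler10 // ler1n.
have h1 : b <= (n%:R * `|y|) * b by apply: ler_peMl.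
(* As [b] exceeds [n * (m + 1)] and [n] is at least 1, at least 1 remains after the constant term is
   subtracted. *)
have h2 := ler_wpM2l n0 hm; have := big (n * m.+1)%N; rewrite natrM -addn1 natrD.
by rewrite mulrBr mulrA; lra.
Qed.

End Scaling.

(** * Transfer of solutions to rescaled parameters *)

Section ScalingTheorem.
Variables (F : rcfType) (nu : F -> RR).
Hypothesis nuP : convex_valuation (idfun : {rmorphism F -> F}) nu.
Notation ev := (@qe_rcf.eval F).

Section Pairs.
Variables (lambda : RR) (N : F) (h : F -> F).
Hypothesis l0 : 0 < lambda.
Hypothesis hP : forall t : F, 0 < t -> 0 < h t /\ nu (h t) = lambda * nu t.
Hypothesis N0 : forall p : {poly rat}, (map_poly ratr p).[N] != 0 -> nu (map_poly ratr p).[N] = 0.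

(** [N] stays fixed, so the base ring of rational polynomials in [N] is paired with itself; each
    parameter [t] is then sent to [h t]. *)
Fixpoint pairs (ts : seq F) : F -> F -> Prop :=
  if ts is t :: ts' then adjoin (pairs ts') t (h t)
  else fun x x' => x = x' /\ exists p : {poly rat}, x = (map_poly ratr p).[N].

Lemma pairs_ring ts : ring_pairs (pairs ts).
Proof.
elim: ts => [|t ts IH] /=; last exact: adjoin_ring.
split.
- by move=> c [q ->]; split=> //; exists q%:P; rewrite map_polyC hornerC.
- by move=> x x' y y' [<- [p ->]] [<- [q ->]]; split=> //; exists (p + q);
    rewrite rmorphD hornerD.
- by move=> x x' y y' [<- [p ->]] [<- [q ->]]; split=> //; exists (p * q);
    rewrite rmorphM hornerM.
- by move=> x x' [<- [p ->]]; split=> //; exists (- p); rewrite rmorphN hornerN.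
Qed.

(** Induction on [ts]. The second conclusion is carried along because, with independence, it makes
    the monomials in the next parameter have distinct valuations. *)
Lemma pairs_scaled ts : All (fun t => 0 < t) ts -> independent (map nu ts) ->
  scaled_pairs nu lambda (pairs ts) /\
  forall x x', pairs ts x x' -> x != 0 -> zspan (map nu ts) (nu x).
Proof.
elim: ts => [_ _|t ts IH] /=.
  split=> [x x' [<- [p ->]]|x x' [_ [p ->]]]; last exact: N0.
  by split=> // /N0 ->; rewrite mulr0.
move=> [t0 tp] [ind ti]; have [W1 W2] := IH tp ind; have [ht0 nht] := hP t0.
have inj (p q : {poly F}) : (forall i, pairs ts p`_i q`_i) -> forall i j,
    p`_i != 0 -> p`_j != 0 -> nu p`_i + nu t *+ i = nu p`_j + nu t *+ j -> i = j.
  move=> pq.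
  suff H i j : (i < j)%N -> p`_i != 0 -> p`_j != 0 ->
      nu p`_i + nu t *+ i = nu p`_j + nu t *+ j -> False.
    by move=> i j pi pj e; case: (ltngtP i j) => // ij; exfalso;
       [apply: (H i j) | apply: (H j i)].
  (* Equal valuations would put the multiple [j - i] of [nu t] into the span of the other values;
     [independent] counts multiples from [k.+1], hence the predecessor. *)
  move=> ij pi pj e; apply: (ti (j - i).-1); rewrite prednK ?subn_gt0 //.
  rewrite mulrnBr ?(ltnW ij) //.
  have -> : nu t *+ j - nu t *+ i = nu p`_i - nu p`_j.
    by apply/eqP; rewrite subr_eq addrAC eq_sym subr_eq e addrC.
  by apply: zspanB; apply: W2 (pq _) _.
have dom x x' : adjoin (pairs ts) t (h t) x x' -> x != 0 ->
    exists (p q : {poly F}) i, [/\ pairs ts p`_i q`_i, p`_i != 0, nu x = nu p`_i + nu t *+ i &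
    [/\ x' != 0, (0 < x) = (0 < x') & nu x' = lambda * nu x]].
  move=> [p [q [pq [-> ->]]]] x0.
  have p0 : p != 0 by apply: contraNneq x0 => ->; rewrite horner0.
  have [i [h1 h2 [_ h3 h4 h5]]] := adjoin_dominant nuP W1 t0 ht0 nht l0 pq (inj _ _ pq) p0.
  by exists p, q, i; split.
split=> [x x' xx'|x x' xx' x0]; last first.
  have [p [q [i [pq pi -> _]]]] := dom x x' xx' x0.
  by rewrite pmulrn; apply: zspan_cons; apply: W2 pq pi.
have [x0|x0] := eqVneq x 0; last first.
  by have [p [q [i [_ _ _ [h1 h2 h3]]]]] := dom x x' xx' x0; split=> //; rewrite (negbTE h1).
(* A nonzero [p] has a nonzero value by dominance, so [p] vanishes, hence [q] coefficientwise. *)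
suff -> : x' = 0 by rewrite x0 eqxx ltxx.
case: xx' => p [q [pq [xE ->]]].
have [p0|p0] := eqVneq p 0; last first.
  have [i [_ _ [h3 _ _ _]]] := adjoin_dominant nuP W1 t0 ht0 nht l0 pq (inj _ _ pq) p0.
  by rewrite -xE x0 eqxx in h3.
suff -> : q = 0 by rewrite horner0.
apply/polyP => i; rewrite coef0; have [e _ _] := W1 _ _ (pq i).
by apply/eqP; rewrite -e p0 coef0.
Qed.

Lemma pairs_nth ts i : pairs ts (rcons ts N)`_i (rcons (map h ts) N)`_i.
Proof.
elim: ts i => [|t ts IH] [|i] //=.
- by split=> //; exists 'X; rewrite map_polyX hornerX.
- rewrite nth_nil; split=> //; exists 0; by rewrite map_poly0 horner0.
- exact: adjoin_gen (pairs_ring ts).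
- exact: adjoin_const (pairs_ring ts) (IH i).
Qed.

Lemma pairs_term ts T : ratT T -> pairs ts (ev (rcons ts N) T) (ev (rcons (map h ts) N) T).
Proof.
have [Wc Wa Wm Wn] := pairs_ring ts.
have Wi (z : int) : pairs ts z%:~R z%:~R by apply: Wc; apply: israt_int.
have Wk n : pairs ts n%:R n%:R by have := Wi n.
elim: T => /=.
- by move=> i _; apply: pairs_nth.
- by move=> c hc; apply: Wc.
- by [].
- by move=> u IHu v IHv [/IHu hu /IHv hv]; apply: Wa.
- by move=> u IHu /IHu; apply: Wn.
- by move=> u IHu n /IHu hu; rewrite -!(mulr_natr (ev _ u)); apply: Wm.
- by move=> u IHu v IHv [/IHu hu /IHv hv]; apply: Wm.
- move=> u IHu n /IHu hu; elim: n => [|n IHn]; first by rewrite !expr0; apply: (Wk 1%N).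
  by rewrite !exprS; apply: Wm.
Qed.

Lemma pairs_same_signs ts : All (fun t => 0 < t) ts -> independent (map nu ts) ->
  same_signs (rcons ts N) (rcons (map h ts) N).
Proof.
by move=> tp ti T hT; have [W1 _] := pairs_scaled tp ti; case: (W1 _ _ (pairs_term ts hT)).
Qed.

End Pairs.

(** A rational polynomial function. Variables are numbered by position, so a term is required for
    every number [a] of preceding parameters. *)
Definition polyfun (g : seq F -> F) : Prop := forall a, exists T, ratT T /\
  forall e x, size e = a -> ev (e ++ x) T = g x.

(** Serves for valuations of Laurent monomials in [ts], written as a quotient of two terms because
    terms have no division. The last clause says in effect that only the variables of [ts] occur. *)
Definition fraction_value (ts : seq F) (g : RR) : Prop := exists T1 T2,
  [/\ ratT T1 /\ ratT T2, 0 < ev ts T1 /\ 0 < ev ts T2, g = nu (ev ts T2) - nu (ev ts T1) &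
    forall e y, (size ts <= size e)%N ->
      ev (e ++ y) T1 = ev e T1 /\ ev (e ++ y) T2 = ev e T2].

Lemma zspan_fraction_value ts g : All (fun t => 0 < t) ts ->
  zspan (map nu ts) g -> fraction_value ts g.
Proof.
move=> tp; apply: zspan_ind.
- exists (qe_rcf.NatConst F 1), (qe_rcf.NatConst F 1).
  by split=> //=; rewrite ?ltr01 ?subrr.
- move=> x y [T1 [T2 [[h1 h2] [p1 p2] -> E]]] [U1 [U2 [[k1 k2] [q1 q2] -> E']]].
  exists (qe_rcf.Mul T1 U2), (qe_rcf.Mul T2 U1); split=> //=; rewrite ?mulr_gt0 //.
    by rewrite !(cv_mul nuP) ?gt_eqF //; ring.
  by move=> e z sz; have [-> ->] := E e z sz; have [-> ->] := E' e z sz.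
apply/All_map.
suff H us vs : ts = us ++ vs -> All (fun x => fraction_value ts (nu x)) vs by apply: (H [::]).
elim: vs us => //= v vs IH us tE; split; last by apply: (IH (rcons us v)); rewrite cat_rcons.
have v0 : 0 < v by move: tp; rewrite tE => /All_cat[_ []].
have tsv : ts`_(size us) = v by rewrite tE nth_cat ltnn subnn.
exists (qe_rcf.NatConst F 1), (qe_rcf.Var F (size us)); split=> //=.
- by rewrite tsv ltr01.
- by rewrite tsv (nu1 nuP) subr0.
- move=> e z sz; split=> //; rewrite nth_cat (leq_trans _ sz) //.
  by rewrite tE size_cat /= -addSnnS leq_addr.
Qed.

Section Transfer.
Variables (lambda : RR) (ts : seq F) (x : seq F).
Hypothesis tp : All (fun t => 0 < t) ts.

Definition compatible (N : F) (e' : seq F) : Prop :=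
  [/\ 0 < N, nu N = 0, size e' = (size ts).+1, e'`_(size ts) = N &
    forall T, ratT T -> (0 < ev (rcons ts N) T) = (0 < ev e' T) /\
      (ev (rcons ts N) T != 0 -> nu (ev e' T) = lambda * nu (ev (rcons ts N) T))].

(* With [u] the unit [g x ^ k * T1 / T2], the definable set [D] says that the
   corresponding quotient at the new point is still between [1 / N] and [N]. *)
Lemma transfer_one (g : seq F -> F) k : polyfun g -> g x != 0 ->
  zspan (map nu ts) (nu (g x) *+ k.+1) ->
  exists u, (u != 0 /\ nu u = 0) /\ forall N e', compatible N e' -> `|u| <= N /\ `|u|^-1 <= N ->
    exists D, [/\ definable D, D (rcons ts N ++ x) &
      forall y, D (e' ++ y) -> g y != 0 /\ nu (g y) = lambda * nu (g x)].
Proof.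
move=> /(_ (size ts).+1)[G [hG GE]] gx0 /(zspan_fraction_value tp).
move=> [T1 [T2 [[h1 h2] [p1 p2] nuE loc]]].
set v1 := ev ts T1 in p1 nuE; set v2 := ev ts T2 in p2 nuE.
have n1 : v1 != 0 by rewrite gt_eqF.
have n2 : v2 != 0 by rewrite gt_eqF.
have gk0 : g x ^+ k.+1 != 0 by rewrite expf_neq0.
have [u [u0 uE nu_u]] : exists u, [/\ u != 0, u * v2 = g x ^+ k.+1 * v1 & nu u = 0].
  exists (g x ^+ k.+1 * v1 / v2); split; first by rewrite !mulf_neq0 ?invr_eq0.
    by rewrite divfK.
  by rewrite (nu_div nuP) ?mulf_neq0 // (cv_mul nuP) // (nuX nuP) // nuE; ring.
exists u; split=> //.
move=> N e' [N0 nN se' e'N comp] [uN uN'].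
(* Squares replace absolute values: the two conditions are [A] at most [M * B] and [B] at most
   [M * A]. *)
pose A := qe_rcf.Mul (qe_rcf.Exp (qe_rcf.Exp G k.+1) 2) (qe_rcf.Exp T1 2).
pose B := qe_rcf.Exp T2 2.
pose M := qe_rcf.Exp (qe_rcf.Var F (size ts)) 2.
pose sub (s t : qe_rcf.term F) := qe_rcf.Add s (qe_rcf.Opp t).
exists (fun e => ~ (0 < ev e (sub A (qe_rcf.Mul M B))) /\ ~ (0 < ev e (sub B (qe_rcf.Mul M A)))).
have loc1 y : ev (rcons ts N ++ y) T1 = v1 /\ ev (rcons ts N ++ y) T2 = v2.
  by rewrite cat_rcons; apply: loc.
have nthN y : (rcons ts N ++ y)`_(size ts) = N by rewrite cat_rcons nth_cat ltnn subnn.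
split.
- by apply: definable_and; apply: definable_not; apply: definable_gt.
- rewrite /= !nthN; have [-> ->] := loc1 x; rewrite GE ?size_rcons //.
  have sq_le (a b : F) : 0 <= a -> a <= b -> a ^+ 2 <= b ^+ 2.
    by move=> a0 ab; rewrite !expr2 ler_pM.
  rewrite -exprMn -uE !subr_gt0 -!exprMn; split; apply/negP; rewrite -leNgt.
    rewrite -(real_normK (num_real (u * v2))) normrM (gtr0_norm p2).
    by apply: sq_le; rewrite ?ler_pM2r // mulr_ge0 // ltW.
  rewrite -(real_normK (num_real (N * _))) !normrM (gtr0_norm p2) (gtr0_norm N0) mulrA.
  apply: sq_le; first exact: ltW.
  by apply: ler_peMl; [exact: ltW | rewrite -ler_pdivrMr ?normr_gt0 // div1r].
have sz : (size ts <= size e')%N by rewrite se'.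
move=> y; rewrite /= nth_cat se' ltnSn e'N.
have [-> ->] := loc e' y sz; rewrite GE //.
have [/esym s1 m1] := comp T1 h1; have [/esym s2 m2] := comp T2 h2.
have := loc1 [::]; rewrite cats0 => -[E1 E2]; rewrite E1 E2 in s1 s2 m1 m2.
rewrite p1 in s1; rewrite p2 in s2; have {}m1 := m1 n1; have {}m2 := m2 n2.
set V1 := ev e' T1 in s1 m1 *; set V2 := ev e' T2 in s2 m2 *; set z := g y.
move=> [/negP + /negP]; rewrite -!leNgt !subr_le0 -!exprMn => c1 c2.
have q1 : V1 != 0 by rewrite gt_eqF.
have q2 : V2 != 0 by rewrite gt_eqF.
have N00 : N != 0 by rewrite gt_eqF.
have z0 : z != 0.
  by apply: contraTneq c2 => ->; rewrite expr0n !(mul0r, mulr0) expr0n /= -ltNge exprn_gt0.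
have zk0 : z ^+ k.+1 != 0 by rewrite expf_neq0.
have zV : z ^+ k.+1 * V1 != 0 by rewrite mulf_neq0.
have sq_gt0 w : w != 0 -> 0 < w ^+ 2 :> F by rewrite exprn_even_gt0.
(* Since [nu N] is 0, the two inequalities force equality of valuations; the factors 2 and [k.+1]
   are then divided out. *)
have := cv_mono nuP (sq_gt0 _ zV) c1; have := cv_mono nuP (sq_gt0 _ q2) c2.
rewrite !(nuX nuP) ?mulf_neq0 // !(cv_mul nuP) ?mulf_neq0 // !(nuX nuP) // nN m1 m2 => i1 i2.
split=> //; apply: (@mulIf _ k.+1%:R); first by rewrite pnatr_eq0.
rewrite !mulr_natr -mulrnAr nuE mulrBr; lra.
Qed.

(** The units are produced before [N], which has to bound all of them at once. *)
Lemma transfer_all (gs : seq (seq F -> F)) :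
  All polyfun gs -> All (fun g => g x != 0) gs ->
  All (fun g => exists k, zspan (map nu ts) (nu (g x) *+ k.+1)) gs ->
  exists us, All (fun u => u != 0 /\ nu u = 0) us /\ forall N e', compatible N e' ->
    All (fun u => `|u| <= N /\ `|u|^-1 <= N) us ->
    exists D, [/\ definable D, D (rcons ts N ++ x) &
      forall y, D (e' ++ y) -> All (fun g => g y != 0 /\ nu (g y) = lambda * nu (g x)) gs].
Proof.
elim: gs => [_ _ _|g gs IH /= [pg pgs] [g0 gs0] [[k gk] gsk]].
  by exists [::]; split=> // N e' _ _; exists (fun=> True); split=> //; apply: definable_true.
have [us [hus H]] := IH pgs gs0 gsk; have [u [hu Hu]] := transfer_one pg g0 gk.
exists (u :: us); split=> // N e' ce' [uN usN].
have [D [hD Dx DE]] := H N e' ce' usN; have [D1 [hD1 D1x D1E]] := Hu N e' ce' uN.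
exists (fun e => D1 e /\ D e); split=> //; first exact: definable_and.
by move=> y [/D1E h1 /DE h2].
Qed.

End Transfer.

Theorem scaling (lambda : RR) (gs : seq (seq F -> F)) (x : seq F) : 0 < lambda ->
  (forall t, 0 < t -> exists t', 0 < t' /\ nu t' = lambda * nu t) ->
  All polyfun gs -> All (fun g => g x != 0) gs ->
  exists y, size y = size x /\ All (fun g => g y != 0 /\ nu (g y) = lambda * nu (g x)) gs.
Proof.
move=> l0 hex pf g0.
have [ts [tp ti tspan]] : exists t : seq F, [/\ All (fun x => 0 < x) t, independent (map nu t) &
    All (fun g : seq F -> F => exists k, zspan (map nu t) (nu (g x) *+ k.+1)) gs].
  have [|t [h1 h2 /All_map h3]] := @independent_basis F nu nuP (map (fun g => g x) gs).
    exact/All_map.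
  by exists t.
have [h hP] : exists h : F -> F, forall t, 0 < t -> 0 < h t /\ nu (h t) = lambda * nu t.
  have : forall t, exists t', 0 < t -> 0 < t' /\ nu t' = lambda * nu t.
    by move=> t; have [/hex[t' ht']|] := boolP (0 < t); [exists t' | exists 0].
  by move=> /boolp.choice[h hP]; exists h.
have [us [hus H]] := @transfer_all lambda ts x tp gs pf g0 tspan.
have [N [N0 nN usN resN]] := residual_bound nuP hus.
pose e := rcons ts N; pose e' := rcons (map h ts) N.
have [W1 _] := pairs_scaled l0 hP resN tp ti.
have ce' : compatible lambda ts N e'.
  split=> //; rewrite ?size_rcons ?size_map //.
    by rewrite nth_rcons size_map ltnn eqxx.
  by move=> T hT; have [] := W1 _ _ (pairs_term N h ts hT).
have [D [hD Dx DE]] := H N e' ce' usN.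
(* Solvability is itself a definable condition on the parameters; it holds at [e], as [x] shows, and
   [e'] has the same signs. *)
have [D' [hD' D'E]] := definable_exists_seq (size ts).+1 (size x) hD.
have : D' e' .
  apply: (definable_transfer hD' (pairs_same_signs l0 hP resN tp ti)).
  by apply/D'E; rewrite ?size_rcons //; exists x.
rewrite D'E ?size_rcons ?size_map // => -[y [sy Dy]].
by exists y; split=> //; apply: DE.
Qed.

End ScalingTheorem.

(** * The real closed field and its complexification *)

Section Instances.
Variables (F : rcfType) (val : F -> RR).
Hypothesis hval : is_valuation val.
Hypothesis hnontriv : nontrivial_valuation val.
Hypothesis hord : order_compatible val.

Notation nu := (nuR val).

Lemma nuR_mul a b : a != 0 -> b != 0 -> nu (a * b) = nu a + nu b.
Proof. by move=> a0 b0; rewrite /nuR hval.1 // opprD. Qed.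

Lemma nuR_add a b g : a != 0 -> b != 0 -> a + b != 0 -> nu a <= g -> nu b <= g -> nu (a + b) <= g.
Proof.
move=> a0 b0 ab0; rewrite /nuR => ha hb; have := hval.2 _ _ a0 b0 ab0.
by rewrite ge_min => /orP[]; lra.
Qed.

Lemma nuR_mono a b : 0 < a -> a <= b -> nu a <= nu b.
Proof. by move=> a0; rewrite le_eqVlt => /orP[/eqP->//|]; apply: hord. Qed.

Lemma nuR_sqr a : a != 0 -> nu (a * a) = nu a + nu a.
Proof. by move=> a0; apply: nuR_mul. Qed.

(** Nontriviality gives a positive element of positive value, after inversion if necessary, and each
    square root halves the value. *)
Lemma nuR_dense e : 0 < e -> exists x, [/\ 0 < x, 0 < nu x & nu x < e].
Proof.
move=> e0; have [a [a0 na]] : exists a, 0 < a /\ 0 < nu a.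
  have [a [a0 va]] := hnontriv.
  have n1 : nu 1 = 0 by have := nuR_mul (oner_neq0 F) (oner_neq0 F); rewrite mulr1; lra.
  have nV x : x != 0 -> nu x^-1 = - nu x.
    move=> x0; have xi : x^-1 != 0 by rewrite invr_eq0.
    by have := nuR_mul x0 xi; rewrite mulfV // n1; lra.
  have abs x : x != 0 -> 0 < `|x| /\ nu `|x| = nu x.
    move=> x0; have ax0 : 0 < `|x| by rewrite normr_gt0.
    have xx : `|x| * `|x| = x * x by rewrite -!expr2 (real_normK (num_real x)).
    by split=> //; have := nuR_sqr (lt0r_neq0 ax0); rewrite xx nuR_sqr //; lra.
  have [p1 p2] := abs a a0; have ai : a^-1 != 0 by rewrite invr_eq0.
  have [q1 q2] := abs _ ai; rewrite nV // in q2.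
  case: (ltrgt0P (nu a)) => h; [by exists `|a|; rewrite p2 | by exists `|a^-1|; rewrite q2 oppr_gt0|].
  by move: h; rewrite /nuR; lra.
have root k : exists x, 0 < x /\ nu x * 2 ^+ k = nu a.
  elim: k => [|k [x [x0 xk]]]; first by exists a; rewrite mulr1.
  exists (Num.sqrt x); have sx : 0 < Num.sqrt x by rewrite sqrtr_gt0.
  split=> //; rewrite -xk exprSr -{2}(sqr_sqrtr (ltW x0)) expr2 nuR_sqr ?gt_eqF //; ring.
have [x [x0 xk]] := root (Num.bound (nu a / e)).
have p2 : 0 < 2 ^+ Num.bound (nu a / e) :> RR by rewrite exprn_gt0.
exists x; split=> //; first by rewrite -(pmulr_lgt0 _ p2) xk.
have b1 : nu a / e < (Num.bound (nu a / e))%:R by apply: archi_boundP; rewrite divr_ge0 ?ltW.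
have b2 : (Num.bound (nu a / e))%:R <= 2 ^+ Num.bound (nu a / e) :> RR.
  by rewrite -natrX ler_nat ltnW // ltn_expl.
rewrite -(ltr_pM2r p2) xk -ltr_pdivrMl // mulrC; exact: lt_le_trans b1 b2.
Qed.

Lemma convex_nuR : convex_valuation (idfun : {rmorphism F -> F}) nu.
Proof.
split=> /=.
- exact: nuR_mul.
- exact: nuR_add.
- exact: nuR_mono.
- by move=> x; rewrite (real_normK (num_real x)) expr2.
- exact: nuR_sqr.
- by move=> x x0; exists (Num.sqrt x); rewrite -expr2 sqr_sqrtr // ltW.
- by [].
- by move=> e /nuR_dense[x [x0 h1 h2]]; exists x; rewrite gt_eqF.
Qed.

Notation nuc := (nuC val).
(** Taken in [F] rather than [F[i]], so that the real valuation and quantifier elimination apply to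
    it. *)
Definition sqnorm (z : F[i]) : F := complex.Re z ^+ 2 + complex.Im z ^+ 2.

Lemma sqnorm_eq0 z : (sqnorm z == 0) = (z == 0).
Proof.
case: z => a b; rewrite /sqnorm /= paddr_eq0 ?sqr_ge0 // !sqrf_eq0.
by rewrite eq_complex.
Qed.

Lemma sqnormM z w : sqnorm (z * w) = sqnorm z * sqnorm w.
Proof. by case: z w => a b [c d]; rewrite /sqnorm /=; ring. Qed.

Lemma nuC_le z g : z != 0 -> (nuc z <= g) = ball nu g (complex.Re z) && ball nu g (complex.Im z).
Proof.
case: z => a b; rewrite eq_complex /nuC /ball /= negb_and.
have [->|a0] := eqVneq a 0; first by move=> /= /negbTE ->.
by have [->|b0] := eqVneq b 0; rewrite /= ?andbT // ge_max.
Qed.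

(** A sum of two squares cannot cancel, so its value is twice the larger of the values of the two
    parts. *)
Lemma nu_sqnorm z : z != 0 -> nu (sqnorm z) = nuc z + nuc z.
Proof.
move=> z0; have n0 : sqnorm z != 0 by rewrite sqnorm_eq0.
apply: (nu_eq_ball n0) => g; have -> : g = g / 2 + g / 2 by lra.
have bsq a : ball nu (g / 2 + g / 2) (a ^+ 2) = ball nu (g / 2) a.
  by rewrite expr2; apply: (ball_norm convex_nuR).
have -> : (nuc z + nuc z <= g / 2 + g / 2) = (nuc z <= g / 2) by apply/idP/idP; lra.
rewrite nuC_le // -!bsq /sqnorm; split=> [h|/andP[h1 h2]]; last exact: (ballD convex_nuR).
pose f (b : bool) := (if b then complex.Re z else complex.Im z) ^+ 2.
have := @ball_sum_ge0 _ _ _ convex_nuR _ xpredT f (g / 2 + g / 2).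
rewrite big_bool /= => H; have {}H := H (fun b _ => sqr_ge0 _) h.
by have /= -> := H true isT; have /= -> := H false isT.
Qed.

Lemma nuC_real (a : F) : nuc a%:C%C = nu a.
Proof. by rewrite /nuC /= eqxx; case: eqP => // ->. Qed.

Lemma pos_real (x : F[i]) : 0 < x -> x = (complex.Re x)%:C%C /\ 0 < complex.Re x.
Proof. by case: x => a b; rewrite ltcE /= => /andP[/eqP -> h]. Qed.

Lemma convex_nuC : convex_valuation (@conjc F : {rmorphism F[i] -> F[i]}) nuc.
Proof.
have nJ x : x * x^*%C = (sqnorm x)%:C%C by rewrite -sqr_normc add_Re2_Im2.
split.
- move=> x y x0 y0; have xy0 : x * y != 0 by rewrite mulf_neq0.
  have := nu_sqnorm xy0; rewrite sqnormM nuR_mul ?sqnorm_eq0 // !nu_sqnorm //; lra.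
- move=> x y g x0 y0 xy0; rewrite !nuC_le // => /andP[h1 h2] /andP[h3 h4].
  by case: x y h1 h2 h3 h4 {x0 y0 xy0} => a b [c d] /= *; apply/andP; split; apply: (ballD convex_nuR).
- move=> x y x0 xy; have y0 := lt_le_trans x0 xy.
  have [xE rx] := pos_real x0; have [yE ry] := pos_real y0.
  by rewrite xE yE !nuC_real; apply: nuR_mono => //; rewrite -lecR -xE -yE.
- by move=> x; rewrite sqr_normc.
- by move=> x x0; rewrite nJ nuC_real nu_sqnorm.
- move=> x x0; have [xE rx] := pos_real x0.
  exists (Num.sqrt (complex.Re x))%:C%C; rewrite nJ /sqnorm /= expr0n addr0 sqr_sqrtr ?ltW //.
- exact: conjcK.
- move=> e /nuR_dense[x [x0 h1 h2]]; exists x%:C%C; rewrite nuC_real; split=> //.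
  by rewrite eq_complex /= eqxx andbT gt_eqF.
Qed.

(** * Minors as polynomial functions, and the rescaled slice *)

Lemma polyfun_ext (g h : seq F -> F) : g =1 h -> polyfun g -> polyfun h.
Proof. by move=> gh hg a; have [T [hT E]] := hg a; exists T; split=> // e x /E ->. Qed.

Lemma polyfun_int (z : int) : polyfun (fun=> z%:~R : F).
Proof. by move=> a; exists (qe_rcf.Const z%:~R); split=> //; apply: israt_int. Qed.

Lemma polyfun_nth i : polyfun (fun x : seq F => x`_i).
Proof.
move=> a; exists (qe_rcf.Var F (a + i)%N); split=> // e x <- /=.
by rewrite nth_cat ltnNge leq_addr /= addKn.
Qed.

Lemma polyfunD (g h : seq F -> F) : polyfun g -> polyfun h -> polyfun (fun x => g x + h x).
Proof.
move=> hg hh a; have [T [hT E]] := hg a; have [U [hU E']] := hh a.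
by exists (qe_rcf.Add T U); split=> // e x sz /=; rewrite E ?E'.
Qed.

Lemma polyfunM (g h : seq F -> F) : polyfun g -> polyfun h -> polyfun (fun x => g x * h x).
Proof.
move=> hg hh a; have [T [hT E]] := hg a; have [U [hU E']] := hh a.
by exists (qe_rcf.Mul T U); split=> // e x sz /=; rewrite E ?E'.
Qed.

Lemma polyfunN (g : seq F -> F) : polyfun g -> polyfun (fun x => - g x).
Proof.
move=> hg; apply: polyfun_ext (polyfunM (polyfun_int (-1)) hg) => x.
by rewrite mulrNz mulN1r.
Qed.

Definition cpolyfun (g : seq F -> F[i]) : Prop :=
  polyfun (fun x => complex.Re (g x)) /\ polyfun (fun x => complex.Im (g x)).

Lemma cpolyfun_ext (g h : seq F -> F[i]) : g =1 h -> cpolyfun g -> cpolyfun h.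
Proof.
by move=> gh [h1 h2]; split; [apply: polyfun_ext h1|apply: polyfun_ext h2] => x; rewrite gh.
Qed.

Lemma cpolyfun_int (z : int) : cpolyfun (fun=> z%:~R).
Proof.
have E : z%:~R = (z%:~R : F)%:C%C by rewrite rmorph_int.
by split; [apply: polyfun_ext (polyfun_int z)|apply: polyfun_ext (polyfun_int 0)] => x; rewrite E.
Qed.

Lemma cpolyfunD (g h : seq F -> F[i]) : cpolyfun g -> cpolyfun h -> cpolyfun (fun x => g x + h x).
Proof.
move=> [g1 g2] [h1 h2]; split.
  by apply: polyfun_ext (polyfunD g1 h1) => x; case: (g x) (h x) => a b [].
by apply: polyfun_ext (polyfunD g2 h2) => x; case: (g x) (h x) => a b [].
Qed.

Lemma cpolyfunM (g h : seq F -> F[i]) : cpolyfun g -> cpolyfun h -> cpolyfun (fun x => g x * h x).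
Proof.
move=> [g1 g2] [h1 h2]; split.
  apply: polyfun_ext (polyfunD (polyfunM g1 h1) (polyfunN (polyfunM g2 h2))) => x.
  by case: (g x) (h x) => a b [].
apply: polyfun_ext (polyfunD (polyfunM g1 h2) (polyfunM g2 h1)) => x.
by case: (g x) (h x) => a b [].
Qed.

(** The class [P] is abstract so that real and complex polynomial functions are treated alike, by
    expanding the determinant. *)
Lemma det_closed (K : comNzRingType) (X : Type) (P : (X -> K) -> Prop) n (A : X -> 'M[K]_n) :
  (forall g h, g =1 h -> P g -> P h) -> (forall z : int, P (fun=> z%:~R)) ->
  (forall g h, P g -> P h -> P (fun x => g x + h x)) ->
  (forall g h, P g -> P h -> P (fun x => g x * h x)) ->
  (forall i j, P (fun x => A x i j)) -> P (fun x => \det (A x)).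
Proof.
move=> Pe Pz PD PM PA.
have Psum (I : Type) (r : seq I) (f : I -> X -> K) :
    (forall i, P (f i)) -> P (fun x => \sum_(i <- r) f i x).
  move=> hf; elim: r => [|i r IH]; first by apply: Pe (Pz 0) => x; rewrite big_nil.
  by apply: Pe (PD _ _ (hf i) IH) => x; rewrite big_cons.
have Pprod (I : Type) (r : seq I) (f : I -> X -> K) :
    (forall i, P (f i)) -> P (fun x => \prod_(i <- r) f i x).
  move=> hf; elim: r => [|i r IH]; first by apply: Pe (Pz 1) => x; rewrite big_nil.
  by apply: Pe (PM _ _ (hf i) IH) => x; rewrite big_cons.
apply: Psum => s; apply: PM; last exact: Pprod.
apply: Pe (Pz ((-1) ^+ s)) => x; by rewrite rmorph_sign.
Qed.

Lemma All_mem (T : eqType) (P : T -> Prop) (s : seq T) : All P s <-> {in s, forall x, P x}.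
Proof.
elim: s => [|x s IH] /=; first by split.
rewrite IH; split=> [[Px Ps] y|h]; first by rewrite inE => /orP[/eqP->|/Ps].
by split=> [|y ys]; apply: h; rewrite inE ?eqxx ?ys ?orbT.
Qed.

Lemma seq_of_fun (I : finType) (f : I -> F) : exists x : seq F, forall i, x`_(enum_rank i) = f i.
Proof.
exists [seq f i | i <- enum I] => i.
by rewrite (nth_map i) ?nth_enum_rank // -cardE ltn_ord.
Qed.

Lemma nuR_scale lambda t : 0 < t -> lambda = 2 \/ lambda = 2^-1 ->
  exists t', 0 < t' /\ nu t' = lambda * nu t.
Proof.
move=> t0 [] ->.
  by exists (t * t); rewrite mulr_gt0 // nuR_sqr ?gt_eqF //; split=> //; ring.
have s0 : 0 < Num.sqrt t by rewrite sqrtr_gt0.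
exists (Num.sqrt t); split=> //.
have := nuR_sqr (lt0r_neq0 s0); rewrite -expr2 sqr_sqrtr ?ltW // => ->; lra.
Qed.

Definition sizes n (p : {set 'I_n} * {set 'I_n}) : bool := (#|p.1| + #|p.2| == n)%N.

(** The matrix is flattened into a sequence, and [scaling] rescales the valuations of all its
    maximal minors at once. *)
Lemma Gr_slice_scale n lambda (G : {set 'I_n} -> RR) : lambda = 2 \/ lambda = 2^-1 ->
  Gr_slice nu G -> Gr_slice nu (fun S => lambda * G S).
Proof.
move=> hl [M hM]; have l0 : 0 < lambda by case: hl => ->; lra.
pose mat (x : seq F) : 'M[F]_(n, n + n) := \matrix_(i, j) x`_(enum_rank (i, j)).
have [x hx] := seq_of_fun (fun p : 'I_n * 'I_(n + n) => M p.1 p.2).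
have matx : mat x = M by apply/matrixP => i j; rewrite mxE hx.
pose g (p : {set 'I_n} * {set 'I_n}) (x : seq F) := pluecker (mat x) (bcols p.1 p.2).
pose s := [seq p <- enum {: {set 'I_n} * {set 'I_n}} | sizes p].
have sP p : p \in s -> (#|p.1| + #|p.2| = n)%N by rewrite mem_filter => /andP[/eqP].
have pg (p : {set 'I_n} * {set 'I_n}) : (#|p.1| + #|p.2| = n)%N -> polyfun (g p).
  move=> hp; have hC : #|bcols p.1 p.2| = n by rewrite card_bcols.
  apply: (@polyfun_ext (fun x => \det (colsub (fun j => enum_val (cast_ord (esym hC) j)) (mat x)))).
    by move=> y; rewrite /g (plueckerE _ hC).
  apply: (@det_closed F (seq F) (@polyfun F) n
    (fun y => colsub (fun j => enum_val (cast_ord (esym hC) j)) (mat y))).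
  - exact: polyfun_ext.
  - exact: polyfun_int.
  - exact: polyfunD.
  - exact: polyfunM.
  - by move=> i j; apply: polyfun_ext (polyfun_nth _) => y; rewrite !mxE.
have [||y [_ /All_map/All_mem hy]] := scaling convex_nuR (gs := map g s) (x := x) l0
  (fun t t0 => nuR_scale t0 hl).
- by apply/All_map/All_mem => p /sP/pg.
- by apply/All_map/All_mem => p /sP hp; rewrite /g matx; case: (hM _ _ hp).
exists (mat y) => S T hST; have inS : (S, T) \in s.
  by rewrite mem_filter mem_enum /sizes hST eqxx.
have [h1 h2] := hy _ inS; split; first exact: h1.
by rewrite -(hM S T hST).2 -matx; exact: h2.
Qed.

(** The real and imaginary parts of the entries are the unknowns. Over the real field, [scaling] is
    applied to [sqnorm] of the minors, whose valuation is twice the wanted one. *)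
Lemma Gr_slice_scaleC n lambda (G : {set 'I_n} -> RR) : lambda = 2 \/ lambda = 2^-1 ->
  Gr_slice nuc G -> Gr_slice nuc (fun S => lambda * G S).
Proof.
move=> hl [M hM]; have l0 : 0 < lambda by case: hl => ->; lra.
pose mat (x : seq F) : 'M[F[i]]_(n, n + n) := \matrix_(i, j)
  (x`_(enum_rank (i, j, true)) +i* x`_(enum_rank (i, j, false)))%C.
have [x hx] := seq_of_fun (fun p : 'I_n * 'I_(n + n) * bool =>
  if p.2 then complex.Re (M p.1.1 p.1.2) else complex.Im (M p.1.1 p.1.2)).
have matx : mat x = M by apply/matrixP => i j; rewrite mxE !hx /=; case: (M i j).
pose g (p : {set 'I_n} * {set 'I_n}) (x : seq F) := sqnorm (pluecker (mat x) (bcols p.1 p.2)).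
pose s := [seq p <- enum {: {set 'I_n} * {set 'I_n}} | sizes p].
have sP p : p \in s -> (#|p.1| + #|p.2| = n)%N by rewrite mem_filter => /andP[/eqP].
have pg (p : {set 'I_n} * {set 'I_n}) : (#|p.1| + #|p.2| = n)%N -> polyfun (g p).
  move=> hp; have hC : #|bcols p.1 p.2| = n by rewrite card_bcols.
  suff [h1 h2] : cpolyfun (fun x => pluecker (mat x) (bcols p.1 p.2)).
    by apply: polyfun_ext (polyfunD (polyfunM h1 h1) (polyfunM h2 h2)) => y; rewrite -!expr2.
  apply: (@cpolyfun_ext (fun x => \det (colsub (fun j => enum_val (cast_ord (esym hC) j)) (mat x)))).
    by move=> y; rewrite (plueckerE _ hC).
  apply: (@det_closed F[i] (seq F) cpolyfun n
    (fun y => colsub (fun j => enum_val (cast_ord (esym hC) j)) (mat y))).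
  - exact: cpolyfun_ext.
  - exact: cpolyfun_int.
  - exact: cpolyfunD.
  - exact: cpolyfunM.
  - by move=> i j; split; apply: polyfun_ext (polyfun_nth _) => y; rewrite !mxE.
have [||y [_ /All_map/All_mem hy]] := scaling convex_nuR (gs := map g s) (x := x) l0
  (fun t t0 => nuR_scale t0 hl).
- by apply/All_map/All_mem => p /sP/pg.
- by apply/All_map/All_mem => p /sP hp; rewrite /g matx sqnorm_eq0; case: (hM _ _ hp).
exists (mat y) => S T hST; have inS : (S, T) \in s.
  by rewrite mem_filter mem_enum /sizes hST eqxx.
have [h1 h2] := hy _ inS; rewrite /g sqnorm_eq0 in h1; split; first exact: h1.
have [nz <-] := hM S T hST; move: h2; rewrite /g matx /= !nu_sqnorm //; lra.
Qed.

End Instances.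

(** * The theorem for both fields *)

Lemma thm41_of_scale (K : numFieldType) (cj : {rmorphism K -> K}) (nu : K -> RR) n :
  convex_valuation cj nu ->
  (forall lambda (G : {set 'I_n.+1} -> RR), lambda = 2 \/ lambda = 2^-1 ->
     Gr_slice nu G -> Gr_slice nu (fun S => lambda * G S)) ->
  thm41_conclusion cj nu n.+1.
Proof.
move=> nuP sc; apply: (thm41_of_scaling nuP) => G hG.
  have [M hM] := sc 2 G (or_introl erefl) hG; exists M => S T /hM[nz ->]; split=> //; lra.
have [M hM] := sc 2^-1 G (or_intror erefl) hG; exists M => S T /hM[nz ->]; split=> //; lra.
Qed.

Theorem theorem4p1 (F : rcfType) (val : F -> RR)
    (hval : is_valuation val) (hnontriv : nontrivial_valuation val)
    (hres : infinite_residue_field val) (hord : order_compatible val)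
    (n : nat) (hn : (0 < n)%N) :
  thm41_conclusion (K := F) id (nuR val) n /\
  thm41_conclusion (K := F[i]) (@conjc F) (nuC val) n.
Proof.
case: n hn => // n _; split.
  apply: (@thm41_of_scale F idfun (nuR val) n); first exact: convex_nuR.
  by move=> lambda G; apply: Gr_slice_scale.
apply: (@thm41_of_scale F[i] (@conjc F) (nuC val) n); first exact: convex_nuC.
by move=> lambda G; apply: Gr_slice_scaleC.
Qed.
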